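(* Let $V_*$ and $W_*$ be parabolic vector bundles on $X$ with parabolic structure over $S$ whose parabolic weights at each $x_i$ are integral multiples of $1/N_i$, let $\mathbb V$ and $\mathbb W$ be the corresponding orbifold vector bundles on $Y$, and let $k\ge0$. There is a natural isomorphism $$\mathrm{DO}^k(\mathbb V,\mathbb W)^\Gamma\ \xrightarrow{\ \sim\ }\ \mathrm{DO}^k_P(V_*,W_* ).$$
   Context: SETTING. $X$ is a compact connected Riemann surface; $S=\{x_1,\dots,x_n\}\subset X$ is a set of $n\ge 1$ distinct points (also the reduced divisor $\sum x_i$), with $n\ge 3$ if $X$ has genus $0$. For each $i$ fix an integer $N_i\ge2$. $X':=X\setminus S$, $F(kS):=F\otimes\mathcal O_X(kS)$. PARABOLIC BUNDLES. A parabolic bundle $V_*$ is a holomorphic vector bundle $V=V_0$ on $X$ with, at each $x_i$, a filtration $V_{x_i}=V_{i,1}\supset\cdots\supset V_{i,l_i}\supset V_{i,l_i+1}=0$ and weights $0\le\alpha_{i,1}<\cdots<\alpha_{i,l_i}<1$. Equivalently it is the decreasing filtered sheaf $(V_t)_{t\in\mathbb R}$: for $0\le t<1$, $V_t\subset V$ consists of sections $s$ with $s(x_i)\in V_{i,j}$, $j$ the smallest index with $\alpha_{i,j}\ge t$ ($s(x_i)=0$ if there is none), and $V_{t+1}=V_t(-S)$. Tensor product: $(V_*\otimes W_* )_t=\sum_{a+b=t}V_a\otimes W_b$ (inside sections on $X'$, meromorphic along $S$). COVERING. Fix a ramified Galois covering $\varphi:Y\to X$ with Galois group $\Gamma$,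 unramified over $X'$, with ramification order $N_i$ at every point over $x_i$; $Y':=\varphi^{-1}(X')$. An orbifold bundle on $Y$ is a holomorphic vector bundle with a lift of the $\Gamma$-action by holomorphic bundle automorphisms. Parabolic bundles $V_*$ with weights at $x_i$ in $\frac1{N_i}\mathbb Z$ correspond to orbifold bundles $\mathbb V$ by $V_t=\bigl(\varphi_*(\mathbb V\otimes\mathcal O_Y(\sum_i\lfloor -tN_i\rfloor\,\varphi^{-1}(x_i)_{\rm red}))\bigr)^\Gamma$; in particular $V_0=(\varphi_*\mathbb V)^\Gamma$. $\mathrm{DO}^k(\mathbb V,\mathbb W):=H^0(Y,\mathrm{Hom}(J^k(\mathbb V),\mathbb W))$ is the space of holomorphic differential operators of order $k$, on which $\Gamma$ acts. PARABOLIC DIFFERENTIAL OPERATORS. Let $\mathcal E_*$ be the parabolic bundle on $X$ corresponding to the orbifold bundle $Y\times\mathbb C[\Gamma]$; explicitly $\mathcal E_0=\varphi_*\mathcal O_Y$ and $\mathcal E_t=\varphi_*\mathcal O_Y(\sum_i\lfloor -tN_i\rfloor\varphi^{-1}(x_i)_{\rm red})$. On $X'$ the bundle $\mathcal E'_0=\varphi_*\mathcal O_{Y'}$ carries the flat holomorphic connection $\varphi_*d$ ($d$ the de Rham differential on $\mathcal O_{Y'}$), whose local flat sections give, for any holomorphic bundle $V'$ on $X'$, an isomorphism $J^k(V')\otimes\mathcal E_0'\cong J^k(V'\otimes\mathcal E'_0)$, $v\otimes u\mapsto v\otimes\widetilde u$ ($\widetilde u$ the local flat section through $u$). A homomorphism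 $D':J^k(V')\to W'$ on $X'$ therefore gives $\widetilde{D'}=D'\otimes\mathrm{Id}:J^k(V'\otimes\mathcal E'_0)\to W'\otimes\mathcal E_0'$. A holomorphic differential operator of order $k$ from $V_*$ to $W_*$ (over $X$) is a holomorphic homomorphism $D':J^k(V')\to W'$ over $X'$, with $V'=V_0|_{X'}$ and $W'=W_0|_{X'}$, such that $\widetilde{D'}$ extends to a holomorphic homomorphism $J^k((V_*\otimes\mathcal E_* )_0)\to(W_*\otimes\mathcal E_* )_0$ over all of $X$. $\mathrm{DO}^k_P(V_*,W_* )$ is the space of these. The natural isomorphism is the map sending $D\in\mathrm{DO}^k(\mathbb V,\mathbb W)^\Gamma$ to the operator defined by the restriction of the direct image $\varphi_*D:\varphi_*\mathbb V\to\varphi_*\mathbb W$ to $(\varphi_*\mathbb V)^\Gamma=V_0\to(\varphi_*\mathbb W)^\Gamma=W_0$. *)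

(* Defs.v *)
(* The complex numbers are [R[i]], with their usual topology carried by [R[i]^o]. *)
From HB Require Import structures.
From mathcomp Require Import all_boot all_order all_algebra all_fingroup.
From mathcomp Require Import all_classical all_reals all_analysis.
From mathcomp Require Import complex.

Set Implicit Arguments.
Unset Strict Implicit.
Unset Printing Implicit Defensive.

Import Order.TTheory GRing.Theory Num.Theory.
Import numFieldNormedType.Exports.

Local Open Scope classical_set_scope.
Local Open Scope complex_scope.
Local Open Scope ring_scope.

(* [fam T] is [forall p, T p] as a vector space.  Sections over an open set are
   represented by families over the whole base whose values outside of that
   open set are ignored. *)
Definition fam (K : pzRingType) (P : Type) (T : P -> lmodType K) : Type :=
  forall p, T p.

Section FamLmodule.
Variables (K : pzRingType) (P : Type) (T : P -> lmodType K).
Implicit Types s t : fam T.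

HB.instance Definition _ := gen_eqMixin (fam T).
HB.instance Definition _ := gen_choiceMixin (fam T).

Let fam_add s t : fam T := fun p => s p + t p.
Let fam_opp s : fam T := fun p => - s p.
Let fam_zero : fam T := fun p => 0.
Let fam_scale (a : K) s : fam T := fun p => a *: s p.

Let fam_addA : associative fam_add.
Proof. by move=> s t u; apply: functional_extensionality_dep => p; exact: addrA. Qed.
Let fam_addC : commutative fam_add.
Proof. by move=> s t; apply: functional_extensionality_dep => p; exact: addrC. Qed.
Let fam_add0 : left_id fam_zero fam_add.
Proof. by move=> s; apply: functional_extensionality_dep => p; exact: add0r. Qed.
Let fam_addN : left_inverse fam_zero fam_opp fam_add.
Proof. by move=> s; apply: functional_extensionality_dep => p; exact: addNr. Qed.

HB.instance Definition _ :=
  GRing.isZmodule.Build (fam T) fam_addA fam_addC fam_add0 fam_addN.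

Let fam_scaleA a b s : fam_scale a (fam_scale b s) = fam_scale (a * b) s.
Proof. by apply: functional_extensionality_dep => p; exact: scalerA. Qed.
Let fam_scale1 : left_id 1 fam_scale.
Proof. by move=> s; apply: functional_extensionality_dep => p; exact: scale1r. Qed.
Let fam_scaleDr : right_distributive fam_scale +%R.
Proof. by move=> a s t; apply: functional_extensionality_dep => p; exact: scalerDr. Qed.
Let fam_scaleDl s : {morph fam_scale^~ s : a b / a + b}.
Proof. by move=> a b; apply: functional_extensionality_dep => p; exact: scalerDl. Qed.

HB.instance Definition _ := GRing.Zmodule_isLmodule.Build K (fam T)
  fam_scaleA fam_scale1 fam_scaleDr fam_scaleDl.

End FamLmodule.

Definition holC_at (R : realType) (g : R[i]^o -> R[i]^o) (z : R[i]^o) : Prop :=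
  \forall z' \near z, derivable g z' 1.

Record chart (R : realType) (T : topologicalType) := Chart {
  dom : set T;
  crd :> T -> R[i]^o;
  chart_open : open dom;
  chart_cont : forall p, dom p -> {for p, continuous crd};
  chart_inj : forall p q, dom p -> dom q -> crd p = crd q -> p = q;
  chart_openmap : forall A : set T, open A -> A `<=` dom -> open (crd @` A)
}.

(* The coordinate change from [c] to [d] is holomorphic. *)
Definition hol_change (R : realType) (T : topologicalType) (c d : chart R T) : Prop :=
  forall p, dom c p -> dom d p ->
    exists2 g : R[i]^o -> R[i]^o,
      holC_at g (c p) & \forall q \near p, d q = g (c q).

Record riemannSurface (R : realType) := RiemannSurface {
  rs_space :> topologicalType;
  atlas : set (chart R rs_space);
  rs_hausdorff : hausdorff_space rs_space;
  rs_connected : connected [set: rs_space];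
  atlas_cover : forall p, exists2 c, atlas c & dom c p;
  atlas_compat : forall c d, atlas c -> atlas d -> hol_change c d
}.

Section RiemannSurfaceTheory.
Variables (R : realType) (X : riemannSurface R).

(* [f] is holomorphic in a neighbourhood of [p]. *)
Definition hol_at (p : X) (f : X -> R[i]^o) : Prop :=
  exists2 c : chart R X, atlas c /\ dom c p &
  exists2 g : R[i]^o -> R[i]^o,
    holC_at g (c p) & \forall q \near p, f q = g (c q).

Definition hol (U : set X) (f : X -> R[i]^o) : Prop :=
  forall p, U p -> hol_at p f.

(* [w] belongs to the maximal atlas, and is centered at [p]. *)
Definition coord_at (p : X) (w : chart R X) : Prop :=
  [/\ dom w p, w p = 0
    & forall c, atlas c -> hol_change c w /\ hol_change w c].

(* Holomorphic 1-forms, given in each chart [c] by [omega c] times the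
   differential of the coordinate. *)
Definition one_form (omega : chart R X -> X -> R[i]^o) : Prop :=
  (forall c, atlas c -> hol (dom c) (omega c)) /\
  (forall c d p (g : R[i]^o -> R[i]^o) (dg : R[i]^o),
     atlas c -> atlas d -> dom c p -> dom d p ->
     (\forall q \near p, d q = g (c q)) -> is_derive (c p : R[i]^o) 1 g dg ->
     omega c p = omega d p * dg).

(* The genus of a compact Riemann surface, as the dimension of the space of
   holomorphic 1-forms. *)
Definition has_genus (g : nat) : Prop :=
  exists2 b : 'I_g -> chart R X -> X -> R[i]^o,
    forall i, one_form (b i)
  & forall omega, one_form omega ->
      exists! a : 'rV[R[i]]_g, forall c p, atlas c -> dom c p ->
        omega c p = \sum_(i < g) a 0 i * b i c p.

End RiemannSurfaceTheory.

Definition hol_map (R : realType) (Y X : riemannSurface R) (f : Y -> X) : Prop :=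
  continuous f /\
  forall y (h : X -> R[i]^o), hol_at (f y) h -> hol_at y (h \o f).

(* A vector bundle is given by its fibres and by a set of local holomorphic
   frames with holomorphic transition matrices. *)
Record vbundle (R : realType) (X : riemannSurface R) := VBundle {
  fib :> X -> lmodType R[i];
  rk : nat;
  frames : set (set X * (forall x, 'I_rk -> fib x));
  frame_cover : forall x, exists2 F, frames F & F.1 x;
  frame_open : forall F, frames F -> open F.1;
  frame_basis : forall F, frames F -> forall x, F.1 x -> forall v : fib x,
    exists! a : 'rV[R[i]]_rk, v = \sum_(i < rk) a 0 i *: F.2 x i;
  frame_change : forall F G, frames F -> frames G ->
    exists2 a : 'I_rk -> 'I_rk -> X -> R[i]^o,
      forall i j, hol (F.1 `&` G.1) (a i j)
    & forall x j, F.1 x -> G.1 x -> G.2 x j = \sum_(i < rk) a i j x *: F.2 x i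
}.

(* A vector, seen in the total space of the bundle. *)
Definition in_total (R : realType) (X : riemannSurface R) (E : vbundle X) (x : X)
    (v : E x) : {x : X & E x} := Tagged (fun x => E x : Type) v.

Section Sections.
Variables (R : realType) (X : riemannSurface R) (E : vbundle X).

(* [s] is a holomorphic section of [E] in a neighbourhood of [x]. *)
Definition hsec_at (x : X) (s : fam E) : Prop :=
  exists2 F, frames F /\ F.1 x &
  exists2 a : 'I_(rk E) -> X -> R[i]^o,
    forall i, hol_at x (a i)
  & \forall y \near x, s y = \sum_(i < rk E) a i y *: F.2 y i.

Definition hsec (U : set X) (s : fam E) : Prop := forall x, U x -> hsec_at x s.

End Sections.

(* An O_X-module presented by its sections: a section over [U] is a family of
   vectors indexed by the points of [om_dom] lying above [U], functions on [X]
   acting through [om_proj].  With [om_proj] the identity this covers vector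
   bundles on [X]; with a covering map it covers direct images. *)
Record omodule (R : realType) (X : riemannSurface R) := OModule {
  om_pt : Type;
  om_proj : om_pt -> X;
  om_dom : set om_pt;
  om_fib : om_pt -> lmodType R[i];
  om_sec : set X -> set (fam om_fib)
}.

Section Germs.
Variables (R : realType) (X : riemannSurface R) (F : omodule X).
Local Notation famF := (fam (@om_fib R X F)).

Definition om_near (x : X) (s t : famF) : Prop :=
  \forall x' \near x, forall p, om_dom p -> om_proj p = x' -> s p = t p.

(* [s] represents an element of the stalk F_x. *)
Definition germ (x : X) : set famF :=
  [set s | exists2 U : set X, open U /\ U x & om_sec U s].

(* [mpow m x] is m_x^m F_x, where m_x is the maximal ideal of O_{X,x}. *)
Fixpoint mpow (m : nat) (x : X) : set famF :=
  match m with
  | 0 => germ x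
  | m'.+1 => [set s |
      exists (l : nat) (f : 'I_l -> X -> R[i]^o) (t : 'I_l -> famF),
        (forall i, [/\ hol_at x (f i), f i x = 0 & mpow m' x (t i)]) /\
        om_near x s ((fun p => \sum_(i < l) f i (om_proj p) *: t i p) : famF)]
  end.

End Germs.
Arguments germ {R X} F x _.
Arguments mpow {R X} F m x _.

Section Jets.
Variables (R : realType) (X : riemannSurface R).

(* Holomorphic homomorphisms J^k(F) -> G over [X], for locally free F and G.
   The fibres at x are J^k(F)_x = F_x / m_x^(k+1) F_x and F_x / m_x F_x, so that
   such a homomorphism is a collection of linear maps
   F_x / m_x^(k+1) F_x -> G_x / m_x G_x which sends (the k-jets of) local sections
   of F to local sections of G.  Here [L x s] is a representative in G_x of the
   image of the k-jet of [s] at [x]. *)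
Definition jet_hom (k : nat) (F G : omodule X)
    (L : X -> fam (@om_fib R X F) -> fam (@om_fib R X G)) : Prop :=
  [/\ forall x s, germ F x s -> germ G x (L x s),
      forall x (a : R[i]) s t, germ F x s -> germ F x t ->
        mpow G 1 x (L x (a *: s + t) - (a *: L x s + L x t)),
      forall x s, germ F x s -> mpow F k.+1 x s -> mpow G 1 x (L x s)
    & forall (U : set X) s, open U -> om_sec U s ->
        exists2 t, om_sec U t & forall x, U x -> mpow G 1 x (L x s - t)].

Definition bundle_omodule (E : vbundle X) : omodule X :=
  @OModule R X X id setT E (hsec (E := E)).

(* H^0(A, Hom(J^k(E), F)) for vector bundles E and F and an open subset A of X.
   Its elements are families of linear maps J^k(E)_x -> F_x, for x in A, as above,
   where the fibre F_x now is available.  The first clause only normalizes the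
   irrelevant values, so that equal homomorphisms are equal families. *)
Definition DO (A : set X) (k : nat) (E F : vbundle X) :
    set (fam (fun x : X => (fam E -> F x) : lmodType R[i])) :=
  [set D | [/\ forall x s, ~ (A x /\ hsec_at x s) -> D x s = 0,
      forall x (a : R[i]) s t, A x -> hsec_at x s -> hsec_at x t ->
        D x (a *: s + t) = a *: D x s + D x t,
      forall x s, A x -> hsec_at x s -> mpow (bundle_omodule E) k.+1 x s ->
        D x s = 0
    & forall (U : set X) s, open U -> U `<=` A -> hsec U s ->
        hsec U ((fun x => D x s) : fam F)]].

End Jets.
Arguments DO {R X} A k E F _.

Definition punctured (R : realType) (X : riemannSurface R) (n : nat)
    (pt : 'I_n -> X) : set X := [set x | forall i, pt i <> x].

(* [par_flag i j] is V_{i,j+1} and [par_weight i j] is alpha_{i,j+1}. *)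
Record parBundle (R : realType) (X : riemannSurface R) (n : nat)
    (pt : 'I_n -> X) := ParBundle {
  par_bundle :> vbundle X;
  par_len : 'I_n -> nat;
  par_flag : forall i : 'I_n, nat -> set (par_bundle (pt i));
  par_weight : 'I_n -> nat -> R;
  par_flag_sub : forall i j, (j <= par_len i)%N ->
    @par_flag i j 0 /\ forall (a : R[i]) u v,
      @par_flag i j u -> @par_flag i j v -> @par_flag i j (a *: u + v);
  par_flag0 : forall i, @par_flag i 0%N = setT;
  par_flag_len : forall i, @par_flag i (par_len i) = [set 0];
  par_flag_dec : forall i j, (j < par_len i)%N ->
    @par_flag i j.+1 `<=` @par_flag i j;
  par_weight_range : forall i j, (j < par_len i)%N -> 0 <= par_weight i j < 1;
  par_weight_inc : forall i j j', (j < j')%N -> (j' < par_len i)%N ->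
    par_weight i j < par_weight i j'
}.
Arguments par_flag {R X n pt} p i j _.

Section Parabolic.
Variables (R : realType) (X : riemannSurface R) (n : nat) (pt : 'I_n -> X).

Definition weights_in (N : 'I_n -> nat) (V : parBundle pt) : Prop :=
  forall i j, (j < par_len V i)%N ->
    exists m : int, par_weight V i j = m%:~R / (N i)%:R.

(* For 0 <= t < 1: the member of the flag at x_i given by the smallest index
   whose weight is >= t, and 0 if there is none. *)
Definition par_fil (V : parBundle pt) (i : 'I_n) (t : R) : set (V (pt i)) :=
  [set v | exists2 j, par_flag V i j v &
     [/\ (j <= par_len V i)%N, forall j', (j' < j)%N -> par_weight V i j' < t
       & (j < par_len V i)%N -> t <= par_weight V i j]].
Arguments par_fil : clear implicits.

(* Sections over [U] of V_t = V_{t - floor t}(- floor t S), as sections over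
   [U] minus S: near [x] they are z^m tau with z a coordinate centered at x, m the
   multiplicity of x in floor t S, and tau a holomorphic section of V whose
   value at [x], if x = x_i, is in the relevant member of the flag. *)
Definition par_sec (V : parBundle pt) (t : R) (U : set X) : set (fam V) :=
  [set s | forall x, U x -> exists (z : chart R X) (tau : fam V),
    [/\ coord_at x z, hsec (dom z) tau,
        forall p, dom z p -> punctured pt p ->
          s p = (z p ^ (\sum_(i < n | pt i == x) Num.floor t)) *: tau p
      & forall i, pt i = x -> par_fil V i (t - (Num.floor t)%:~R) (tau (pt i))]].

End Parabolic.

Definition ramified_at (R : realType) (Y X : riemannSurface R) (f : Y -> X)
    (y : Y) (e : nat) : Prop :=
  exists (w : chart R Y) (z : chart R X),
    [/\ coord_at y w, coord_at (f y) z, f @` dom w `<=` dom z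
      & forall p, dom w p -> z (f p) = w p ^+ e].

Record galoisCover (R : realType) (X Y : riemannSurface R) (n : nat)
    (pt : 'I_n -> X) (N : 'I_n -> nat) (Gam : finGroupType) := GaloisCover {
  cov :> Y -> X;
  deck : Gam -> Y -> Y;
  cov_hol : hol_map cov;
  cov_surj : forall x, exists y, cov y = x;
  cov_ram : forall y i, cov y = pt i -> ramified_at cov y (N i);
  cov_unram : forall y, punctured pt (cov y) -> ramified_at cov y 1;
  deck1 : forall y, deck 1%g y = y;
  deckM : forall g h y, deck (g * h)%g y = deck g (deck h y);
  deck_hol : forall g, hol_map (deck g);
  deck_cov : forall g y, cov (deck g y) = cov y;
  deck_faithful : forall g, (forall y, deck g y = y) -> g = 1%g;
  deck_full : forall f : Y -> Y, bijective f -> hol_map f ->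
    (forall y, cov (f y) = cov y) -> exists g, forall y, f y = deck g y;
  deck_trans : forall y y', cov y = cov y' -> exists g, y' = deck g y
}.

Record orbBundle (R : realType) (X Y : riemannSurface R) (n : nat)
    (pt : 'I_n -> X) (N : 'I_n -> nat) (Gam : finGroupType)
    (phi : galoisCover Y pt N Gam) := OrbBundle {
  orb_bundle :> vbundle Y;
  orb_act : forall (g : Gam) (y : Y),
    {linear orb_bundle y -> orb_bundle (deck phi g y)};
  orb_act1 : forall y (v : orb_bundle y),
    in_total (orb_act 1%g y v) = in_total v;
  orb_actM : forall g h y (v : orb_bundle y),
    in_total (orb_act (g * h)%g y v) =
    in_total (orb_act g (deck phi h y) (orb_act h y v));
  orb_act_hol : forall g y (s t : fam orb_bundle), hsec_at y s ->
    (forall p, t (deck phi g p) = orb_act g p (s p)) -> hsec_at (deck phi g y) t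
}.

Section Correspondence.
Variables (R : realType) (X Y : riemannSurface R) (n : nat) (pt : 'I_n -> X).
Variables (N : 'I_n -> nat) (Gam : finGroupType) (phi : galoisCover Y pt N Gam).

(* Multiplicity at [y] of the divisor sum_i floor(- t N_i) phi^{-1}(x_i)_red. *)
Definition orb_div (t : R) (y : Y) : int :=
  \sum_(i < n | pt i == phi y) Num.floor (- t * (N i)%:R).

(* Sections over [U] of phi_*(T (x) O_Y(sum_i floor(- t N_i) phi^{-1}(x_i)_red)),
   as families over the preimage of [U] minus S; [H] tells which families are
   holomorphic sections of [T]. *)
Definition direct_image_sec (T : Y -> lmodType R[i]) (H : set Y -> set (fam T))
    (t : R) (U : set X) : set (fam T) :=
  [set s | forall y, U (phi y) -> exists (w : chart R Y) (tau : fam T),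
    [/\ coord_at y w, H (dom w) tau
      & forall p, dom w p -> punctured pt (phi p) ->
          s p = (w p ^ (- orb_div t y)) *: tau p]].

Definition orb_sec (VV : orbBundle phi) : R -> set X -> set (fam VV) :=
  direct_image_sec (hsec (E := VV)).

Definition pull (V : parBundle pt) (VV : orbBundle phi)
    (iota : forall y, {linear V (phi y) -> VV y}) (s : fam V) : fam VV :=
  fun y => iota y (s (phi y)).

(* [V] is the parabolic bundle corresponding to [VV].  Over the complement of S,
   where phi is etale, the isomorphism V_0 = (phi_* VV)^Gam amounts to a
   Gam-equivariant isomorphism phi^* V = VV, and it has to identify V_t with
   (phi_*(VV (x) O_Y(sum_i floor(- t N_i) phi^{-1}(x_i)_red)))^Gam for all t. *)
Record corresponds (V : parBundle pt) (VV : orbBundle phi) := Corresponds {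
  orb_iso :> forall y, {linear V (phi y) -> VV y};
  orb_iso_bij : forall y, punctured pt (phi y) -> bijective (orb_iso y);
  orb_iso_equiv : forall g y (s : fam V), punctured pt (phi y) ->
    orb_act VV g y (pull orb_iso s y) = pull orb_iso s (deck phi g y);
  orb_iso_fil : forall t (U : set X) (s : fam V), open U ->
    par_sec t U s <-> orb_sec t U (pull orb_iso s)
}.

(* Invariance under D |-> g D g^{-1}; [t] is the translate g s. *)
Definition DO_inv (k : nat) (VV WW : orbBundle phi) :
    set (fam (fun y : Y => (fam VV -> WW y) : lmodType R[i])) :=
  DO setT k VV WW `&`
  [set D | forall g y (s t : fam VV), hsec_at y s ->
     (forall p, t (deck phi g p) = orb_act VV g p (s p)) ->
     D (deck phi g y) t = orb_act WW g y (D y s)].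

Definition cE_sec : R -> set X -> set (fam (fun _ : Y => R[i]^o : lmodType R[i])) :=
  direct_image_sec (T := fun _ => R[i]^o) (@hol R Y).

(* Sections over [U] of (V_* (x) E_* )_t = sum_{a + b = t} V_a (x) E_b, inside
   the sections over [U] minus S of V (x) phi_* O_Y = phi_* phi^* V; the latter
   are families [sig y] in the fibres V_{phi y}, and s (x) f is
   [fun y => f y *: s (phi y)]. *)
Definition tensE_sec (V : parBundle pt) (t : R) (U : set X) :
    set (fam (fun y : Y => V (phi y))) :=
  [set sig | forall x, U x -> exists2 U' : set X, open U' /\ U' x &
    exists (l : nat) (a b : 'I_l -> R) (s : 'I_l -> fam V)
           (f : 'I_l -> fam (fun _ : Y => R[i]^o : lmodType R[i])),
      (forall j, [/\ a j + b j = t, par_sec (a j) U' (s j) & cE_sec (b j) U' (f j)])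
      /\ forall y, U' (phi y) -> punctured pt (phi y) ->
           sig y = \sum_(j < l) (f j y : R[i]) *: s j (phi y)].

Definition tensE (V : parBundle pt) : omodule X :=
  @OModule R X Y phi [set y | punctured pt (phi y)] (fun y => V (phi y))
    (tensE_sec (V := V) 0).

(* Flat sections near [x] of (phi_* O, phi_* d), i.e. functions with zero
   derivative. *)
Definition flat_at (x : X) (u : Y -> R[i]^o) : Prop :=
  exists2 U : set X, open U /\ U x &
    forall y, U (phi y) -> \forall p \near y, u p = u y.

(* D' (x) Id extends to Dhat on X.  Over the complement of S, D' (x) Id is the
   homomorphism on J^k(V' (x) E'_0) = J^k(V') (x) E'_0 which sends the jet of
   s (x) u, for a local section s of V' and a flat u, to D'(s) (x) u. *)
Definition extends_tilde (V W : parBundle pt)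
    (D' : fam (fun x : X => (fam V -> W x) : lmodType R[i]))
    (Dhat : X -> fam (fun y : Y => V (phi y)) -> fam (fun y : Y => W (phi y))) : Prop :=
  forall y (s : fam V) (u : Y -> R[i]^o),
    punctured pt (phi y) -> hsec_at (phi y) s -> flat_at (phi y) u ->
    Dhat (phi y) (fun p => (u p : R[i]) *: s (phi p)) y = (u y : R[i]) *: D' (phi y) s.

Definition DO_par (k : nat) (V W : parBundle pt) :
    set (fam (fun x : X => (fam V -> W x) : lmodType R[i])) :=
  DO (punctured pt) k V W `&`
  [set D' | exists2 Dhat, jet_hom k (F := tensE V) (G := tensE W) Dhat
                        & extends_tilde D' Dhat].

End Correspondence.
Arguments DO_inv {R X Y n pt N Gam phi} k VV WW _.
Arguments DO_par {R X Y n pt N Gam} phi k V W _.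

(* Main.v *)
(* Over [X'] the covering is unramified and sections of [VV] are locally pull-backs of
   sections of [V], so that invariant operators on [Y'] and operators on [X'] determine
   each other; the point is what happens over [S].
   At a ramification point holomorphic functions vanishing there are divisible by a
   coordinate (removable singularities, from a Goursat lemma for midpoint sums). Averaging
   over the deck group and over the powers of a coordinate yields
   [(V (x) E)_0 = phi_* VV]. Hence the extension of [D'] to [(V (x) E)_0] is the same thing
   as an operator on [VV] over all of [Y]. Its order is at most [k] also at the ramification
   points, and likewise for the filtration by powers of [m_x] on [phi_* VV]: this goes by
   induction on the order through the commutators of the operator with functions. *)

Require Import Defs.
From HB Require Import structures.
From mathcomp Require Import all_boot all_order all_algebra all_fingroup.
From mathcomp Require Import all_classical all_reals all_analysis.
From mathcomp Require Import complex.
From mathcomp Require Import ring lra zify.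
Set Implicit Arguments.
Unset Strict Implicit.
Unset Printing Implicit Defensive.
Import Order.TTheory GRing.Theory Num.Theory.
Import numFieldNormedType.Exports.
Local Open Scope classical_set_scope.
Local Open Scope complex_scope.
Local Open Scope ring_scope.
Import ComplexField.Normc.
Local Notation dom := Defs.dom.

(** Holomorphy is complex differentiability near a point. The one substantial fact drawn from it is
    that a coordinate generates the maximal ideal of a point. It makes twists independent of the
    coordinate that defines them and, with the connectedness of [Y], makes the deck group act freely
    over [X']. The correspondence of [V] and [VV] is given on sections only; even the holomorphy of
    the isomorphism over [X'] has to be read off from the case t = 0. The orders need care at a
    point y over x with ramification order e > 1, where m_x O_Y = m_y^e. For the direct image of D
    it is not enough that sections in m_x^(k+1) have images vanishing at y: the images must lie in
    m_x (W (x) E)_0, so the commutators are taken with functions coming from [X]. Conversely the jet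
    condition at x speaks only of m_y^(e(k+1)); that a lifted operator kills all of m_y^(k+1) is
    carried over from the neighbouring unramified points. *)

Section NumFieldFunctions.
Variable K : numFieldType.
Implicit Types (f g : K^o -> K^o) (p : K^o).

Lemma fderivableM f g p : derivable f p 1 -> derivable g p 1 ->
  derivable (fun z => f z * g z : K^o) p 1.
Proof. exact: derivableM. Qed.

Lemma fderivableD f g p : derivable f p 1 -> derivable g p 1 ->
  derivable (fun z => f z + g z : K^o) p 1.
Proof. exact: derivableD. Qed.

Lemma fderivableB f g p : derivable f p 1 -> derivable g p 1 ->
  derivable (fun z => f z - g z : K^o) p 1.
Proof. exact: derivableB. Qed.

Lemma fderivableV f p : f p != 0 -> derivable f p 1 -> derivable (fun z => (f z)^-1 : K^o) p 1.
Proof. exact: derivableV. Qed.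

Lemma fderivable_comp f g p : derivable f p 1 -> derivable g (f p) 1 ->
  derivable (fun z => g (f z)) p 1.
Proof.
move=> /derivable1_diffP hf /derivable1_diffP hg; apply/derivable1_diffP.
exact: differentiable_comp.
Qed.

Lemma fderivable_cst (c : K^o) p : derivable (fun z : K^o => c) p 1.
Proof. exact: derivable_cst. Qed.

Lemma fderivable_id p : derivable (fun z : K^o => z) p 1.
Proof. exact: derivable_id. Qed.

Lemma fcontM f g p : {for p, continuous f} -> {for p, continuous g} ->
  {for p, continuous (fun z => f z * g z : K^o)}.
Proof. by move=> hf hg; exact: (cvgM hf hg). Qed.

Lemma fcontB f g p : {for p, continuous f} -> {for p, continuous g} ->
  {for p, continuous (fun z => f z - g z : K^o)}.
Proof. by move=> hf hg; exact: (cvgB hf hg). Qed.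

Lemma fderivable_cont f p : derivable f p 1 -> {for p, continuous f}.
Proof. by move=> /derivable1_diffP/differentiable_continuous. Qed.
End NumFieldFunctions.

(** * Goursat's lemma for midpoint sums *)

Section DiscreteGoursat.
Variable R : realType.
Local Notation C := R[i].
Local Notation re := (@complex.Re R).
Local Notation im := (@complex.Im R).
Implicit Types F G : C -> C.

(** The composite midpoint rule with 2^n equal pieces for the integral of [F] along the segment from
    [c] to [c + e]. It stands in for the contour integral. *)
Fixpoint msum F (n : nat) (c e : C) : C :=
  if n is m.+1 then msum F m c (e / 2) + msum F m (c + e / 2) (e / 2)
  else F (c + e / 2) * e.

Definition csum F n (c s : C) : C :=
  msum F n c s + msum F n (c + s) (s * 'i) - msum F n (c + s * 'i) s
  - msum F n c (s * 'i).

(** The inner edges cancel exactly, without passage to a limit: level [n.+1] on a side is by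
    definition level [n] on its two halves, and neighbouring quarters use the same sum on their
    common edge. *)
Lemma csumS F n c s : csum F n.+1 c s =
  csum F n c (s / 2) + csum F n (c + s / 2) (s / 2)
  + csum F n (c + s / 2 * 'i) (s / 2) + csum F n (c + s / 2 + s / 2 * 'i) (s / 2).
Proof.
rewrite /csum /=.
have -> : s * 'i / 2 = s / 2 * 'i by ring.
set h := s / 2; have -> : s = h + h by rewrite /h; field.
have -> : c + (h + h) + h * 'i = c + h + h * 'i + h by ring.
have -> : c + (h + h) = c + h + h by ring.
have -> : c + (h + h) * 'i + h = c + h + h * 'i + h * 'i by ring.
have -> : c + (h + h) * 'i = c + h * 'i + h * 'i by ring.
have -> : c + h * 'i + h = c + h + h * 'i by ring.
ring.
Qed.

Lemma normc_ge0 (z : C) : 0 <= normc z.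
Proof. by case: z => a b; exact: sqrtr_ge0. Qed.

Lemma normcE (z : C) : `|z| = (normc z)%:C.
Proof. by case: z. Qed.

Lemma normc_real (x : R) : normc x%:C = `|x|.
Proof. by rewrite /= expr0n addr0 sqrtr_sqr. Qed.

Lemma normc_i : normc ('i%C : C) = 1.
Proof. by rewrite /= expr0n add0r expr1n sqrtr1. Qed.

Lemma normcB_le (y z : C) : normc (y - z) <= normc y + normc z.
Proof. by rewrite -(normcN z); exact: le_normcD. Qed.

Lemma normc_half (e : C) : normc (e / 2) = normc e / 2.
Proof.
rewrite normcM normcV; congr (_ / _).
by have -> : (2 : C) = (2 : R)%:C; [rewrite rmorphMn|rewrite normc_real ger0_norm].
Qed.

Lemma normc_le_ReIm (z : C) : normc z <= `|re z| + `|im z|.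
Proof.
case: z => a b /=; rewrite -[leRHS]ger0_norm ?addr_ge0// -sqrtr_sqr ler_wsqrtr//.
by rewrite sqrrD !real_normK ?num_real// lerD2r lerDl mulrn_wge0 ?mulr_ge0.
Qed.

Lemma Re_le_normc (z : C) : `|re z| <= normc z.
Proof. by case: z => a b /=; rewrite -sqrtr_sqr ler_wsqrtr// lerDl sqr_ge0. Qed.

Lemma Im_le_normc (z : C) : `|im z| <= normc z.
Proof. by case: z => a b /=; rewrite -sqrtr_sqr ler_wsqrtr// lerDr sqr_ge0. Qed.

Definition seg (c e z : C) := exists2 t : R, 0 <= t <= 1 & z = c + t%:C * e.

Let half2 : (2^-1 : C) = (2^-1 : R)%:C.
Proof. by rewrite fmorphV rmorphMn. Qed.

Lemma seg_l c e z : seg c (e / 2) z -> seg c e z.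
Proof.
case=> t t01 ->; exists (t / 2); first by lra.
by rewrite rmorphM /= -half2; ring.
Qed.

Lemma seg_r c e z : seg (c + e / 2) (e / 2) z -> seg c e z.
Proof.
case=> t t01 ->; exists (t / 2 + 2^-1); first by lra.
by rewrite rmorphD rmorphM /= -half2; ring.
Qed.

Lemma seg_mid c e : seg c e (c + e / 2).
Proof. by exists 2^-1; [lra|rewrite -half2; ring]. Qed.

Lemma msum_le F n c e M : (forall z, seg c e z -> normc (F z) <= M) ->
  normc (msum F n c e) <= normc e * M.
Proof.
elim: n c e => [|n IH] c e H /=.
  by rewrite normcM mulrC ler_wpM2l ?normc_ge0 ?H//; exact: seg_mid.
apply: (le_trans (le_normcD _ _)).
rewrite (le_trans (lerD (IH _ _ _) (IH _ _ _)))//.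
- by move=> z /seg_l; exact: H.
- by move=> z /seg_r; exact: H.
- by rewrite normc_half; lra.
Qed.

Lemma msum_Im_ge F n c e m : (forall z, seg c e z -> m <= im (F z * e)) ->
  m <= im (msum F n c e).
Proof.
elim: n c e m => [|n IH] c e m H /=; first by apply: H; exact: seg_mid.
have Im_half (w : C) : im (w * (e / 2)) = im (w * e) / 2.
  have -> : w * (e / 2) = (w * e) * (2^-1 : R)%:C by rewrite -half2; ring.
  by case: (w * e) => p q /=; ring.
have ImD (u v : C) : im (u + v) = im u + im v by case: u v => ? ? [].
rewrite ImD (splitr m) lerD// IH// => z hz; rewrite Im_half ler_pM2r ?invr_gt0//.
- by apply/H/seg_l.
- by apply/H/seg_r.
Qed.

Lemma msumB F G n c e :
  msum (fun z => F z - G z) n c e = msum F n c e - msum G n c e.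
Proof. by elim: n c e => [|n IH] c e /=; [ring|rewrite !IH; ring]. Qed.

Lemma msumZ F k n c e : msum (fun z => k * F z) n c e = k * msum F n c e.
Proof. by elim: n c e => [|n IH] c e /=; [ring|rewrite !IH; ring]. Qed.

(** The midpoint rule is exact on affine functions. This is why midpoints are used: the first order
    part of [F] drops out of square sums with no error term. *)
Lemma msum_affine k l n c e :
  msum (fun z => k + l * z) n c e = e * (k + l * (c + e / 2)).
Proof. by elim: n c e => [|n IH] c e /=; [ring|rewrite !IH; field]. Qed.

Lemma eq_msum F G n c e : (forall z, seg c e z -> F z = G z) ->
  msum F n c e = msum G n c e.
Proof.
elim: n c e => [|n IH] c e H /=; first by rewrite H//; exact: seg_mid.
by congr (_ + _); apply: IH => z hz; apply: H; [exact: seg_l|exact: seg_r].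
Qed.

Definition insq (x y s : R) (z : C) := (x <= re z <= x + s) && (y <= im z <= y + s).

Definition onsq (x y s : R) (z : C) := insq x y s z /\
  (re z = x \/ re z = x + s \/ im z = y \/ im z = y + s).

Definition qsum F n (x y s : R) := csum F n (x +i* y) s%:C.

Lemma onsq_seg x y s z : 0 < s -> let c := x +i* y in let s' := s%:C in
  [\/ seg c s' z, seg (c + s') (s' * 'i) z, seg (c + s' * 'i) s' z
    | seg c (s' * 'i) z] -> onsq x y s z.
Proof.
move=> s0 c s'; rewrite /seg /onsq /insq /c /s'.
have b t : 0 <= t <= 1 -> 0 <= t * s <= s by move=> ?; nra.
by case=> -[t /b tb ->] /=; (split; first lra);
  [right; right; left|right; left|right; right; right|left]; ring.
Qed.

Lemma qsum_le F n x y s M : 0 < s ->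
  (forall z, onsq x y s z -> normc (F z) <= M) -> normc (qsum F n x y s) <= 4 * s * M.
Proof.
move=> s0 H; have Hs := fun z h => H z (onsq_seg s0 h).
have ns : normc s%:C = s by rewrite normc_real gtr0_norm.
have nsi : normc (s%:C * 'i) = s by rewrite normcM ns normc_i mulr1.
rewrite /qsum /csum.
have := @msum_le F n (x +i* y) s%:C M; rewrite ns.
have := @msum_le F n (x +i* y + s%:C) (s%:C * 'i) M; rewrite nsi.
have := @msum_le F n (x +i* y + s%:C * 'i) s%:C M; rewrite ns.
have := @msum_le F n (x +i* y) (s%:C * 'i) M; rewrite nsi.
move=> h4 h3 h2 h1.
have {}h1 := h1 (fun z h => Hs z (Or41 _ _ _ h)).
have {}h2 := h2 (fun z h => Hs z (Or42 _ _ _ h)).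
have {}h3 := h3 (fun z h => Hs z (Or43 _ _ _ h)).
have {}h4 := h4 (fun z h => Hs z (Or44 _ _ _ h)).
apply: (le_trans (normcB_le _ _)); apply: (le_trans (lerD (normcB_le _ _) (lexx _))).
apply: (le_trans (lerD (lerD (le_normcD _ _) (lexx _)) (lexx _))).
by lra.
Qed.

Lemma eq_qsum F G n x y s : 0 < s -> (forall z, onsq x y s z -> F z = G z) ->
  qsum F n x y s = qsum G n x y s.
Proof.
move=> s0 H; have Hs := fun z h => H z (onsq_seg s0 h).
rewrite /qsum /csum; congr (_ + _ - _ - _); apply: eq_msum => z h; apply: Hs.
- exact: Or41.
- exact: Or42.
- exact: Or43.
- exact: Or44.
Qed.

Lemma qsumB F G n x y s :
  qsum (fun z => F z - G z) n x y s = qsum F n x y s - qsum G n x y s.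
Proof. by rewrite /qsum /csum !msumB; ring. Qed.

Lemma qsumZ F k n x y s : qsum (fun z => k * F z) n x y s = k * qsum F n x y s.
Proof. by rewrite /qsum /csum !msumZ; ring. Qed.

Lemma qsum_affine k l n x y s : qsum (fun z => k + l * z) n x y s = 0.
Proof. by rewrite /qsum /csum !msum_affine; field. Qed.

Lemma qsumS F n x y s : qsum F n.+1 x y s =
  qsum F n x y (s / 2) + qsum F n (x + s / 2) y (s / 2)
  + qsum F n x (y + s / 2) (s / 2) + qsum F n (x + s / 2) (y + s / 2) (s / 2).
Proof.
rewrite /qsum csumS; have -> : s%:C / 2 = (s / 2)%:C by rewrite rmorphM /= half2.
by congr (csum _ _ _ _ + csum _ _ _ _ + csum _ _ _ _ + csum _ _ _ _) => /=;
  apply/eqP; rewrite eq_complex /=; apply/andP; split; apply/eqP; ring.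
Qed.

(* Each side of the square contributes at least [1] to the imaginary part. *)
Lemma qsum_inv_ge n r : 0 < r ->
  4 <= normc (qsum (fun z => z^-1) n (- r) (- r) (2 * r)).
Proof.
move=> r0; apply: le_trans (Im_le_normc _); apply: le_trans (ler_norm _).
rewrite /qsum /csum.
have imB (u v : C) : im (u - v) = im u - im v by case: u v => ? ? [].
have imD (u v : C) : im (u + v) = im u + im v by case: u v => ? ? [].
set e := (2 * r)%:C; set c0 := - r +i* - r.
have hN c f : - im (msum (fun z => z^-1) n c f) = im (msum (fun z => - 1 * z^-1) n c f).
  by rewrite msumZ; case: (msum _ _ _ _) => p q /=; ring.
have ge1 (p q s : R) : p ^+ 2 <= r ^+ 2 -> q ^+ 2 = r ^+ 2 -> s = r ->
    1 <= 2 * r * s / (p ^+ 2 + q ^+ 2).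
  by move=> h1 h2 ->; rewrite ler_pdivlMr; nra.
have tr t : 0 <= t <= 1 -> (2 * r * t - r) ^+ 2 <= r ^+ 2.
  move=> /andP[t0 t1]; rewrite -subr_ge0.
  have -> : r ^+ 2 - (2 * r * t - r) ^+ 2 = 4 * r ^+ 2 * (t * (1 - t)) by ring.
  by rewrite !mulr_ge0 ?subr_ge0 ?sqr_ge0 ?(ltW r0).
have ev k (p q : R) :
    im ((k * (p +i* q)^-1) * e) = 2 * r * (im k * p - re k * q) / (p ^+ 2 + q ^+ 2).
  by case: k => k1 k2 /=; ring.
have evi k (p q : R) :
    im ((k * (p +i* q)^-1) * (e * 'i)) = 2 * r * (re k * p + im k * q) / (p ^+ 2 + q ^+ 2).
  by case: k => k1 k2 /=; ring.
have ceq (a b a' b' : R) : a = a' -> b = b' -> a +i* b = a' +i* b' by move=> -> ->.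
have h1 : 1 <= im (msum (fun z => z^-1) n c0 e).
  apply: msum_Im_ge => z [t /tr tb ->]; rewrite -[_^-1]mul1r.
  have -> : c0 + t%:C * e = (2 * r * t - r) +i* (- r) by apply: ceq => /=; ring.
  by rewrite ev /=; apply: ge1 => //; ring.
have h2 : 1 <= im (msum (fun z => z^-1) n (c0 + e) (e * 'i)).
  apply: msum_Im_ge => z [t /tr tb ->]; rewrite -[_^-1]mul1r.
  have -> : c0 + e + t%:C * (e * 'i) = r +i* (2 * r * t - r) by apply: ceq => /=; ring.
  by rewrite evi /= [X in _ / X]addrC; apply: ge1 => //; ring.
have h3 : 1 <= - im (msum (fun z => z^-1) n (c0 + e * 'i) e).
  rewrite hN; apply: msum_Im_ge => z [t /tr tb ->].
  have -> : c0 + e * 'i + t%:C * e = (2 * r * t - r) +i* r by apply: ceq => /=; ring.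
  by rewrite ev /=; apply: ge1 => //; ring.
have h4 : 1 <= - im (msum (fun z => z^-1) n c0 (e * 'i)).
  rewrite hN; apply: msum_Im_ge => z [t /tr tb ->].
  have -> : c0 + t%:C * (e * 'i) = (- r) +i* (2 * r * t - r) by apply: ceq => /=; ring.
  by rewrite evi /= [X in _ / X]addrC; apply: ge1 => //; ring.
by rewrite !imB imD; lra.
Qed.

(** If [P] failed, it would fail on nested quarters shrinking to a point, against the local
    hypothesis there. This replaces compactness of the square, both in Goursat's lemma and for the
    boundedness of continuous functions. *)
Lemma square_bisection (P : R -> R -> R -> Prop) (x0 y0 s0 : R) : 0 < s0 ->
  (forall x y s, 0 < s -> P x y (s / 2) -> P (x + s / 2) y (s / 2) ->
     P x (y + s / 2) (s / 2) -> P (x + s / 2) (y + s / 2) (s / 2) -> P x y s) ->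
  (forall p, insq x0 y0 s0 p -> exists2 d : R, 0 < d &
     forall x y s, 0 < s < d -> insq x y s p -> P x y s) ->
  P x0 y0 s0.
Proof.
move=> s00 Hsub Hloc; apply: contrapT => nP0.
have next (q : R * R * R) : exists q' : R * R * R, 0 < q.2 -> ~ P q.1.1 q.1.2 q.2 ->
    [/\ ~ P q'.1.1 q'.1.2 q'.2, q'.2 = q.2 / 2, q.1.1 <= q'.1.1 <= q.1.1 + q.2 / 2
      & q.1.2 <= q'.1.2 <= q.1.2 + q.2 / 2].
  case: q => -[x y] s /=; have [s_gt0|] := pselect (0 < s); last by exists (x, y, s).
  have [?|nP] := pselect (P x y s); first by exists (x, y, s).
  have [P1|?] := pselect (P x y (s / 2)); last by exists (x, y, s / 2) => /= _ _; split=> //; lra.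
  have [P2|?] := pselect (P (x + s / 2) y (s / 2));
    last by exists (x + s / 2, y, s / 2) => /= _ _; split=> //; lra.
  have [P3|?] := pselect (P x (y + s / 2) (s / 2));
    last by exists (x, y + s / 2, s / 2) => /= _ _; split=> //; lra.
  have [P4|?] := pselect (P (x + s / 2) (y + s / 2) (s / 2));
    last by exists (x + s / 2, y + s / 2, s / 2) => /= _ _; split=> //; lra.
  by case: nP; exact: Hsub.
have {next} [nx Hnx] := choice next.
pose q k := iter k nx (x0, y0, s0).
have qs k : (q k).2 = s0 / 2 ^+ k /\ ~ P (q k).1.1 (q k).1.2 (q k).2.
  elim: k => [|k [e nP]]; first by rewrite expr0 divr1.
  have s_gt0 : 0 < (q k).2 by rewrite e divr_gt0// exprn_gt0.
  have [nP' e' _ _] := Hnx (q k) s_gt0 nP.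
  by split=> //; rewrite [LHS]e' e exprS invfM; ring.
have qs0 k : 0 < (q k).2 by rewrite (qs k).1 divr_gt0// exprn_gt0.
have step k : [/\ (q k.+1).2 = (q k).2 / 2, (q k).1.1 <= (q k.+1).1.1 <= (q k).1.1 + (q k).2 / 2
      & (q k).1.2 <= (q k.+1).1.2 <= (q k).1.2 + (q k).2 / 2].
  by have [_ ? ? ?] := Hnx (q k) (qs0 k) (qs k).2.
(* The left ends of nested intervals have a supremum which lies in all of them. *)
have nest (u : nat -> R) : (forall k, u k <= u k.+1 <= u k + (q k).2 / 2) ->
    exists a, forall k, u k <= a <= u k + (q k).2.
  move=> Hu; have mono k l : u k <= u (k + l)%N /\ u (k + l)%N + (q (k + l)%N).2 <= u k + (q k).2.
    elim: l => [|l [h1 h2]]; first by rewrite addn0.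
    have := Hu (k + l)%N; have [e _ _] := step (k + l)%N.
    by rewrite addnS e => /andP[? ?]; have := qs0 (k + l)%N; split; lra.
  have ub k l : u l <= u k + (q k).2.
    have [kl|lk] := leqP k l.
      have [_ h] := mono k (l - k)%N; rewrite (subnKC kl) in h.
      by apply: le_trans h; rewrite lerDl ltW.
    have [h _] := mono l (k - l)%N; rewrite (subnKC (ltnW lk)) in h.
    by apply: (le_trans h); rewrite lerDl ltW.
  have hs : has_sup (range u).
    by split; [exists (u 0%N), 0%N|exists (u 0%N + (q 0%N).2) => _ [l _ <-]].
  exists (sup (range u)) => k; apply/andP; split.
    by apply: ub_le_sup; [exact: hs.2|exists k].
  by apply: ge_sup; [exact: hs.1|move=> _ [l _ <-]].
have [a Ha] := nest (fun k => (q k).1.1) (fun k => let: And3 _ h _ := step k in h).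
have [b Hb] := nest (fun k => (q k).1.2) (fun k => let: And3 _ _ h := step k in h).
have [|d d0 Hd] := Hloc (a +i* b).
  by have := Ha 0%N; have := Hb 0%N; rewrite /insq /= => -> ->.
have [k kd] : exists k, s0 / 2 ^+ k < d.
  have := @archi_boundP R (s0 / d) (ltW (divr_gt0 s00 d0)); set k := Num.bound _ => hk.
  exists k; rewrite ltr_pdivrMr ?exprn_gt0// -ltr_pdivrMl// mulrC.
  apply: (lt_le_trans hk); rewrite -natrX ler_nat; exact/ltnW/ltn_expl.
apply: (qs k).2; apply: Hd; last by rewrite /insq /= Ha Hb.
by rewrite qs0 (qs k).1.
Qed.

(** Differentiability and continuity with real moduli, since the norm of [R[i]] takes values in
    [R[i]]. The agreement with the usual notions is [cdiffP] and [ccontP]. *)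
Definition cdiff F p := exists d : C, forall e : R, 0 < e ->
  exists2 r : R, 0 < r & forall z, normc (z - p) < r ->
    normc (F z - F p - d * (z - p)) <= e * normc (z - p).

Definition ccont F p := forall e : R, 0 < e ->
  exists2 r : R, 0 < r & forall z, normc (z - p) < r -> normc (F z - F p) <= e.

(* Primitive of [1 / (2 sqrt |x - a|)]. *)
Definition ssqrt (a x : R) := if a <= x then Num.sqrt (x - a) else - Num.sqrt (a - x).

Lemma ssqrt_nd a x y : x <= y -> ssqrt a x <= ssqrt a y.
Proof.
move=> xy; rewrite /ssqrt; have [ax|xa] := leP a x; have [ay|ya] := leP a y.
- by rewrite ler_wsqrtr// lerB.
- by have := lt_le_trans ya ax; rewrite ltNge xy.
- by apply: (@le_trans _ _ 0); rewrite ?oppr_le0 sqrtr_ge0.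
- by rewrite lerN2 ler_wsqrtr// lerB.
Qed.

(** Subadditivity of the square root. Two such factors, one for each coordinate, give a square
    around [a] the mass [s], which is of the order of its perimeter rather than of its area. *)
Lemma ssqrt_jump a x s : 0 <= s -> x <= a <= x + s ->
  Num.sqrt s <= ssqrt a (x + s) - ssqrt a x.
Proof.
move=> s0 /andP[xa as_]; rewrite /ssqrt as_; have [ax|ax] := leP a x.
  have -> : a = x by apply/eqP; rewrite eq_le xa ax.
  by rewrite subrr sqrtr0 subr0 addrAC subrr add0r.
have -> : s = (x + s - a) + (a - x) by ring.
set u := x + s - a; have -> : x + (u + (a - x)) - a = u by ring.
rewrite opprK; have u0 : 0 <= u by rewrite subr_ge0.
have v0 : 0 <= a - x by rewrite subr_ge0.
rewrite -[leRHS]ger0_norm ?addr_ge0 ?sqrtr_ge0// -sqrtr_sqr ler_wsqrtr//.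
by rewrite sqrrD !sqr_sqrtr// lerD2r lerDl mulrn_wge0// mulr_ge0 ?sqrtr_ge0.
Qed.

(* A finite measure giving mass at least [s] to a square of side [s] around [a];
   with it the Goursat estimate survives at a point where [F] is just continuous. *)
Definition smass (a : C) (x y s : R) :=
  (ssqrt (re a) (x + s) - ssqrt (re a) x) * (ssqrt (im a) (y + s) - ssqrt (im a) y).

Lemma smass_ge0 a x y s : 0 <= s -> 0 <= smass a x y s.
Proof. by move=> s0; rewrite mulr_ge0// subr_ge0 ssqrt_nd// lerDl. Qed.

Lemma smass_ge a x y s : 0 <= s -> insq x y s a -> s <= smass a x y s.
Proof.
move=> s0 /andP[hx hy]; rewrite -{1}(sqr_sqrtr s0) expr2 /smass.
by rewrite ler_pM ?sqrtr_ge0 ?ssqrt_jump.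
Qed.

Lemma smassS a x y s : smass a x y s = smass a x y (s / 2)
  + smass a (x + s / 2) y (s / 2) + smass a x (y + s / 2) (s / 2)
  + smass a (x + s / 2) (y + s / 2) (s / 2).
Proof.
have h (u : R) : u + s / 2 + s / 2 = u + s by field.
by rewrite /smass !h; ring.
Qed.

Lemma insq_normc x y s p z : insq x y s p -> insq x y s z -> normc (z - p) <= 2 * s.
Proof.
move=> /andP[/andP[a1 a2] /andP[a3 a4]] /andP[/andP[b1 b2] /andP[b3 b4]].
apply: (le_trans (normc_le_ReIm _)).
have -> : re (z - p) = re z - re p by case: z p {a1 a2 a3 a4 b1 b2 b3 b4} => ? ? [].
have -> : im (z - p) = im z - im p by case: z p {a1 a2 a3 a4 b1 b2 b3 b4} => ? ? [].
have h (u v : R) : u - v <= s -> v - u <= s -> `|u - v| <= s.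
  by move=> ? ?; rewrite ler_norml; apply/andP; split; lra.
by have := h (re z) (re p); have := h (im z) (im p); lra.
Qed.

Lemma goursat F (a b : C) x0 y0 s0 : 0 < s0 ->
  (forall p, insq x0 y0 s0 p -> cdiff F p \/ (p = a \/ p = b) /\ ccont F p) ->
  forall e : R, 0 < e -> exists n0, forall n, (n0 <= n)%N -> normc (qsum F n x0 y0 s0) <= e.
Proof.
move=> s00 HF e e0.
pose M x y s := s ^+ 2 + smass a x y s + smass b x y s.
have M0 : 0 < M x0 y0 s0 by rewrite /M !ltr_wpDr ?smass_ge0 ?exprn_gt0// ltW.
pose P k x y s := exists n0, forall n, (n0 <= n)%N -> normc (qsum F n x y s) <= k * M x y s.
suff : P (e / M x0 y0 s0) x0 y0 s0.
  by case=> n0 h; exists n0 => n /h; rewrite divfK// gt_eqF.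
have : 0 < e / M x0 y0 s0 by rewrite divr_gt0.
move: (e / _) => {e0}e e0.
apply: square_bisection s00 _ _ => [x y s s_gt0 [n1 h1] [n2 h2] [n3 h3] [n4 h4]|p hp].
  exists (n1 + n2 + n3 + n4).+1 => -[//|n]; rewrite ltnS => hn; rewrite qsumS.
  have {}h1 := h1 n ltac:(lia); have {}h2 := h2 n ltac:(lia).
  have {}h3 := h3 n ltac:(lia); have {}h4 := h4 n ltac:(lia).
  apply: (le_trans (le_normcD _ _)); apply: (le_trans (lerD (le_normcD _ _) (lexx _))).
  apply: (le_trans (lerD (lerD (le_normcD _ _) (lexx _)) (lexx _))).
  apply: (le_trans (lerD (lerD (lerD h1 h2) h3) h4)).
  rewrite /M (smassS a x y s) (smassS b x y s) le_eqVlt; apply/orP; left; apply/eqP.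
  by field.
have [[d Hd]|[pab Hc]] := HF p hp.
  (* The 8 is the perimeter [4 * s] times the bound [2 * s] on distances within the square; below,
     [e / 4] accounts for the perimeter alone. *)
  have [r r0 Hr] := Hd (e / 8) ltac:(lra).
  exists (r / 4) => [|x y s /andP[s_gt0 sr] ps]; first lra.
  exists 0%N => n _.
  have -> : qsum F n x y s = qsum (fun z => F z - ((F p - d * p) + d * z)) n x y s.
    by rewrite qsumB qsum_affine subr0.
  apply: (@le_trans _ _ (4 * s * (e / 8 * (2 * s)))); last first.
    rewrite /M; have := @smass_ge0 a x y s (ltW s_gt0); have := @smass_ge0 b x y s (ltW s_gt0).
    have -> : 4 * s * (e / 8 * (2 * s)) = e * s ^+ 2 by field.
    by move=> h1 h2; rewrite ler_pM2l//; lra.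
  apply: qsum_le => // z [hz _].
  have zp := insq_normc ps hz.
  have -> : F z - (F p - d * p + d * z) = F z - F p - d * (z - p) by ring.
  apply: (le_trans (Hr z _)); first by lra.
  by rewrite ler_pM2l//; lra.
have [r r0 Hr] := Hc (e / 4) ltac:(lra).
exists (r / 4) => [|x y s /andP[s_gt0 sr] ps]; first lra.
exists 0%N => n _.
have -> : qsum F n x y s = qsum (fun z => F z - (F p + 0 * z)) n x y s.
  by rewrite qsumB qsum_affine subr0.
apply: (@le_trans _ _ (4 * s * (e / 4))); last first.
  have -> : 4 * s * (e / 4) = e * s by field.
  rewrite ler_pM2l// /M.
  have := @smass_ge0 a x y s (ltW s_gt0); have := @smass_ge0 b x y s (ltW s_gt0).
  have := sqr_ge0 s; have := smass_ge (ltW s_gt0) ps.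
  by case: pab => ->; lra.
apply: qsum_le => // z [hz _]; have zp := insq_normc ps hz.
by rewrite mul0r addr0; apply: Hr; lra.
Qed.
End DiscreteGoursat.

(** * Removable singularities *)

Section RemovableSingularity.
Variable R : realType.
Local Notation C := R[i].
Local Notation Co := (R[i]^o).
Local Notation re := (@complex.Re R).
Local Notation im := (@complex.Im R).
Implicit Types F G : C -> C.

Lemma complex_gt0 (e : C) : 0 < e -> exists2 r : R, 0 < r & e = r%:C.
Proof. by case: e => a b; rewrite ltcE /= => /andP[/eqP-> ?]; exists a. Qed.

Lemma near_normcP (p : Co) (P : Co -> Prop) : (\forall z \near p, P z) <->
  exists2 r : R, 0 < r & forall z, normc (z - p) < r -> P z.
Proof.
split.
  move=> /nbhs_ballP[e /= /complex_gt0[r r0 ->] H]; exists r => // z zr; apply: H.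
  by rewrite /ball /= distrC normcE ltcR.
case=> r r0 H; apply/nbhs_ballP; exists r%:C => /=; first by rewrite ltcR.
by move=> z; rewrite /ball /= distrC normcE ltcR; exact: H.
Qed.

Lemma ccontP F (p : Co) : ccont F p <-> {for p, continuous (F : Co -> Co)}.
Proof.
split.
  move=> H; apply/(@cvgrPdist_le _ Co Co (nbhs p) _ F (F p)) => e /complex_gt0[r r0 ->].
  have [d d0 Hd] := H r r0; apply/near_normcP; exists d => // z /Hd.
  by rewrite distrC normcE lecR.
move=> /(@cvgrPdist_le _ Co Co (nbhs p) _ F (F p)) H e e0.
have /near_normcP[d d0 Hd] := H e%:C ltac:(by rewrite ltcR).
by exists d => // z /Hd; rewrite distrC normcE lecR.
Qed.

Lemma cdiffP F (p : Co) : cdiff F p <-> derivable (F : Co -> Co) p 1.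
Proof.
split.
  case=> d Hd; apply/cvg_ex; exists d; apply/cvgrPdist_le => e /complex_gt0[r r0 ->].
  have [s s0 Hs] := Hd r r0; apply/near_normcP; exists s => // h; rewrite subr0 => hs h0.
  rewrite distrC normcE lecR.
  have := Hs (h + p); rewrite addrK => /(_ hs) {}Hs.
  have e1 : (h *: (1 : Co)) = h by exact: mulr1.
  rewrite /= e1; move: Hs.
  have -> : F (h + p) - F p - d * h = h * (h^-1 * (F (h + p) - F p) - d).
    by rewrite mulrBr mulrA divff// mul1r [d * h]mulrC.
  rewrite normcM mulrC ler_pM2r// lt_neqAle normc_ge0 andbT eq_sym.
  by apply/negP => /eqP/eq0_normc/eqP; exact/negP.
case/cvg_ex => d /cvgrPdist_le H; exists d => e e0.
have /near_normcP[r r0 Hr] := H e%:C ltac:(by rewrite ltcR).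
exists r => // z zr; have [->|zp] := eqVneq z p.
  by rewrite !subrr mulr0 subr0 normc0 mulr0.
have h0 : z - p != 0 by rewrite subr_eq0.
have := Hr (z - p); rewrite subr0 => /(_ zr h0).
rewrite distrC normcE lecR => h.
have -> : F z - F p - d * (z - p) = ((z - p)^-1 *: (F ((z - p) *: 1 + p) - F p) - d) * (z - p).
  have e1 : ((z - p) *: (1 : Co)) = z - p by exact: mulr1.
  rewrite e1 subrK [RHS]mulrBl; congr (_ - _).
  by rewrite [RHS]mulrAC mulVf// mul1r.
by rewrite normcM ler_wpM2r ?normc_ge0.
Qed.

Lemma cdiffM F G p : cdiff F p -> cdiff G p -> cdiff (fun z => F z * G z) p.
Proof.
by move=> /cdiffP hF /cdiffP hG; apply/cdiffP; exact: (@fderivableM R[i] F G p hF hG).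
Qed.

Lemma cdiffB F G p : cdiff F p -> cdiff G p -> cdiff (fun z => F z - G z) p.
Proof.
by move=> /cdiffP hF /cdiffP hG; apply/cdiffP; exact: (@fderivableB R[i] F G p hF hG).
Qed.

Lemma cdiffV F p : F p != 0 -> cdiff F p -> cdiff (fun z => (F z)^-1) p.
Proof.
by move=> p0 /cdiffP hF; apply/cdiffP; exact: (@fderivableV R[i] F p p0 hF).
Qed.

Lemma cdiff_cst (k p : C) : cdiff (fun=> k) p.
Proof. by apply/cdiffP; exact: (@fderivable_cst R[i] k p). Qed.

Lemma cdiff_id (p : C) : cdiff id p.
Proof. by apply/cdiffP; exact: (@fderivable_id R[i] p). Qed.

Lemma cdiff_invB (k p : C) : p - k != 0 -> cdiff (fun z => (z - k)^-1) p.
Proof.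
by move=> h; apply: (@cdiffV (fun z => z - k)) => //; apply: cdiffB;
  [exact: cdiff_id|exact: cdiff_cst].
Qed.

Lemma cdiff_ccont F p : cdiff F p -> ccont F p.
Proof. by move=> /cdiffP h; apply/ccontP; exact: (@fderivable_cont R[i] F p h). Qed.

Lemma ccontM F G p : ccont F p -> ccont G p -> ccont (fun z => F z * G z) p.
Proof.
by move=> /ccontP hF /ccontP hG; apply/ccontP; exact: (@fcontM R[i] F G p hF hG).
Qed.

Lemma ccontB F G p : ccont F p -> ccont G p -> ccont (fun z => F z - G z) p.
Proof.
by move=> /ccontP hF /ccontP hG; apply/ccontP; exact: (@fcontB R[i] F G p hF hG).
Qed.

Lemma ccont_bounded F x y s : 0 < s -> (forall p, insq x y s p -> ccont F p) ->
  exists M, forall z, insq x y s z -> normc (F z) <= M.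
Proof.
move=> s0 H; pose P x y s := exists M, forall z, insq x y s z -> normc (F z) <= M.
apply: (@square_bisection R P x y s s0) => [x' y' s' s'0 [A HA] [B HB] [D HD] [E HE]|p /H Hp].
  exists (Num.max (Num.max A B) (Num.max D E)) => z /andP[/andP[z1 z2] /andP[z3 z4]].
  rewrite !le_max.
  have h (u : R) : u <= x' + s' -> u <= x' + s' / 2 + s' / 2 by lra.
  have h' (u : R) : u <= y' + s' -> u <= y' + s' / 2 + s' / 2 by lra.
  have [hx|hx] := leP (re z) (x' + s' / 2); have [hy|hy] := leP (im z) (y' + s' / 2).
  - by rewrite HA// /insq z1 hx z3 hy.
  - by rewrite HD ?orbT// /insq z1 hx (ltW hy) h'.
  - by rewrite HB ?orbT// /insq (ltW hx) z3 hy h.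
  - by rewrite HE ?orbT// /insq (ltW hx) (ltW hy) h ?h'.
have [r r0 Hr] := Hp 1 ltr01; exists (r / 2); first by rewrite divr_gt0.
move=> x' y' s' /andP[s'0 s'r] ps; exists (1 + normc (F p)) => z hz.
rewrite -[F z](subrK (F p)); apply: (le_trans (le_normcD _ _)); rewrite lerD2r.
by apply: Hr; have := insq_normc ps hz; lra.
Qed.

Lemma near_cdiff F G (p : C) r : 0 < r -> (forall z, normc (z - p) < r -> F z = G z) ->
  cdiff G p -> cdiff F p.
Proof.
move=> r0 H [d Hd]; exists d => e /Hd[s s0 Hs].
exists (Num.min r s) => [|z]; rewrite lt_min ?r0// => /andP[zr zs].
by rewrite !H ?subrr ?normc0// Hs.
Qed.

Lemma near_ccont F G (p : C) r : 0 < r -> (forall z, normc (z - p) < r -> F z = G z) ->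
  ccont G p -> ccont F p.
Proof.
move=> r0 H Hc e /Hc[s s0 Hs].
exists (Num.min r s) => [|z]; rewrite lt_min ?r0// => /andP[zr zs].
by rewrite !H ?subrr ?normc0// Hs.
Qed.

Lemma normc_gt0 (z : C) : (0 < normc z) = (z != 0).
Proof.
rewrite lt_neqAle normc_ge0 andbT eq_sym; congr (~~ _).
by apply/eqP/eqP => [/eq0_normc|->]; rewrite ?normc0.
Qed.

Lemma normcBC (y z : C) : normc (y - z) = normc (z - y).
Proof. by rewrite -normcN opprB. Qed.

Section core.
Variables (g : C -> C) (rho : R).
Hypothesis rho0 : 0 < rho.
Hypothesis gd : forall z, normc z < rho -> cdiff g z.
Hypothesis g0 : forall e : R, 0 < e ->
  exists2 r : R, 0 < r & forall z, normc z < r -> normc (g z) <= e * normc z.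

Let q z := g z / z.
Let r := rho / 4.
Let I n F := qsum F n (- r) (- r) (2 * r).

Let r0 : 0 < r. Proof. by rewrite divr_gt0. Qed.

Let rho4 : rho = 4 * r. Proof. by rewrite /r; field. Qed.

Let I_le n F M : (forall z, onsq (- r) (- r) (2 * r) z -> normc (F z) <= M) ->
  normc (I n F) <= 8 * r * M.
Proof.
move=> H; apply: le_trans (qsum_le n _ H) _; first by rewrite mulr_gt0.
by rewrite le_eqVlt; apply/orP; left; apply/eqP; ring.
Qed.

Let sq_rho z : insq (- r) (- r) (2 * r) z -> normc z < rho.
Proof.
move=> /andP[/andP[h1 h2] /andP[h3 h4]]; apply: (le_lt_trans (normc_le_ReIm z)).
have h (u : R) : - r <= u -> u <= - r + 2 * r -> `|u| <= r by rewrite ler_norml; lra.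
by apply: (le_lt_trans (lerD (h _ h1 h2) (h _ h3 h4))); move: r0; rewrite rho4; lra.
Qed.

Let bd_ge z : onsq (- r) (- r) (2 * r) z -> r <= normc z.
Proof.
have h (u : R) : u = - r \/ u = - r + 2 * r -> r <= `|u|.
  move=> [->|->]; rewrite ?normrN; first exact: ler_norm.
  by apply: le_trans (ler_norm _); lra.
case=> _ [hz|[hz|[hz|hz]]].
- by apply: le_trans (Re_le_normc z); apply: h; left.
- by apply: le_trans (Re_le_normc z); apply: h; right.
- by apply: le_trans (Im_le_normc z); apply: h; left.
- by apply: le_trans (Im_le_normc z); apply: h; right.
Qed.

Let q_diff z : z != 0 -> normc z < rho -> cdiff q z.
Proof.
by move=> z0 /gd h; exact: (cdiffM h (cdiffV z0 (cdiff_id _))).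
Qed.

(** Division by zero gives [q] the value 0 at 0, which is also its limit there since [g] is o(z). *)
Let q_cont0 : ccont q 0.
Proof.
move=> e e0; have [s s0 Hs] := g0 e0; exists s => // z; rewrite subr0 => zs.
rewrite /q invr0 mulr0 subr0 normcM normcV; have [->|z0] := eqVneq z 0.
  by rewrite normc0 invr0 mulr0 ltW.
by rewrite ler_pdivrMr ?normc_gt0// Hs.
Qed.

Let q0 : q 0 = 0. Proof. by rewrite /q invr0 mulr0. Qed.

Let q_bounded : exists2 B, 0 < B &
  forall z, onsq (- r) (- r) (2 * r) z -> normc (q z) <= B.
Proof.
have [|z hz|M HM] := @ccont_bounded q (- r) (- r) (2 * r).
- by rewrite mulr_gt0.
- have [->//|z0] := eqVneq z 0; apply: cdiff_ccont; apply: q_diff => //; exact: sq_rho.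
- exists (`|M| + 1); first by rewrite ltr_wpDl.
  move=> z [/HM h _]; apply: (le_trans h); apply: (le_trans (ler_norm M)).
  by rewrite lerDl.
Qed.

(** Cauchy's formula for [q] at [a], up to [e]: Goursat's lemma for the difference quotient of [q]
    at [a], filled in with the derivative. It is continuous at 0 and at [a], and differentiable
    elsewhere. *)
Let quotient_goursat (a : C) : a != 0 -> normc a < r / 2 ->
  forall e : R, 0 < e -> exists n0, forall n, (n0 <= n)%N ->
  normc (I n (fun z => q z * (z - a)^-1) - q a * I n (fun z => (z - a)^-1)) <= e.
Proof.
move=> a0 ar e e0; have arho : normc a < rho by move: r0 rho4; lra.
have [d Hd] := q_diff a0 arho.
pose G z := (q z - q a) * (z - a)^-1.
pose E z := if z == a then d else G z.
have EG p : p != a -> forall z, normc (z - p) < normc (p - a) -> E z = G z.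
  move=> pa z h; rewrite /E; case: eqP => // za; move: h.
  by rewrite za normcBC ltxx.
have pa0 p : p != a -> 0 < normc (p - a) by rewrite normc_gt0 subr_eq0.
have Gd p : p != 0 -> p != a -> normc p < rho -> cdiff G p.
  move=> p0 pa pr; have h2 : p - a != 0 by rewrite subr_eq0.
  apply: cdiffM; first exact: cdiffB (q_diff p0 pr) (cdiff_cst _ _).
  exact: (cdiff_invB h2).
have Gc0 : ccont G 0.
  have h2 : 0 - a != 0 by rewrite sub0r oppr_eq0.
  apply: ccontM; first exact: ccontB q_cont0 (cdiff_ccont (cdiff_cst _ _)).
  exact: (cdiff_ccont (cdiff_invB h2)).
have [|p hp|n0 Hn0] := @goursat R E 0 a (- r) (- r) (2 * r) _ _ e e0.
- by rewrite mulr_gt0.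
- have pr := sq_rho hp; have [pa|pa] := eqVneq p a.
    right; split; first by right.
    move=> e' e'0; have [s s0 Hs] := Hd e' e'0; exists s => // z; rewrite pa => zs.
    rewrite /E eqxx; case: eqVneq => [_|za]; first by rewrite subrr normc0 ltW.
    have h := Hs z zs; have za0 := pa0 _ za.
    have -> : G z - d = (q z - q a - d * (z - a)) * (z - a)^-1.
      by rewrite mulrBl mulfK// subr_eq0.
    by rewrite normcM normcV ler_pdivrMr.
  have [->|p0] := eqVneq p 0.
    right; split; first by left.
    by apply: near_ccont (pa0 0 _) (EG 0 _) Gc0; rewrite eq_sym.
  by left; apply: near_cdiff (pa0 p pa) (EG p pa) (Gd p p0 pa pr).
- exists n0 => n /Hn0; congr (normc _ <= _).
  have -> : qsum E n (- r) (- r) (2 * r) = I n (fun z => q z * (z - a)^-1 - q a * (z - a)^-1).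
    apply: eq_qsum => [|z /bd_ge hz]; first by rewrite mulr_gt0.
    rewrite /E; case: eqP => [za|_]; last by rewrite /G mulrBl.
    by exfalso; move: hz ar r0; rewrite za; lra.
  by rewrite /I qsumB qsumZ.
Qed.

(* With [J2], [J3] the sums of [1/z] and [q z / z^2] over the boundary, Goursat's lemma
   and the expansion of [1/(z - a)] at [a = 0] give [(q a / a) * J2 = J3 + O(a)]. *)
Let small_diff : exists K : R, exists2 s : R, 0 < s &
  forall a b : C, 0 < normc a < s -> 0 < normc b < s ->
    normc (q a / a - q b / b) <= K * (normc a + normc b).
Proof.
have [B B0 HB] := q_bounded.
have [v [v0 vE rv]] : exists v, [/\ 0 < v, v = r^-1 & r * v = 1].
  by exists r^-1; rewrite invr_gt0 divff// gt_eqF.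
have bz z : onsq (- r) (- r) (2 * r) z -> z != 0 /\ normc z^-1 <= v.
  move=> /bd_ge h; have z0 := lt_le_trans r0 h; rewrite -normc_gt0; split=> //.
  by rewrite normcV vE lef_pV2.
have ba a z : normc a < r / 2 -> onsq (- r) (- r) (2 * r) z ->
  z - a != 0 /\ normc (z - a)^-1 <= 2 * v.
  move=> ar /bd_ge h; have hza : r / 2 <= normc (z - a).
    have := le_normcD (z - a) a; rewrite subrK; lra.
  have z0 := lt_le_trans (divr_gt0 r0 (ltr0n _ 2)) hza; rewrite -normc_gt0; split=> //.
  by rewrite normcV -[2]invrK vE -invfM lef_pV2 ?posrE ?mulr_gt0// mulrC.
have mulb (x y x' y' : R) : 0 <= x -> 0 <= y -> x <= x' -> y <= y' -> x * y <= x' * y'.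
  by move=> *; exact: ler_pM.
have mulbc (x y : C) (x' y' : R) : normc x <= x' -> normc y <= y' -> normc (x * y) <= x' * y'.
  by move=> *; rewrite normcM; apply: mulb => //; exact: normc_ge0.
have rvX (x y : R) : x = y * (r * v) -> x <= y by rewrite rv mulr1 => ->.
have sq0 : 0 < 2 * r by rewrite mulr_gt0.
(* The kernels are the terms and remainders of the expansion of 1/(z - a) at a = 0: by [key], each
   subtraction splits off a factor [a]. *)
pose K1 a n := I n (fun z => q z * (z - a)^-1).
pose K2 a n := I n (fun z => (z - a)^-1).
pose K3 a n := I n (fun z => q z * (z^-1 * (z - a)^-1)).
pose K4 a n := I n (fun z => z^-1 * (z - a)^-1).
pose K5 a n := I n (fun z => q z * (z^-1 * (z^-1 * (z - a)^-1))).
pose J1 n := I n (fun z => q z * z^-1).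
pose J2 n := I n (fun z => z^-1).
pose J3 n := I n (fun z => q z * (z^-1 * z^-1)).
have key a z : normc a < r / 2 -> onsq (- r) (- r) (2 * r) z ->
    (z - a)^-1 - z^-1 = a * (z^-1 * (z - a)^-1).
  move=> ar hz; have [z0 _] := bz _ hz; have [za _] := ba _ _ ar hz.
  have h (w : C) : w != 0 -> w^-1 - z^-1 = (z - w) * (z^-1 * w^-1).
    by move=> w0; rewrite mulrBl mulrA divff// mul1r mulrCA divff// mulr1.
  by rewrite (h _ za) subKr.
have e1 a n : normc a < r / 2 -> K1 a n - J1 n = a * K3 a n.
  move=> ar; rewrite /K1 /J1 /K3 /I -qsumB -qsumZ; apply: eq_qsum => // z hz.
  by rewrite -mulrBr key//; ring.
have e2 a n : normc a < r / 2 -> K2 a n - J2 n = a * K4 a n.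
  move=> ar; rewrite /K2 /J2 /K4 /I -qsumB -qsumZ; apply: eq_qsum => // z hz.
  by rewrite key.
have e3 a n : normc a < r / 2 -> K3 a n - J3 n = a * K5 a n.
  move=> ar; rewrite /K3 /J3 /K5 /I -qsumB -qsumZ; apply: eq_qsum => // z hz.
  by rewrite -!mulrBr key//; ring.
have n2 a n : normc a < r / 2 -> normc (K2 a n) <= 16.
  move=> ar; apply: le_trans (I_le n (M := 2 * v) _) _ => [z hz|].
    by have [_ za] := ba _ _ ar hz.
  have -> : 8 * r * (2 * v) = 16 * (r * v) by ring.
  by rewrite rv mulr1.
have n3 a n : normc a < r / 2 -> normc (K3 a n) <= 16 * (B * v).
  move=> ar; apply: le_trans (I_le n (M := B * (v * (2 * v))) _) _ => [z hz|].
    have [_ zv] := bz _ hz; have [_ za] := ba _ _ ar hz.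
    exact: (mulbc _ _ _ _ (HB _ hz) (mulbc _ _ _ _ zv za)).
  by apply: rvX; ring.
have n4 a n : normc a < r / 2 -> normc (K4 a n) <= 16 * v.
  move=> ar; apply: le_trans (I_le n (M := v * (2 * v)) _) _ => [z hz|].
    have [_ zv] := bz _ hz; have [_ za] := ba _ _ ar hz.
    exact: mulbc.
  by apply: rvX; ring.
have n5 a n : normc a < r / 2 -> normc (K5 a n) <= 16 * (B * v * v).
  move=> ar; apply: le_trans (I_le n (M := B * (v * (v * (2 * v)))) _) _ => [z hz|].
    have [_ zv] := bz _ hz; have [_ za] := ba _ _ ar hz.
    exact: (mulbc _ _ _ _ (HB _ hz) (mulbc _ _ _ _ zv (mulbc _ _ _ _ zv za))).
  by apply: rvX; ring.
have j2 n : 4 <= normc (J2 n) by exact: qsum_inv_ge.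
have tri (x y : C) : normc x <= normc (x - y) + normc y.
  by have := le_normcD (x - y) y; rewrite subrK.
(* Nothing is known yet about a derivative of [q] at 0, so Cauchy's formula there is approached
   through a small real [t]. The 48 = 3 * 16 splits [e] into thirds, with 16 the bound on [K2] and
   [16 * (B * v)] the one on [K3]. *)
have j1 e : 0 < e -> exists n0, forall n, (n0 <= n)%N -> normc (J1 n) <= e.
  move=> e0; have [|s s0 Hs] := q_cont0 (e := e / 48); first by rewrite divr_gt0.
  pose t := Num.min (Num.min (r / 4) (s / 2)) (e / (48 * (B * v))).
  have Bv0 : 0 < B * v by rewrite mulr_gt0.
  have t0 : 0 < t by rewrite !lt_min !divr_gt0 ?mulr_gt0.
  have [t1 t2 t3] : [/\ t <= r / 4, t <= s / 2 & t <= e / (48 * (B * v))].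
    by split; rewrite /t !ge_min lexx ?orbT.
  have nt : normc t%:C = t by rewrite normc_real gtr0_norm.
  have ar : normc t%:C < r / 2 by rewrite nt; move: r0; lra.
  have t_neq0 : t%:C != 0 by rewrite -normc_gt0 nt.
  have [n0 Hn0] := quotient_goursat t_neq0 ar (divr_gt0 e0 (ltr0n _ 3)).
  exists n0 => n /Hn0 h; have qt : normc (q t%:C) <= e / 48.
    by have := Hs t%:C; rewrite q0 !subr0 nt; apply; lra.
  have h1 : normc (q t%:C * K2 t%:C n) <= e / 3.
    rewrite normcM; apply: le_trans (mulb _ _ _ _ _ _ qt (n2 _ n ar)) _; rewrite ?normc_ge0//.
    by rewrite -subr_ge0; lra.
  have h2 : normc (t%:C * K3 t%:C n) <= e / 3.
    rewrite normcM nt; apply: le_trans (mulb _ _ _ _ (ltW t0) (normc_ge0 _) t3 (n3 _ n ar)) _.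
    rewrite le_eqVlt; apply/orP; left; apply/eqP; field.
    by rewrite !gt_eqF.
  have h3 := tri (J1 n) (K1 t%:C n); rewrite (normcBC (J1 n)) (e1 _ n ar) in h3.
  have h4 := tri (K1 t%:C n) (q t%:C * K2 t%:C n).
  by rewrite -/(K1 _ _) -/(K2 _ _) in h; lra.
have [c cE] : exists c : C -> C, forall a, c a = q a / a by exists (fun a => q a / a).
have e4 a e : 0 < normc a < r / 2 -> 0 < e ->
    exists n0, forall n, (n0 <= n)%N -> normc (K3 a n - c a * K2 a n) <= e.
  move=> /andP[na ar] e0; have a0 : a != 0 by rewrite -normc_gt0.
  have ea : 0 < e * normc a / 2 by rewrite !mulr_gt0 ?invr_gt0.
  have [n1 H1] := quotient_goursat a0 ar ea; have [n2' H2] := j1 _ ea.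
  exists (n1 + n2')%N => n hn; have {}H1 := H1 n (leq_trans (leq_addr _ _) hn);
    have {}H2 := H2 n (leq_trans (leq_addl _ _) hn).
  rewrite -(ler_pM2l na) -normcM.
  have -> : a * (K3 a n - c a * K2 a n) = K1 a n - q a * K2 a n - J1 n.
    by rewrite mulrBr -e1// cE; field.
  apply: (le_trans (normcB_le _ _)); rewrite -/(K1 _ _) -/(K2 _ _) in H1.
  by rewrite [normc a * e]mulrC; lra.
(* For [a] within this radius [K2] differs by at most 1 from [J2], whose norm is at least 4. *)
pose s := r / 16; have s0 : 0 < s by rewrite divr_gt0.
have sr a : 0 < normc a < s -> 0 < normc a < r / 2.
  by move=> /andP[-> h]; apply: (lt_le_trans h); rewrite /s; move: r0; lra.
have sv a : 0 < normc a < s -> normc a * (16 * v) <= 1.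
  move=> /andP[_ /ltW h]; apply: (@le_trans _ _ (s * (16 * v))).
    by rewrite ler_pM2r// mulr_gt0.
  by apply: rvX; rewrite /s; field.
(* The quotients q a / a are bounded: in the comparison with [J2] the error is at most the norm of
   [c a] itself and is absorbed on the left. *)
have cb a : 0 < normc a < s -> normc (c a) <= 16 * (B * v) + 1.
  move=> hs; have /andP[na ar] := sr _ hs.
  have [n0 H] := e4 a 1 (sr _ hs) ltr01; have {}H := H n0 (leqnn _).
  have h1 : normc (c a) * 4 <= normc (c a * J2 n0) by rewrite normcM ler_wpM2l ?normc_ge0.
  have h2 := tri (c a * J2 n0) (c a * K2 a n0).
  have h3 : normc (c a * J2 n0 - c a * K2 a n0) <= normc (c a).
    rewrite -mulrBr normcM normcBC e2// normcM -[leRHS]mulr1 ler_wpM2l ?normc_ge0//.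
    by apply: le_trans (sv _ hs); rewrite ler_wpM2l ?normc_ge0 ?n4.
  have h4 := tri (c a * K2 a n0) (K3 a n0); rewrite normcBC in h4.
  have h5 := n3 a n0 ar; have h6 := normc_ge0 (c a).
  have h7 : 0 <= 16 * (B * v) by rewrite !mulr_ge0// ltW.
  by lra.
pose K := 16 * (B * v * v) + 16 * v * (16 * (B * v) + 1).
have e5 a e : 0 < normc a < s -> 0 < e ->
    exists n0, forall n, (n0 <= n)%N -> normc (J3 n - c a * J2 n) <= e + K * normc a.
  move=> hs e0; have /andP[na ar] := sr _ hs.
  have [n0 H] := e4 a e (sr _ hs) e0; exists n0 => n /H {}H.
  have -> : J3 n - c a * J2 n = (K3 a n - c a * K2 a n) - (K3 a n - J3 n) + c a * (K2 a n - J2 n).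
    by ring.
  apply: (le_trans (le_normcD _ _)); apply: (le_trans (lerD (normcB_le _ _) (lexx _))).
  rewrite e3// e2// !normcM.
  have h5 : normc a * normc (K5 a n) <= normc a * (16 * (B * v * v)).
    by rewrite ler_wpM2l ?normc_ge0 ?n5.
  have h6 : normc (c a) * (normc a * normc (K4 a n)) <= (16 * (B * v) + 1) * (normc a * (16 * v)).
    by rewrite mulb ?mulr_ge0 ?normc_ge0 ?cb// ler_wpM2l ?normc_ge0 ?n4.
  apply: (le_trans (lerD (lerD H h5) h6)).
  by rewrite le_eqVlt; apply/orP; left; apply/eqP; rewrite /K; ring.
exists (K / 4), s => // a b ha hb; rewrite -!cE; apply/ler_addgt0Pr => e e0.
have [n1 H1] := e5 a e ha e0; have [n2' H2] := e5 b e hb e0.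
have {}H1 := H1 (n1 + n2')%N (leq_addr _ _); have {}H2 := H2 (n1 + n2')%N (leq_addl _ _).
move: H1 H2; set n := (n1 + n2')%N => H1 H2.
have : normc (c a - c b) * 4 <= normc ((c a - c b) * J2 n).
  by rewrite normcM ler_wpM2l ?normc_ge0.
have -> : (c a - c b) * J2 n = (J3 n - c b * J2 n) - (J3 n - c a * J2 n) by ring.
have := normcB_le (J3 n - c b * J2 n) (J3 n - c a * J2 n); by lra.
Qed.

(* A limit of [u] at [0] is produced as the supremum of the lower bounds. *)
Let real_limit (u : C -> R) (K s : R) : 0 < s ->
  (forall a b, 0 < normc a < s -> 0 < normc b < s -> u a - u b <= K * (normc a + normc b)) ->
  exists L, forall a, 0 < normc a < s -> `|u a - L| <= K * normc a.
Proof.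
move=> s0 H; pose S := [set u b - K * normc b | b in [set b | 0 < normc b < s]].
have hs : has_sup S.
  have hh : 0 < normc (s / 2)%:C < s by rewrite normc_real gtr0_norm; lra.
  split; first by exists (u (s / 2)%:C - K * normc (s / 2)%:C), (s / 2)%:C.
  exists (u (s / 2)%:C + K * normc (s / 2)%:C) => _ [b hb <-].
  by have := H _ _ hb hh; lra.
exists (sup S) => a ha; rewrite ler_norml; apply/andP; split.
  rewrite lerBrDr addrC lerBlDr; apply: ge_sup; first exact: hs.1.
  by move=> _ [b hb <-]; have := H _ _ hb ha; lra.
have : u a - K * normc a <= sup S by apply: ub_le_sup; [exact: hs.2|exists a].
by lra.
Qed.

(** By [small_diff] the quotients q a / a satisfy a Cauchy condition with linear modulus. The limits
    of their real and imaginary parts form the derivative of [q] at 0. *)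
Lemma quotient_cdiff0 : cdiff (fun z => g z / z) 0.
Proof.
have [K0 [s s0 Hs]] := small_diff; pose K := `|K0|; have K_ge0 : 0 <= K := normr_ge0 _.
have {}Hs a b : 0 < normc a < s -> 0 < normc b < s ->
    normc (q a / a - q b / b) <= K * (normc a + normc b).
  move=> ha hb; apply: (le_trans (Hs a b ha hb)); rewrite ler_wpM2r ?ler_norm//.
  by rewrite addr_ge0 ?normc_ge0.
have reB (u v : C) : re (u - v) = re u - re v by case: u v => ? ? [].
have imB (u v : C) : im (u - v) = im u - im v by case: u v => ? ? [].
have [L1 H1] : exists L, forall a, 0 < normc a < s -> `|re (q a / a) - L| <= K * normc a.
  apply: (@real_limit (fun a => re (q a / a))) => // a b ha hb; apply: le_trans (Hs a b ha hb);
    rewrite -reB.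
  exact: le_trans (ler_norm _) (Re_le_normc _).
have [L2 H2] : exists L, forall a, 0 < normc a < s -> `|im (q a / a) - L| <= K * normc a.
  apply: (@real_limit (fun a => im (q a / a))) => // a b ha hb.
  apply: le_trans (Hs a b ha hb); rewrite -imB.
  exact: le_trans (ler_norm _) (Im_le_normc _).
exists (L1 +i* L2) => e e0; exists (Num.min s (e / (2 * K + 1))).
  by rewrite lt_min s0 divr_gt0// ltr_wpDl// mulr_ge0.
move=> z; rewrite subr0 lt_min => /andP[zs ze]; rewrite -/(q z) -/(q 0) q0 subr0.
have [->|z0] := eqVneq z 0; first by rewrite q0 mulr0 subr0 normc0 mulr0.
have hz : 0 < normc z < s by rewrite normc_gt0 z0.
have -> : q z - (L1 +i* L2) * z = (q z / z - (L1 +i* L2)) * z by rewrite mulrBl divfK.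
rewrite normcM ler_wpM2r ?normc_ge0//.
apply: (le_trans (normc_le_ReIm _)); rewrite reB imB /=.
apply: (le_trans (lerD (H1 z hz) (H2 z hz))).
have : normc z * (2 * K + 1) < e by rewrite -ltr_pdivlMr// ltr_wpDl// mulr_ge0.
by have := normc_ge0 z; lra.
Qed.

End core.

Lemma cdiffD F G p : cdiff F p -> cdiff G p -> cdiff (fun z => F z + G z) p.
Proof.
by move=> /cdiffP hF /cdiffP hG; apply/cdiffP; exact: (@fderivableD R[i] F G p hF hG).
Qed.

(* Riemann's removable singularity theorem for [f z / z]. *)
Lemma divided_difference f rho : 0 < rho -> (forall z, normc z < rho -> cdiff f z) ->
  f 0 = 0 -> exists d : C, cdiff (fun z => if z == 0 then d else f z / z) 0.
Proof.
move=> rho0 fd f0; have [|d Hd] := fd 0; first by rewrite normc0.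
(* Subtracting the linear part leaves o(z), and off 0 the quotient f z / z is [d + g z / z]. *)
exists d; pose g z := f z - d * z.
have h : cdiff (fun z => d + g z / z) 0.
  apply: cdiffD; first exact: cdiff_cst.
  apply: (@quotient_cdiff0 g rho rho0) => [z /fd fz|e /Hd[s s0 Hs]].
    by apply: cdiffB => //; apply: cdiffM; [exact: cdiff_cst|exact: cdiff_id].
  by exists s => // z zs; have := Hs z; rewrite f0 !subr0 => /(_ zs).
apply: near_cdiff ltr01 _ h => z _; case: eqVneq => [->|z0].
  by rewrite invr0 mulr0 addr0.
by rewrite /g; field.
Qed.
End RemovableSingularity.

(** * Holomorphic functions, coordinates and sections *)

Lemma near_comp (S T : topologicalType) (f : S -> T) (z : S) (P : T -> Prop) :
  {for z, continuous f} -> (\forall t \near f z, P t) -> \forall s \near z, P (f s).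
Proof. by move=> hf; exact: hf. Qed.

Section HolC.
Variable R : realType.
Local Notation C := R[i].
Local Notation Co := (R[i]^o).
Implicit Types (f g : Co -> Co) (z : Co).

Lemma holC_atP g z : holC_at g z <-> exists2 r : R, 0 < r &
  forall z' : C, normc (z' - z) < r -> cdiff g z'.
Proof.
by split=> [/near_normcP|] [r r0 H]; [|apply/near_normcP]; exists r => // z' /H/cdiffP.
Qed.

Lemma holC_cont g z : holC_at g z -> {for z, continuous g}.
Proof.
by move=> /holC_atP[r r0 H]; apply/ccontP/cdiff_ccont/H; rewrite subrr normc0.
Qed.

Lemma holC_cst (k z : Co) : holC_at (fun=> k) z.
Proof. by apply/holC_atP; exists 1 => // z' _; exact: cdiff_cst. Qed.

Lemma holC_id z : holC_at id z.
Proof. by apply/holC_atP; exists 1 => // z' _; exact: cdiff_id. Qed.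

Lemma holCD f g z : holC_at f z -> holC_at g z -> holC_at (fun t => f t + g t) z.
Proof. by apply: filterS2 => t; exact: (@fderivableD R[i] f g t). Qed.

Lemma holCM f g z : holC_at f z -> holC_at g z -> holC_at (fun t => f t * g t : C) z.
Proof. by apply: filterS2 => t; exact: (@fderivableM R[i] f g t). Qed.

Lemma holCV f z : f z != 0 -> holC_at f z -> holC_at (fun t => (f t)^-1 : C) z.
Proof.
move=> f0 hf; have : \forall t \near z, f t != 0.
  exact: (@cvgr_neq0 _ _ _ (nbhs z) _ f (f z) (holC_cont hf) f0).
by move: hf; apply: filterS2 => t h h0; exact: (@fderivableV R[i] f t h0 h).
Qed.

Lemma holC_comp f g z : holC_at f z -> holC_at g (f z) -> holC_at (g \o f) z.
Proof.
move=> hf hg; have h := near_comp (holC_cont hf) hg.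
by apply: filterS2 hf h => t; exact: (@fderivable_comp R[i] f g t).
Qed.

Lemma holC_factor f : holC_at f 0 -> f 0 = 0 ->
  exists2 h, holC_at h 0 & forall z, f z = z * h z :> C.
Proof.
move=> /holC_atP[r r0 Hr] f0.
have [d Hd] := divided_difference r0 (fun z (hz : normc z < r) =>
  Hr z (eq_ind_r (fun x => normc x < r) hz (subr0 z))) f0.
exists (fun z => if z == 0 then d else f z / z); last first.
  move=> z; case: eqVneq => [->|z0]; first by rewrite f0 mul0r.
  by rewrite mulrC divfK.
apply/holC_atP; exists r => // z zr; have [->//|z0] := eqVneq z 0.
apply: (@near_cdiff _ _ (fun z => f z / z) _ (normc z)); first by rewrite normc_gt0.
  move=> t ht; case: eqP => // t0; move: ht.
  by rewrite t0 sub0r normcN ltxx.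
apply: cdiffM; first exact: Hr.
have := @cdiff_invB R 0 z; rewrite subr0 => /(_ z0).
by apply: near_cdiff ltr01 _ => t _; rewrite subr0.
Qed.
End HolC.

#[local] Opaque holC_at.

Section HolAt.
Variables (R : realType) (X : riemannSurface R).
Local Notation C := R[i].
Local Notation Co := (R[i]^o).
Implicit Types (p q : X) (f g : X -> Co).

Lemma hol_at_chart p f (w : chart R X) : dom w p ->
  (forall c, atlas c -> hol_change w c) -> hol_at p f ->
  exists2 g, holC_at g (w p) & \forall q \near p, f q = g (w q).
Proof.
move=> wp wc [c [ac cp] [g hg fg]].
have [h hh ch] := wc c ac p wp cp; exists (g \o h).
  by apply: holC_comp hh _; rewrite -(nbhs_singleton ch).
by move: fg ch; apply: filterS2 => q -> ->.
Qed.

Lemma hol_at_atlas p f c : atlas c -> dom c p -> hol_at p f ->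
  exists2 g, holC_at g (c p) & \forall q \near p, f q = g (c q).
Proof. by move=> ac cp; apply: hol_at_chart => // d; exact: atlas_compat. Qed.

Lemma hol_at_near p f g : (\forall q \near p, f q = g q) -> hol_at p g -> hol_at p f.
Proof.
move=> fg [c cp [h hh gh]]; exists c => //; exists h => //.
by move: fg gh; apply: filterS2 => q -> ->.
Qed.

Lemma hol_at_cont p f : hol_at p f -> {for p, continuous f}.
Proof.
move=> [c [ac cp] [g hg fg]].
have h : {for p, continuous (g \o c)}.
  by apply: continuous_comp; [exact: chart_cont|exact: holC_cont].
rewrite /prop_for /continuous_at (nbhs_singleton fg).
by apply: cvg_trans h; apply: near_eq_cvg; move: fg; apply: filterS => q ->.
Qed.

Lemma hol_at_open p f : hol_at p f -> \forall q \near p, hol_at q f.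
Proof.
move=> [c [ac cp] [g hg fg]].
have h1 : \forall q \near p, dom c q by apply: open_nbhs_nbhs; split=> //; exact: chart_open.
have h2 : \forall q \near p, holC_at g (c q).
  exact: near_comp (chart_cont cp) (nbhs_interior hg).
move: (nbhs_interior fg) h1 h2; apply: filterS3 => q h1 h2 h3.
by exists c => //; exists g.
Qed.

Lemma hol_cst p (k : Co) : hol_at p (fun=> k).
Proof.
have [c ac cp] := atlas_cover p; exists c => //; exists (fun=> k); first exact: holC_cst.
exact: nearW.
Qed.

Lemma holD p f g : hol_at p f -> hol_at p g -> hol_at p (fun q => f q + g q).
Proof.
move=> [c [ac cp] [f' hf ff]] /(hol_at_atlas ac cp)[g' hg gg]; exists c => //.
exists (fun t => f' t + g' t); first exact: holCD.
by move: ff gg; apply: filterS2 => q -> ->.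
Qed.

Lemma holM p f g : hol_at p f -> hol_at p g -> hol_at p (fun q => f q * g q : C).
Proof.
move=> [c [ac cp] [f' hf ff]] /(hol_at_atlas ac cp)[g' hg gg]; exists c => //.
exists (fun t => f' t * g' t : C); first exact: holCM.
by move: ff gg; apply: filterS2 => q -> ->.
Qed.

Lemma holV p f : f p != 0 -> hol_at p f -> hol_at p (fun q => (f q)^-1 : C).
Proof.
move=> f0 [c cp [g hg fg]]; exists c => //; exists (fun t => (g t)^-1 : C).
  by apply: holCV => //; rewrite -(nbhs_singleton fg).
by move: fg; apply: filterS => q ->.
Qed.

Lemma holX p f n : hol_at p f -> hol_at p (fun q => f q ^+ n : C).
Proof.
move=> hf; elim: n => [|n IH]; first exact: hol_cst.
by apply: hol_at_near (holM hf IH); apply: nearW => q; rewrite exprS.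
Qed.

Lemma holXz p f (n : int) : f p != 0 -> hol_at p f -> hol_at p (fun q => f q ^ n : C).
Proof.
move=> f0 hf; case: n => n; first exact: holX.
by apply: holV; [rewrite expf_neq0|exact: holX].
Qed.

Lemma hol_sum p (I : Type) (r : seq I) (P : pred I) (f : I -> X -> Co) :
  (forall i, P i -> hol_at p (f i)) -> hol_at p (fun q => \sum_(i <- r | P i) f i q).
Proof.
move=> H; elim: r => [|i r IH].
  by apply: hol_at_near (hol_cst p 0); apply: nearW => q; rewrite big_nil.
case Pi : (P i).
  by apply: hol_at_near (holD (H i Pi) IH); apply: nearW => q; rewrite big_cons Pi.
by apply: hol_at_near IH; apply: nearW => q; rewrite big_cons Pi.
Qed.

Lemma hol_neq0 p f : hol_at p f -> f p != 0 -> \forall q \near p, f q != 0.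
Proof. by move=> /hol_at_cont hf; exact: (@cvgr_neq0 _ _ _ (nbhs p) _ f (f p) hf). Qed.

(* Riemann surfaces have no isolated points, as charts are open maps. *)
Lemma near_neq p (P : set X) : (\forall q \near p, P q) -> exists2 q, q <> p & P q.
Proof.
move=> hP; have [c ac cp] := atlas_cover p.
have : nbhs p (dom c `&` P).
  by apply: filterI => //; apply: open_nbhs_nbhs; split=> //; exact: chart_open.
rewrite nbhsE => -[A [oA Ap] AP].
have oc : open (c @` A) by apply: chart_openmap => // q /AP[].
have : \forall t \near c p, (c @` A) t by apply: open_nbhs_nbhs; split=> //; exists p.
case/near_normcP => r r0 Hr.
have [|q Aq qp] := Hr (c p + (r / 2)%:C).
  by rewrite addrAC subrr add0r normc_real gtr0_norm; lra.
exists q; last by have [] := AP q Aq.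
move=> qp'; move: qp; rewrite qp' => /eqP.
rewrite -subr_eq0 opprD addrA subrr add0r oppr_eq0 => /eqP[/eqP].
by rewrite gt_eqF// divr_gt0.
Qed.

Lemma hol_eq0 p f : hol_at p f -> (\forall q \near p, q <> p -> f q = 0) -> f p = 0.
Proof.
move=> hf f0; apply/eqP; apply: contraT => fp.
have : \forall q \near p, f q != 0 /\ (q <> p -> f q = 0).
  by apply: filterI => //; exact: hol_neq0.
by move=> /near_neq[q qp [/eqP h /(_ qp)]].
Qed.

Section Coordinates.
Variables (p : X) (w : chart R X).
Hypothesis wp : coord_at p w.

Lemma coord_hol : hol_at p w.
Proof.
have [c ac cp] := atlas_cover p; case: wp => dp w0 /(_ c ac)[h _].
by exists c => //; exact: h.
Qed.

Lemma coord_near : \forall q \near p, dom w q.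
Proof. by case: wp => dp _ _; apply: open_nbhs_nbhs; split=> //; exact: chart_open. Qed.

Lemma coord_factor f : hol_at p f ->
  exists2 g, holC_at g 0 & \forall q \near p, f q = g (w q).
Proof.
case: wp => dp w0 hw hf; rewrite -w0; apply: hol_at_chart => // c ac.
by have [] := hw c ac.
Qed.

(** The removable singularity theorem read in the coordinate [w]. *)
Lemma coord_div f : hol_at p f -> f p = 0 ->
  exists2 h, hol_at p h & \forall q \near p, f q = w q * h q :> C.
Proof.
move=> /coord_factor[g hg fg] f0; case: (wp) => _ w0 _.
have g0 : g 0 = 0 by rewrite -[RHS]f0 (nbhs_singleton fg) w0.
have [k hk gk] := holC_factor hg g0; exists (k \o w).
  have [c [ac cp] [u hu wu]] := coord_hol; exists c => //.
  exists (k \o u); last by move: wu; apply: filterS => q /= ->.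
  by apply: holC_comp hu _; rewrite -(nbhs_singleton wu) w0.
by move: fg; apply: filterS => q ->; rewrite gk.
Qed.

Lemma coord_eq0 q : dom w q -> w q = 0 -> q = p.
Proof. by case: wp => dp w0 _ dq wq; apply: (chart_inj dq dp); rewrite wq w0. Qed.
End Coordinates.
End HolAt.

Section SmallCharts.
Variables (R : realType) (X : riemannSurface R).
Local Notation Co := (R[i]^o).
Variables (c : chart R X) (p : X) (A : set X).
Hypotheses (ac : atlas c) (cp : dom c p) (oA : open A) (Ap : A p).

Let w q : Co := c q - c p.

Let w_cont q : (dom c `&` A) q -> {for q, continuous w}.
Proof.
case=> cq _; apply: (@cvgB _ _ _ (nbhs q) _ c (fun=> c p)); first exact: chart_cont.
exact: cvg_cst.
Qed.

Let w_inj q q' : (dom c `&` A) q -> (dom c `&` A) q' -> w q = w q' -> q = q'.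
Proof. by move=> [cq _] [cq' _] /addIr; exact: chart_inj. Qed.

Let w_open B : open B -> B `<=` dom c `&` A -> open (w @` B).
Proof.
move=> oB BA; have -> : w @` B = (fun t : Co => t + c p) @^-1` (c @` B).
  rewrite eqEsubset; split=> [_ [q Bq <-]|t [q Bq qt]].
    by exists q => //; rewrite /w subrK.
  by exists q => //; rewrite /w qt addrK.
apply: open_comp; last by apply: chart_openmap => // q /BA[].
move=> t _; apply: (@cvgD _ _ _ (nbhs t) _ id (fun=> c p)); first exact: cvg_id.
exact: cvg_cst.
Qed.

(** A translated and shrunk chart of the atlas. Charts with small domain are needed because sections
    of twisted sheaves are described on the whole domain of a chart. *)
Lemma small_coord : exists2 v : chart R X, coord_at p v /\ (forall q, v q = c q - c p)
  & dom v `<=` A.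
Proof.
exists (Chart (openI (chart_open c) oA) w_cont w_inj w_open); last by move=> q [].
split=> //; split=> //=; first by rewrite /w subrr.
move=> d ad; split=> q /=; rewrite /hol_change /=.
  move=> dq [cq Aq]; have [g hg cg] := atlas_compat ad ac dq cq.
  exists (fun t => g t - c p); first exact: holCD hg (holC_cst _ _).
  by move: cg; apply: filterS => q'; rewrite /w => ->.
move=> [cq Aq] dq; have [g hg dg] := atlas_compat ac ad cq dq.
exists (g \o (fun t => t + c p)).
  apply: holC_comp; first exact: holCD (holC_id _) (holC_cst _ _).
  by rewrite /w subrK.
by move: dg; apply: filterS => q'; rewrite /w /= subrK.
Qed.
End SmallCharts.

(** * Generators of the maximal ideal of a point *)

Section Uniformizers.
Variables (R : realType) (X : riemannSurface R).
Local Notation C := R[i].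
Local Notation Co := (R[i]^o).
Implicit Types (p q : X) (f g u v : X -> Co).

(** Unlike a chart, such a function is moved by a deck transformation by mere composition, and it
    has no domain to keep track of. *)
Definition unif p u := [/\ hol_at p u, u p = 0
  & forall f, hol_at p f -> f p = 0 ->
    exists2 h, hol_at p h & \forall q \near p, f q = u q * h q :> C].

Lemma coord_unif p (w : chart R X) : coord_at p w -> unif p w.
Proof.
move=> wp; split; first exact: coord_hol.
  by case: wp.
by move=> f; exact: coord_div.
Qed.

(** The function [u] does not depend on [A]: a section can be factored by [u] before the domain of
    the chart is cut down to where the factorization holds. *)
Lemma coord_germ p : exists2 u, unif p u & forall A : set X, (\forall q \near p, A q) ->
  exists w : chart R X, [/\ coord_at p w, dom w `<=` A & forall q, w q = u q].
Proof.
have [c ac cp] := atlas_cover p; exists (fun q => c q - c p).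
  have [w [wp wE] _] := small_coord ac cp openT I.
  have -> : (fun q => c q - c p) = w by apply: funext => q; rewrite wE.
  exact: coord_unif.
move=> A; rewrite -[X in X -> _]/(nbhs p A) nbhsE => -[B [oB Bp] BA].
have [w [wp wE] wB] := small_coord ac cp oB Bp.
by exists w; split=> // q /wB/BA.
Qed.

Lemma unif_neq0 p u : unif p u -> \forall q \near p, q <> p -> u q != 0.
Proof.
have [u0 _ /(_ setT filterT)[w [wp _ _]]] := coord_germ p.
move=> [_ _ /(_ w (coord_hol wp))]; have [_ w0 _] := wp => /(_ w0)[h _].
move: (coord_near wp); apply: filterS2 => q dq wq qp.
by apply/eqP => uq; apply: qp; apply: (coord_eq0 wp dq); rewrite wq uq mul0r.
Qed.

(** The two quotients have product 1 off [p], where [u] does not vanish, hence also at [p] by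
    continuity. *)
Lemma unif_change p u v : unif p u -> unif p v ->
  exists2 h, hol_at p h /\ h p != 0 & \forall q \near p, v q = u q * h q :> C.
Proof.
move=> hu hv; have [hu1 u0 Hu] := hu; have [hv1 v0 Hv] := hv.
have [h hh vh] := Hu v hv1 v0; have [k hk uk] := Hv u hu1 u0.
exists h => //; split=> //.
have : h p * k p + (- 1) = 0 :> C.
  apply: (@hol_eq0 R X p (fun q => h q * k q + (- 1) : C)).
    by apply: holD; [exact: holM|exact: hol_cst].
  move: (unif_neq0 hu) vh uk; apply: filterS3 => q /[swap] vq /[swap] uq /[apply] u0q.
  apply: (mulfI u0q); rewrite mulr0 mulrDr mulrN1 mulrA -vq -uq.
  by rewrite subrr.
move/eqP; rewrite addr_eq0 opprK => /eqP hk1; apply/eqP => h0.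
by move: hk1; rewrite h0 mul0r => /eqP; rewrite eq_sym oner_eq0.
Qed.

(* [p] is excluded, where [u p ^ m] has the junk value [0] for [m < 0]. *)
Lemma unif_expz p u v (m : int) : unif p u -> unif p v ->
  exists2 h, hol_at p h & \forall q \near p, q <> p -> v q ^ m = u q ^ m * h q :> C.
Proof.
move=> hu hv; have [h [hh h0] vh] := unif_change hu hv.
exists (fun q => h q ^ m); first exact: holXz.
by move: vh; apply: filterS => q -> _; rewrite expfzMl.
Qed.
End Uniformizers.

Section HolMaps.
Variables (R : realType) (X Y : riemannSurface R) (f : Y -> X).
Hypothesis hf : hol_map f.

Lemma hol_map_near y (P : X -> Prop) : (\forall x \near f y, P x) -> \forall z \near y, P (f z).
Proof. by apply: near_comp; exact: hf.1. Qed.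

Lemma hol_map_inverse_unif (g : X -> Y) y u : hol_map g ->
  (forall z, g (f z) = z) -> (forall x, f (g x) = x) -> unif y u -> unif (f y) (u \o g).
Proof.
move=> hg gf fg [hu u0 Hu]; split.
- by apply: hg.2; rewrite gf.
- by rewrite /= gf.
- move=> k hk k0; have [|h hh kh] := Hu (k \o f) (hf.2 _ _ hk).
    by rewrite /= k0.
  exists (h \o g); first by apply: hg.2; rewrite gf.
  have := @near_comp _ _ g (f y) _ (hg.1 _); rewrite gf => /(_ _ kh).
  by apply: filterS => x /=; rewrite fg.
Qed.
End HolMaps.

Section FamTheory.
Variables (K : pzRingType) (P : Type) (T : P -> lmodType K).
Implicit Types s t : fam T.

Lemma famD s t p : (s + t) p = s p + t p. Proof. by []. Qed.
Lemma famN s p : (- s) p = - s p. Proof. by []. Qed.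
Lemma famZ a s p : (a *: s) p = a *: s p. Proof. by []. Qed.

Lemma fam_sum I (r : seq I) (Q : pred I) (F : I -> fam T) p :
  (\sum_(i <- r | Q i) F i) p = \sum_(i <- r | Q i) F i p.
Proof. by elim/big_rec2: _ => // i u v _ <-. Qed.

Lemma fam_ext s t : (forall p, s p = t p) -> s = t.
Proof. exact: functional_extensionality_dep. Qed.
Definition fscale (f : P -> K) s : fam T := fun p => f p *: s p.

Lemma fscaleE f s p : fscale f s p = f p *: s p. Proof. by []. Qed.
End FamTheory.

(** * Holomorphic sections of vector bundles and powers of maximal ideals *)

Section HolSections.
Variables (R : realType) (X : riemannSurface R) (E : vbundle X).
Local Notation C := R[i].
Local Notation Co := (R[i]^o).
Implicit Types (x y : X) (s t : fam E) (f : X -> Co).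

Lemma frame_near x F : frames F -> F.1 x ->
  \forall y \near x, (F : set X * (forall x, 'I_(rk E) -> E x)).1 y.
Proof. by move=> hF Fx; apply: open_nbhs_nbhs; split=> //; exact: frame_open. Qed.

Lemma hsec_frame x s F : frames F -> F.1 x -> hsec_at x s ->
  exists2 a : 'I_(rk E) -> X -> Co, forall i, hol_at x (a i)
    & \forall y \near x, s y = \sum_(i < rk E) (a i y : C) *: F.2 y i.
Proof.
move=> hF Fx [G [hG Gx] [b hb sb]]; have [a ha GF] := frame_change hF hG.
exists (fun i y => \sum_(j < rk E) b j y * a i j y : C).
  by move=> i; apply: hol_sum => j _; apply: holM => //; exact: ha.
move: sb (frame_near hF Fx) (frame_near hG Gx); apply: filterS3 => y -> Fy Gy.
under eq_bigr do rewrite GF// scaler_sumr.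
rewrite exchange_big; apply: eq_bigr => i _ /=; rewrite scaler_suml.
by apply: eq_bigr => j _; rewrite scalerA.
Qed.

Lemma hsec_near x s t : (\forall y \near x, s y = t y) -> hsec_at x t -> hsec_at x s.
Proof.
move=> st [F hF [a ha ta]]; exists F => //; exists a => //.
by move: st ta; apply: filterS2 => y -> ->.
Qed.

Lemma hsec0 x : hsec_at x (0 : fam E).
Proof.
have [F hF Fx] := frame_cover E x; exists F => //; exists (fun _ _ => 0).
  by move=> i; exact: hol_cst.
by apply: nearW => y; rewrite big1// => i _; rewrite scale0r.
Qed.

Lemma hsecD x s t : hsec_at x s -> hsec_at x t -> hsec_at x (s + t).
Proof.
move=> [F [hF Fx] [a ha sa]] /(hsec_frame hF Fx)[b hb tb]; exists F => //.
exists (fun i y => a i y + b i y); first by move=> i; exact: holD.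
move: sa tb; apply: filterS2 => y sa tb; rewrite famD sa tb -big_split.
by apply: eq_bigr => i _; rewrite scalerDl.
Qed.

Lemma hsecM x f s : hol_at x f -> hsec_at x s -> hsec_at x (fscale (f : X -> C) s).
Proof.
move=> hf [F hF [a ha sa]]; exists F => //; exists (fun i y => f y * a i y : C).
  by move=> i; exact: holM.
move: sa; apply: filterS => y sa; rewrite fscaleE sa scaler_sumr.
by apply: eq_bigr => i _; rewrite scalerA.
Qed.

Lemma hsecZ x (a : C) s : hsec_at x s -> hsec_at x (a *: s).
Proof. exact: (hsecM (hol_cst x a)). Qed.

Lemma hsecB x s t : hsec_at x s -> hsec_at x t -> hsec_at x (s - t).
Proof. by move=> hs ht; apply: hsecD => //; rewrite -scaleN1r; exact: hsecZ. Qed.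

Lemma hsec_sum x I (r : seq I) (Q : pred I) (F : I -> fam E) :
  (forall i, Q i -> hsec_at x (F i)) -> hsec_at x (\sum_(i <- r | Q i) F i).
Proof. by move=> H; elim/big_rec: _ => [|i u Qi]; [exact: hsec0|apply: hsecD; exact: H]. Qed.

Lemma hsec_at_open x s : hsec_at x s -> \forall y \near x, hsec_at y s.
Proof.
move=> [F [hF Fx] [a ha sa]].
have h : \forall y \near x, forall i, hol_at y (a i).
  apply: filter_forall => i; exact: hol_at_open.
move: (nbhs_interior sa) (frame_near hF Fx) h; apply: filterS3 => y h1 h2 h3.
by exists F => //; exists a.
Qed.

Lemma hsec_nbhs x s : hsec_at x s -> exists2 U : set X, open U /\ U x & hsec U s.
Proof.
move=> /hsec_at_open; rewrite -[X in X -> _]/(nbhs x (fun y => hsec_at y s)) nbhsE.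
by move=> -[U [oU Ux] Us]; exists U.
Qed.

Lemma hsec_eq0 x s : hsec_at x s -> (\forall y \near x, y <> x -> s y = 0) -> s x = 0.
Proof.
move=> [F [hF Fx] [a ha sa]] s0; rewrite (nbhs_singleton sa) big1// => i _.
suff -> : a i x = 0 by rewrite scale0r.
apply: hol_eq0 (ha i) _.
move: sa s0 (frame_near hF Fx); apply: filterS3 => y sa s0 Fy yx.
have [c [_ cu]] := frame_basis hF Fy 0.
have h1 : 0 = \sum_(i < rk E) (\row_i (a i y : C)) 0 i *: F.2 y i.
  apply: etrans (esym (s0 yx)) _; rewrite sa.
  by apply: eq_bigr => j _; rewrite mxE.
have h2 : 0 = \sum_(i < rk E) (0 : 'rV[C]_(rk E)) 0 i *: F.2 y i.
  by rewrite big1// => j _; rewrite mxE scale0r.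
have := congr1 (fun A : 'rV[C]__ => A 0 i) (etrans (esym (cu _ h1)) (cu _ h2)).
by rewrite !mxE.
Qed.

Lemma hsec_eq x s t : hsec_at x s -> hsec_at x t ->
  (\forall y \near x, y <> x -> s y = t y) -> s x = t x.
Proof.
move=> hs ht st; apply/eqP; rewrite -subr_eq0; apply/eqP.
apply: (@hsec_eq0 x (s - t)); first exact: hsecB.
by move: st; apply: filterS => y h /h; rewrite famD famN => ->; rewrite subrr.
Qed.
End HolSections.

Section MPow.
Variables (R : realType) (X : riemannSurface R).
Local Notation C := R[i].
Local Notation Co := (R[i]^o).

Section Bundle.
Variable E : vbundle X.
Local Notation OE := (bundle_omodule E).

Lemma germ_bundle x (s : fam E) : germ OE x s <-> hsec_at x s.
Proof. by split=> [[U [_ Ux] /(_ x Ux)]//|/hsec_nbhs[U hU hs]]; exists U. Qed.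

Lemma mpow_near0 (F : omodule X) m x s : om_near x s 0 -> mpow F m.+1 x s.
Proof.
move=> h; exists 0%N, (fun=> fun=> 0), (fun=> 0); split; first by case.
by move: h; apply: filterS => x' h p dp px; rewrite h// big_ord0.
Qed.

Lemma mpow_bundle_near0 m x (s : fam E) : (\forall y \near x, s y = 0) -> mpow OE m.+1 x s.
Proof.
move=> h; apply: mpow_near0; move: h; apply: filterS => y h p _ py.
by rewrite -py in h.
Qed.

Lemma mpow_bundleS m x (s : fam E) : mpow OE m.+1 x s <->
  exists (l : nat) (f : 'I_l -> X -> Co) (t : 'I_l -> fam E),
    (forall i, [/\ hol_at x (f i), f i x = 0 & mpow OE m x (t i)]) /\
    \forall y \near x, s y = \sum_(i < l) (f i y : C) *: t i y.
Proof.
split=> -[l [f [t [H st]]]]; exists l, f, t; split=> //; move: st; apply: filterS.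
  by move=> y h; exact: h y I erefl.
by move=> y h p _ py; rewrite -py in h.
Qed.

Lemma mpow_bundle_hsec m x (s : fam E) : mpow OE m x s -> hsec_at x s.
Proof.
elim: m s => [s /germ_bundle//|m IH s /mpow_bundleS[l [f [t [H st]]]]].
have h : hsec_at x (\sum_(i < l) fscale (f i : X -> C) (t i)).
  by apply: hsec_sum => i _; have [hf _ /IH ht] := H i; exact: hsecM.
by apply: hsec_near h; move: st; apply: filterS => y ->; rewrite fam_sum.
Qed.
End Bundle.
End MPow.

(** * The covering *)

Lemma near_seq (T : topologicalType) (I : eqType) (l : seq I) (x : T) (P : I -> T -> Prop) :
  (forall i, i \in l -> \forall y \near x, P i y) ->
  \forall y \near x, forall i, i \in l -> P i y.
Proof.
elim: l => [|i l IH] H; first exact: nearW.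
have h1 := H i (mem_head i l).
have h2 : \forall y \near x, forall j, j \in l -> P j y.
  by apply: IH => j jl; apply: H; rewrite in_cons jl orbT.
by move: h1 h2; apply: filterS2 => y ? hl j; rewrite in_cons => /orP[/eqP->|/hl].
Qed.

Lemma hausdorff_near_neq (T : topologicalType) (x y : T) : hausdorff_space T ->
  x <> y -> \forall z \near x, z <> y.
Proof.
move=> hT xy; have cl : closed [set y] by apply: compact_closed => //; exact: compact_set1.
by apply: open_nbhs_nbhs; split; [exact: closed_openC|exact: xy].
Qed.

Section Covering.
Variables (R : realType) (X Y : riemannSurface R) (n : nat) (pt : 'I_n -> X).
Variables (N : 'I_n -> nat) (Gam : finGroupType) (phi : galoisCover Y pt N Gam).
Hypotheses (Y_compact : compact [set: Y]) (N_gt0 : forall i, (0 < N i)%N).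
Local Notation C := R[i].
Local Notation X' := (punctured pt).
Implicit Types (x : X) (y p q : Y) (g h : Gam).

Lemma phi_near y (P : X -> Prop) : (\forall x \near phi y, P x) -> \forall p \near y, P (phi p).
Proof. exact: hol_map_near (cov_hol phi) _ _. Qed.

Lemma near_punctured x : \forall x' \near x, x' <> x -> X' x'.
Proof.
have h : \forall x' \near x, forall i, x' <> x -> pt i <> x'.
  apply: filter_forall => i; have [->|ix] := pselect (pt i = x).
    by apply: nearW => x' h /esym.
  have := hausdorff_near_neq (@rs_hausdorff _ X) (nesym ix).
  by apply: filterS => x' h _ /esym.
by move: h; apply: filterS => x' h xx i; exact: h.
Qed.

Lemma punctured_near x : X' x -> \forall x' \near x, X' x'.
Proof.
move=> hx; move: (near_punctured x); apply: filterS => x' h.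
by have [->|/h] := pselect (x' = x).
Qed.

Lemma open_punctured : open X'.
Proof. by rewrite openE => x /punctured_near. Qed.

Lemma ramified y : exists2 e, (0 < e)%N & ramified_at phi y e.
Proof.
have [hy|] := pselect (X' (phi y)); first by exists 1%N => //; exact: cov_unram.
by move=> /existsNP[i /contrapT yi]; exists (N i) => //; apply: cov_ram; rewrite yi.
Qed.

Lemma fibre_discrete y : \forall p \near y, phi p = phi y -> p = y.
Proof.
have [e e0 [w [z [wy zy wz zw]]]] := ramified y.
move: (coord_near wy); apply: filterS => p dp pe; apply: (coord_eq0 wy dp).
have [_ z0 _] := zy; have := zw p dp; rewrite pe z0 => /esym/eqP.
by rewrite expf_eq0 e0 => /eqP.
Qed.

Lemma near_phi_punctured y : \forall p \near y, p <> y -> X' (phi p).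
Proof.
move: (phi_near (near_punctured (phi y))) (fibre_discrete y).
by apply: filterS2 => p h1 h2 py; apply: h1 => /h2.
Qed.

Lemma deckK g : cancel (deck phi g) (deck phi g^-1%g).
Proof. by move=> y; rewrite -deckM mulVg deck1. Qed.

Lemma deckVK g : cancel (deck phi g^-1%g) (deck phi g).
Proof. by move=> y; rewrite -deckM mulgV deck1. Qed.

Lemma deck_near g y (P : Y -> Prop) :
  (\forall p \near deck phi g y, P p) -> \forall p \near y, P (deck phi g p).
Proof. exact: hol_map_near (deck_hol phi g) _ _. Qed.

Lemma deck_unif g y u : unif y u -> unif (deck phi g y) (u \o deck phi g^-1%g).
Proof.
by apply: hol_map_inverse_unif; [exact: deck_hol|exact: deck_hol|exact: deckK|exact: deckVK].
Qed.

Lemma deck_punctured g y : X' (phi (deck phi g y)) <-> X' (phi y).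
Proof. by rewrite deck_cov. Qed.

(** The interior of the fixed point set. It is open by construction, so that its closedness suffices
    for the connectedness argument. *)
Let fixed g : set Y := [set p | \forall q \near p, deck phi g q = q].

Let fixed_ram g y e (w : chart R Y) (z : chart R X) : coord_at y w ->
  (forall p, dom w p -> z (phi p) = w p ^+ e) -> deck phi g y = y ->
  \forall q \near y, [/\ dom w q, dom w (deck phi g q) & w (deck phi g q) ^+ e = w q ^+ e :> C].
Proof.
move=> wy zw gy; have h : \forall q \near y, dom w (deck phi g q).
  by apply: deck_near; rewrite gy; exact: coord_near.
move: (coord_near wy) h; apply: filterS2 => q h1 h2; split=> //.
by rewrite -(zw q h1) -(zw _ h2) deck_cov.
Qed.

(** At a limit point y write w o g = w h with a coordinate w at y. Off y one has h^e = 1, as z o phi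
    = w^e is invariant, and h = 1 at points of [fixed g] close to y, so h y = 1. The cofactor 1 + h
    + ... + h^(e-1) of h - 1 equals e at y, hence does not vanish nearby, and h = 1 around y. *)
Let fixed_closed g : closed (fixed g).
Proof.
move=> y cy; have gy : deck phi g y = y.
  apply/esym; apply: (@rs_hausdorff _ Y) => A B nA nB.
  have [q [/nbhs_singleton qf [Aq Bq]]] := cy _ (filterI nA (deck_near nB)).
  by exists q; split=> //; rewrite -qf.
have [//|nfy] := pselect (fixed g y).
have [e e0 [w [z [wy zy wz zw]]]] := ramified y.
have [_ w0 _] := wy; have [wu _ Hw] := coord_unif wy.
have [||h hh wh] := Hw (w \o deck phi g).
- by apply: (deck_hol phi g).2; rewrite gy.
- by rewrite /= gy.
have h1 : \forall q \near y, q <> y -> h q ^+ e = 1 :> C.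
  move: (fixed_ram wy zw gy) wh (unif_neq0 (coord_unif wy)).
  apply: filterS3 => q [_ _ hq] wq /[apply] w0q.
  move: hq; rewrite -[w (deck phi g q)]/((w \o deck phi g) q) wq exprMn => hq.
  by apply: (mulfI (expf_neq0 e w0q)); rewrite hq mulr1.
have hy1 : h y = 1.
  apply/eqP; rewrite -subr_eq0; apply: contraT => hn.
  have hol_h1 : hol_at y (fun q => h q + (- 1) : C) by apply: holD => //; exact: hol_cst.
  have : \forall q \near y, [/\ q <> y -> w q != 0, h q + (- 1) != 0 &
      (w \o deck phi g) q = w q * h q :> C].
    by move: (unif_neq0 (coord_unif wy)) (hol_neq0 hol_h1 hn) wh; exact: filterS3.
  move=> /cy[q [qf [wq hq whq]]].
  have gq := nbhs_singleton qf; have qy : q <> y by move=> qy; apply: nfy; rewrite -qy.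
  move: whq; rewrite /= gq -[X in X = _]mulr1 => /(mulfI (wq qy)) h1q.
  by move: hq; rewrite -h1q subrr eqxx.
pose S q : C := \sum_(i < e) h q ^+ i.
have hS : hol_at y S by apply: hol_sum => i _; exact: holX.
have Sy : S y != 0.
  rewrite /S hy1; under eq_bigr do rewrite expr1n.
  by rewrite sumr_const card_ord pnatr_eq0 -lt0n.
have h2 : \forall q \near y, q <> y -> h q = 1.
  move: h1 (hol_neq0 hS Sy); apply: filterS2 => q /[swap] Sq /[apply] hq.
  apply/eqP; rewrite -subr_eq0; have := subrX1 (h q) e; rewrite hq subrr => /esym/eqP.
  by rewrite mulf_eq0 (negbTE Sq) orbF.
move: h2 wh (fixed_ram wy zw gy); apply: filterS3 => q h2 whq [d1 d2 _].
have [->//|/h2 hq] := pselect (q = y).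
by apply: (chart_inj d2 d1); move: whq; rewrite /= hq mulr1.
Qed.

(** Over [X'] the coordinate w is invariant, as e = 1, so a fixed point is fixed together with a
    neighbourhood. By connectedness [g] is then the identity everywhere, and the action is
    faithful. *)
Lemma deck_free g y : X' (phi y) -> deck phi g y = y -> g = 1%g.
Proof.
move=> hy gy; apply: (@deck_faithful _ _ _ _ _ _ _ phi) => p.
have fT : fixed g = setT.
  apply: (@rs_connected _ Y).
  - exists y; have [w [z [wy zy wz zw]]] := cov_unram hy.
    move: (fixed_ram wy zw gy); apply: filterS => q [d1 d2].
    by rewrite !expr1; exact: chart_inj.
  - exists (fixed g); last by rewrite setTI.
    by rewrite openE => q /nbhs_interior; apply: filterS => r.
  - exists (fixed g); last by rewrite setTI.
    exact: fixed_closed.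
have : fixed g p by rewrite fT.
exact: nbhs_singleton.
Qed.

Lemma deck_free_inj g h y : X' (phi y) -> deck phi g y = deck phi h y -> g = h.
Proof.
move=> hy gh; have : (h^-1 * g)%g = 1%g.
  by apply: (@deck_free _ y) => //; rewrite deckM gh deckK.
by move/(congr1 (mulg h)); rewrite mulKVg mulg1.
Qed.

Lemma fibre_exists x : exists l : seq Y, uniq l /\ forall y, (y \in l) <-> phi y = x.
Proof.
have [y0 y0x] := cov_surj phi x.
exists (undup [seq deck phi g y0 | g <- enum Gam]); split; first exact: undup_uniq.
move=> y; rewrite mem_undup; split.
  by move=> /mapP[g _ ->]; rewrite deck_cov.
move=> yx; have [g ->] := @deck_trans _ _ _ _ _ _ _ phi y0 y (etrans y0x (esym yx)).
by apply/mapP; exists g => //; rewrite mem_enum.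
Qed.

Definition fibre x : seq Y := projT1 (cid (fibre_exists x)).

Lemma fibre_uniq x : uniq (fibre x).
Proof. by rewrite /fibre; case: cid => l []. Qed.

Lemma mem_fibre x y : (y \in fibre x) <-> phi y = x.
Proof. by rewrite /fibre; case: cid => l []. Qed.

(* As [Y] is compact, [phi] is a closed map. *)
Lemma fibre_nbhs x (O : Y -> set Y) : (forall y, phi y = x -> \forall p \near y, O y p) ->
  exists (U : set X) (D : Y -> set Y), [/\ open U /\ U x,
    forall y, phi y = x -> [/\ open (D y), D y y & D y `<=` O y],
    forall y y' p, phi y = x -> phi y' = x -> D y p -> D y' p -> y = y'
  & forall p, U (phi p) -> exists2 y, phi y = x & D y p].
Proof.
move=> HO.
have sep (y y' : Y) : exists AB : set Y * set Y, y <> y' ->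
    [/\ \forall p \near y, AB.1 p, \forall p \near y', AB.2 p & forall p,
      AB.1 p -> AB.2 p -> False].
  have [->|/eqP yy'] := pselect (y = y'); first by exists (setT, setT).
  have := @rs_hausdorff _ Y;
    rewrite open_hausdorff => /(_ y y' yy')[[A B] /= [yA y'B] [oA oB AB]].
  exists (A, B) => _; split => /=.
  - by apply: open_nbhs_nbhs; split=> //; exact: set_mem.
  - by apply: open_nbhs_nbhs; split=> //; exact: set_mem.
  - by move=> p Ap Bp; move/eqP: AB => AB; have : (A `&` B) p by []; rewrite AB.
have [S {}sep] := choice (fun yy : Y * Y => sep yy.1 yy.2).
(* [S] separates ordered pairs, so a disc must lie in the first set for [(y, y')] and in the second
   one for [(y', y)]; the discs of y and y' are then disjoint by [S (y, y')] alone. *)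
pose D' y p := O y p /\ forall y', y' \in fibre x -> y' <> y -> (S (y, y')).1 p /\ (S (y',
  y)).2 p.
pose D y := (D' y)^°.
have Dnear y : phi y = x -> \forall p \near y, D' y p.
  move=> yx; have h2 : \forall p \near y, forall y', y' \in fibre x -> y' <> y ->
      (S (y, y')).1 p /\ (S (y', y)).2 p.
    apply: near_seq => y' _; have [->|yy'] := pselect (y' = y); first exact: nearW.
    have [/= h1 _ _] := sep (y, y') (nesym yy'); have [/= _ h2 _] := sep (y', y) yy'.
    by move: h1 h2; apply: filterS2.
  by move: (HO y yx) h2; apply: filterS2.
have Dsub y : D y `<=` D' y by exact: interior_subset.
pose V := \bigcup_(y in [set y | phi y = x]) D y.
have oV : open V by apply: bigcup_open => y _; exact: open_interior.
have cK : compact (phi @` (~` V)).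
  apply: continuous_compact; first exact/continuous_subspaceT/(cov_hol phi).1.
  by apply: (subclosed_compact _ Y_compact) => //; exact: open_closedC.
exists (~` (phi @` (~` V))), D; split.
- split; first by apply: closed_openC; apply: compact_closed => //; exact: rs_hausdorff.
  by case=> y nVy yx; apply: nVy; exists y => //; exact: Dnear.
- move=> y yx; split; [exact: open_interior|exact: Dnear|].
  by move=> p /Dsub[].
- move=> y y' p yx y'x /Dsub[_ h] /Dsub[_ h']; apply: contrapT => yy'.
  have [_ _ /(_ p)] := sep (y, y') yy'; apply => /=.
    by have [] := h y' ((mem_fibre x y').2 y'x) (nesym yy').
  by have [] := h' y ((mem_fibre x y).2 yx) yy'.
- move=> p Up; have [//|nVp] := pselect (V p).
  by case: Up; exists p.
Qed.

(** With ramification order 1, [phi] is read as the identity in the coordinates [w] and [z], and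
    charts are open maps. *)
Lemma phi_open_near y (P : X -> Prop) : X' (phi y) -> (\forall p \near y, P (phi p)) ->
  \forall x \near phi y, P x.
Proof.
move=> Xy hP; have [w [z [wy zy wz zw]]] := cov_unram Xy.
have [A [[oA Ay] Aw AP]] : exists A : set Y, [/\ open A /\ A y, A `<=` dom w & forall p,
  A p -> P (phi p)].
  have : nbhs y (dom w `&` (fun p => P (phi p))) by apply: filterI => //; exact: coord_near.
  by rewrite nbhsE => -[A [oA Ay] h]; exists A; split=> // p /h[].
have nA : \forall c \near z (phi y), (w @` A) c.
  apply: open_nbhs_nbhs; split; first exact: chart_openmap.
  have [dy _ _] := wy; rewrite zw// expr1.
  by exists y.
have [dz _ _] := zy.
move: (near_comp (chart_cont dz) nA) (coord_near zy); apply: filterS2 => x [p Ap wp] dx.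
have dp : dom z (phi p) by apply: wz; exists p => //; exact: Aw.
have <- : phi p = x by apply: (chart_inj dp dx); rewrite zw ?expr1//; exact: Aw.
exact: AP.
Qed.

(** The discs cut the preimage of [U] into disjoint open pieces, so each piece is relatively closed.
    Hence cutting a section off to one disc keeps it holomorphic, and the indicator of a disc is
    locally constant there. *)
Lemma disc_near x (U : set X) (D : Y -> set Y) y q :
  (forall y, phi y = x -> open (D y)) ->
  (forall y y' p, phi y = x -> phi y' = x -> D y p -> D y' p -> y = y') ->
  (forall p, U (phi p) -> exists2 y, phi y = x & D y p) -> phi y = x -> U (phi q) ->
  (\forall p \near q, D y p) \/ (\forall p \near q, ~ D y p).
Proof.
move=> oD disj cov yx /cov[y0 y0x Dq].
have nD : \forall p \near q, D y0 p by apply: open_nbhs_nbhs; split=> //; exact: oD.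
have [yy|yy] := pselect (y0 = y); first by left; rewrite -yy.
by right; move: nD; apply: filterS => p h /disj/(_ h) - /(_ yx y0x)/esym.
Qed.
End Covering.

(** * Sections of twisted direct images *)

Section Twists.
Variables (R : realType) (X Y : riemannSurface R) (n : nat) (pt : 'I_n -> X).
Variables (N : 'I_n -> nat) (Gam : finGroupType) (phi : galoisCover Y pt N Gam).
Hypotheses (pt_inj : injective pt) (N_gt0 : forall i, (0 < N i)%N).
Local Notation C := R[i].
Local Notation Co := (R[i]^o).
Local Notation X' := (punctured pt).

Lemma orb_div_punctured t y : X' (phi y) -> orb_div phi t y = 0.
Proof. by move=> hy; rewrite /orb_div big_pred0// => i; apply/eqP; exact: hy. Qed.

Lemma orb_div_over t y i : pt i = phi y -> orb_div phi t y = Num.floor (- t * (N i)%:R).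
Proof.
move=> iy; rewrite /orb_div (bigD1 i) ?iy ?eqxx//= big1 ?addr0// => j /andP[/eqP jy].
by rewrite (pt_inj (etrans jy (esym iy))) eqxx.
Qed.

Lemma orb_div0 y : orb_div phi 0 y = 0.
Proof. by rewrite /orb_div big1// => i _; rewrite oppr0 mul0r floor0. Qed.

(** This is floor x + floor (- x) <= 0. It means that products of sections of V_a and E_b with a + b
    = 0 acquire no poles. *)
Lemma orb_divD_le0 a b y : a + b = 0 -> orb_div phi a y + orb_div phi b y <= 0.
Proof.
move=> ab; rewrite /orb_div -big_split sumr_le0// => i _ /=.
have -> : b = - a by apply/eqP; rewrite -addr_eq0 addrC ab.
rewrite -(ler_int R) rmorphD /= opprK.
have := floor_le (- a * (N i)%:R : R); have := floor_le (a * (N i)%:R : R).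
by rewrite mulNr; lra.
Qed.

Section Germs.
Variables (T : Y -> lmodType C) (H : Y -> fam T -> Prop).
Hypothesis H_open : forall y s, H y s -> \forall p \near y, H p s.
Hypothesis H_scale : forall y (f : Y -> Co) s, hol_at y f -> H y s ->
  H y (fscale (f : Y -> C) s).

(* The germ at [y] of a section of [T (x) O (sum_i floor (- t N_i) phi^-1 (x_i)_red)]. *)
Definition twisted (t : R) (y : Y) (s : fam T) := exists2 u : Y -> Co, unif y u &
  exists2 tau, H y tau & \forall p \near y, X' (phi p) ->
    s p = ((u p : C) ^ (- orb_div phi t y)) *: tau p.

Lemma twisted_unif t y s u : twisted t y s -> unif y u ->
  exists2 tau, H y tau & \forall p \near y, X' (phi p) ->
    s p = ((u p : C) ^ (- orb_div phi t y)) *: tau p.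
Proof.
(* Above [X'] the formula is also claimed at [y] itself, where [unif_expz] is silent; there the
   exponent is 0. *)
move=> [v hv [tau htau sv]] hu; have [hy|hy] := pselect (X' (phi y)).
  exists tau; first exact: htau.
  move: sv; rewrite (orb_div_punctured _ hy) oppr0.
  by apply: filterS => p h /h ->; rewrite !expr0z.
have [h hh vh] := unif_expz (- orb_div phi t y) hu hv.
exists (fscale h tau); first exact: H_scale.
move: sv vh; apply: filterS2 => p sv vh hp; rewrite sv// fscaleE scalerA vh// => py.
by apply: hy; rewrite -py.
Qed.

Lemma twisted_near t y s s' : (\forall p \near y, X' (phi p) -> s p = s' p) ->
  twisted t y s' -> twisted t y s.
Proof.
move=> ss [u hu [tau htau su]]; exists u => //; exists tau => //.
by move: ss su; apply: filterS2 => p h1 h2 hp; rewrite h1// h2.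
Qed.

(** Passes from charts to germs with an arbitrary uniformizer; the chart asked for is recovered by
    shrinking. It serves both for orbifold bundles and for functions. *)
Lemma direct_imageP t (U : set X) s :
  direct_image_sec phi (fun A s => forall y, A y -> H y s) t U s <->
  forall y, U (phi y) -> twisted t y s.
Proof.
split=> [h y /h[w [tau [wy htau sw]]]|h y /h tw].
  exists w; first exact: coord_unif.
  exists tau; first by apply: htau; case: wy.
  by move: (coord_near wy); apply: filterS => p; exact: sw.
have [u hu Hu] := coord_germ y; have [tau htau su] := twisted_unif tw hu.
have : \forall p \near y, H p tau /\ (X' (phi p) ->
    s p = ((u p : C) ^ (- orb_div phi t y)) *: tau p).
  by move: (H_open htau) su; exact: filterS2.
move=> /Hu[w [wy wA wu]]; exists w, tau; split=> // p /wA[] //.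
by rewrite wu.
Qed.
End Germs.

(** By [orb_divD_le0] the two exponents add up to some k >= 0, so the product is u^k times something
    holomorphic. *)
Lemma twisted_mul (T : Y -> lmodType C) (H : Y -> fam T -> Prop) a b y
    (f : fam (fun _ : Y => Co : lmodType C)) s :
  (forall y (f : Y -> Co) s, hol_at y f -> H y s -> H y (fscale (f : Y -> C) s)) ->
  a + b = 0 ->
  @twisted (fun _ : Y => Co : lmodType C) (@hol_at R Y) b y f -> twisted H a y s ->
  exists2 tau, H y tau & \forall p \near y, X' (phi p) -> (f p : C) *: s p = tau p.
Proof.
move=> H_scale ab [u hu [g hg fu]] /(twisted_unif H_scale) - /(_ u hu)[tau htau su].
have [k kE] : exists k : nat, - orb_div phi a y - orb_div phi b y = k%:Z.
  have := orb_divD_le0 y ab; rewrite -oppr_ge0 opprD.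
  by case: (- _ - _) => // k _; exists k.
exists (fscale (fun p => u p ^+ k * g p : C) tau).
  by apply: H_scale => //; apply: holM => //; apply: holX; case: hu.
move: fu su (unif_neq0 hu); apply: filterS3 => p fu su u0 hp.
have {}fu : f p = (u p : C) ^ (- orb_div phi b y) * g p := fu hp.
rewrite fscaleE (su hp) fu scalerA; congr (_ *: _).
rewrite mulrAC; congr (_ * _); rewrite exprnP -kE mulrC.
have [hy|hy] := pselect (X' (phi y)).
  by rewrite !(orb_div_punctured _ hy) oppr0 addr0 !expr0z mulr1.
by rewrite expfzDr ?u0// => py; apply: hy; rewrite -py.
Qed.
End Twists.

(** Deck transformations compose only up to equalities between base points, so vectors are compared
    in the total space; within one fibre nothing is lost by this. *)
Lemma in_total_inj (R : realType) (X : riemannSurface R) (E : vbundle X) (x : X) :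
  injective (@in_total R X E x).
Proof.
move=> u v uv; pose f (w : {x : X & E x}) : E x :=
  if pselect (tag w = x) is left e then eq_rect _ (fun x => E x : Type) (tagged w) _ e else 0.
have fE (w : E x) : f (in_total w) = w.
  by rewrite /f; case: pselect => //= e; rewrite (Prop_irrelevance e erefl).
by rewrite -(fE u) uv fE.
Qed.

(** * Translates by the deck group, and sections of the direct image of an orbifold bundle *)

Section OrbifoldBundles.
Variables (R : realType) (X Y : riemannSurface R) (n : nat) (pt : 'I_n -> X).
Variables (N : 'I_n -> nat) (Gam : finGroupType) (phi : galoisCover Y pt N Gam).
Variables (VV : orbBundle phi).
Implicit Types (y p q : Y) (g h : Gam).

Lemma orb_actK g p (v : VV p) :
  in_total (orb_act VV g^-1%g (deck phi g p) (orb_act VV g p v)) = in_total v.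
Proof. by rewrite -orb_actM mulVg orb_act1. Qed.

Lemma orb_act_inj g p : injective (orb_act VV g p).
Proof.
by move=> u v uv; apply: in_total_inj; rewrite -(orb_actK g u) uv orb_actK.
Qed.

Lemma translate g (s : fam VV) : exists t : fam VV,
  forall p, t (deck phi g p) = orb_act VV g p (s p).
Proof.
have ex q : exists v : VV q, forall p,
  deck phi g p = q -> in_total v = in_total (orb_act VV g p (s p)).
  rewrite -(deckVK phi g q); set p := deck phi g^-1%g q.
  exists (orb_act VV g p (s p)) => p' pp'.
  by have -> : p' = p by apply: (can_inj (deckK phi g)).
exists (fun q => projT1 (cid (ex q))) => p; case: cid => v /= /(_ p erefl) h.
exact: in_total_inj.
Qed.

Lemma translate_inv g (s : fam VV) : exists2 t : fam VV,
  forall p, orb_act VV g p (t p) = s (deck phi g p)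
  & forall p, hsec_at (deck phi g p) s -> hsec_at p t.
Proof.
have [t tE] := translate g^-1 s; exists t.
  have h p q : p = deck phi g^-1%g q -> in_total (orb_act VV g p (t p)) = in_total (s q).
    by move=> ->; rewrite tE -orb_actM mulgV orb_act1.
  by move=> p; apply: in_total_inj; apply: h; rewrite deckK.
move=> p hs; have := orb_act_hol hs tE; by rewrite deckK.
Qed.

End OrbifoldBundles.

Section Correspondence.
Variables (R : realType) (X Y : riemannSurface R) (n : nat) (pt : 'I_n -> X).
Variables (N : 'I_n -> nat) (Gam : finGroupType) (phi : galoisCover Y pt N Gam).
Variables (V : parBundle pt) (VV : orbBundle phi) (iV : corresponds V VV).
Hypotheses (Y_compact : compact [set: Y]) (pt_inj : injective pt).
Hypothesis N_gt0 : forall i, (0 < N i)%N.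
Local Notation C := R[i].
Local Notation Co := (R[i]^o).
Local Notation X' := (punctured pt).
Local Notation SV := (fam (fun y : Y => V (phi y))).
Local Notation tw := (@twisted R X Y n pt N Gam phi VV (@hsec_at R Y VV)).
Implicit Types (x : X) (y p q : Y) (g h : Gam) (sig : SV).

Definition push sig : fam VV := fun y => orb_iso iV y (sig y).

Lemma twP t (U : set X) (s : fam VV) :
  orb_sec t U s <-> forall y, U (phi y) -> tw t y s.
Proof.
apply: direct_imageP; first exact: (@hsec_at_open R Y VV).
exact: (@hsecM R Y VV).
Qed.

Lemma ctwP t (U : set X) (f : fam (fun _ : Y => Co : lmodType C)) : cE_sec phi t U f <->
  forall y, U (phi y) ->
    @twisted R X Y n pt N Gam phi (fun _ : Y => Co : lmodType C) (@hol_at R Y) t y f.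
Proof.
apply: direct_imageP; first exact: (@hol_at_open R Y).
exact: (@holM R Y).
Qed.

(** The condition at [y] that will describe (V (x) E)_0: seen in [VV], the family extends
    holomorphically over [y]. Values over S are ignored. *)
Definition hols y sig := exists2 tau : fam VV, hsec_at y tau &
  \forall p \near y, X' (phi p) -> orb_iso iV p (sig p) = tau p.

Lemma hols_tw0 y sig : hols y sig <-> tw 0 y (push sig).
Proof.
split=> [[tau htau st]|[u hu [tau htau st]]].
  have [u hu _] := coord_germ y; exists u => //; exists tau => //.
  by move: st; apply: filterS => p h /h; rewrite orb_div0 oppr0 expr0z scale1r.
exists tau => //; move: st; apply: filterS => p h /h.
by rewrite orb_div0 oppr0 expr0z scale1r.
Qed.

Lemma par_sec_tw t (U : set X) (s : fam V) : open U ->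
  par_sec t U s <-> forall y, U (phi y) -> tw t y (pull (orb_iso iV) s).
Proof. by move=> oU; rewrite (orb_iso_fil iV) //; exact: twP. Qed.

(** The easy inclusion of (V (x) E)_0 in the direct image of [VV]: in each summand [twisted_mul]
    lets the zeros of one factor compensate the poles of the other. *)
Lemma tensE_hols (U : set X) sig : @tensE_sec R X Y n pt N Gam phi V 0 U sig ->
  forall y, U (phi y) -> hols y sig.
Proof.
move=> + y Uy => /(_ _ Uy)[U' [oU' U'y] [l [a [b [s [f [H sE]]]]]]].
have h j : exists tau : fam VV, hsec_at y tau /\ \forall p \near y, X' (phi p) ->
    (f j p : C) *: pull (orb_iso iV) (s j) p = tau p.
  have [ab /(par_sec_tw _ _ oU') hs /ctwP hf] := H j.
  have [tau htau tE] := twisted_mul (@hsecM R Y VV) ab (hf y U'y) (hs y U'y).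
  by exists tau.
have [tau Htau] := choice h.
exists (\sum_(j < l) tau j); first by apply: hsec_sum => j _; have [] := Htau j.
have h2 : \forall p \near y, forall j, X' (phi p) ->
    (f j p : C) *: pull (orb_iso iV) (s j) p = tau j p.
  by apply: filter_forall => j; have [] := Htau j.
have h3 : \forall p \near y, U' (phi p).
  by apply: phi_near; apply: open_nbhs_nbhs.
move: h2 h3; apply: filterS2 => p hp U'p Xp.
rewrite sE// linear_sum fam_sum; apply: eq_bigr => j _.
by rewrite linearZ -(hp j Xp).
Qed.

(** The types [V (phi q)] vary with [q] even along a fibre; transport to [V x], with default value 0
    off the fibre, allows values over one point to be added. *)
Definition atx sig x q : V x :=
  if pselect (phi q = x) is left e then eq_rect _ (fun x => V x : Type) (sig q) _ e else 0.

Lemma atxE sig q : atx sig (phi q) q = sig q.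
Proof. by rewrite /atx; case: pselect => //= e; rewrite (Prop_irrelevance e erefl). Qed.

Lemma atxZ (f : Y -> C) sig x q : phi q = x -> atx (fscale f sig) x q = f q *: atx sig x q.
Proof. by move=> <-; rewrite !atxE. Qed.

(** The pull-back of [sig] by [g], with the fibres at p and g p identified through phi (g p) = phi
    p. By [push_conjugate] it becomes in [VV] the translate by the inverse of [g]. *)
Definition conjugate g sig : SV := fun p => atx sig (phi p) (deck phi g p).

Lemma push_conjugate g sig p : X' (phi p) ->
  orb_act VV g p (push (conjugate g sig) p) = push sig (deck phi g p).
Proof.
move=> Xp; have := orb_iso_equiv iV g (fun x => atx sig x (deck phi g p)) Xp.
by rewrite /pull /push atxE.
Qed.

Lemma tw_conjugate t g y sig : tw t (deck phi g y) (push sig) ->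
  tw t y (push (conjugate g sig)).
Proof.
move=> [u hu [tau htau sE]].
have [t' t'E ht'] := translate_inv g tau.
exists (u \o deck phi g).
  by have := @deck_unif _ _ _ _ _ _ _ phi g^-1%g _ _ hu; rewrite invgK deckK.
exists t'; first exact: ht'.
move: (deck_near sE); apply: filterS => p h Xp.
have {}h := h (proj2 (deck_punctured phi g p) Xp).
apply: (@orb_act_inj _ _ _ _ _ _ _ _ _ g); rewrite push_conjugate// h linearZ /= t'E.
by rewrite /orb_div deck_cov.
Qed.

Lemma tw_near t y s s' : (\forall p \near y, X' (phi p) -> s p = s' p) ->
  tw t y s' -> tw t y s.
Proof. exact: twisted_near. Qed.

Lemma tw0 t y : tw t y 0.
Proof.
have [u hu _] := coord_germ y; exists u => //; exists 0; first exact: hsec0.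
by apply: nearW => p _; rewrite scaler0.
Qed.

Lemma twD t y s s' : tw t y s -> tw t y s' -> tw t y (s + s').
Proof.
move=> [u hu [tau htau sE]] /(twisted_unif (@hsecM R Y VV)) - /(_ u hu)[tau' htau' sE'].
exists u => //; exists (tau + tau'); first exact: hsecD.
by move: sE sE'; apply: filterS2 => p h h' Xp; rewrite famD h// h'// -scalerDr.
Qed.

Lemma tw_sum t y I (r : seq I) (Q : pred I) (F : I -> fam VV) :
  (forall i, Q i -> tw t y (F i)) -> tw t y (\sum_(i <- r | Q i) F i).
Proof. by move=> H; elim/big_rec: _ => [|i u Qi]; [exact: tw0|apply: twD; exact: H]. Qed.

(** Over [X'], the identity of V tensored with the trace of phi_* O_Y over O_X. *)
Definition trace sig : fam V := fun x => \sum_(q <- fibre phi x) atx sig x q.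

Lemma perm_fibre p : X' (phi p) ->
  perm_eq (fibre phi (phi p)) [seq deck phi g p | g <- enum Gam].
Proof.
move=> Xp; apply: uniq_perm; first exact: fibre_uniq.
  rewrite map_inj_in_uniq ?enum_uniq// => g h _ _; exact: deck_free_inj.
move=> q; apply/idP/idP.
  move=> /mem_fibre qp; have [g ->] := @deck_trans _ _ _ _ _ _ _ phi p q (esym qp).
  by apply/mapP; exists g => //; rewrite mem_enum.
by move=> /mapP[g _ ->]; apply/mem_fibre; rewrite deck_cov.
Qed.

(** Over [X'] the group acts freely and transitively on fibres, so the sum over the fibre is the sum
    over the group. The trace thus pulls back to an invariant section, to which the correspondence
    applies. *)
Lemma push_trace sig p : X' (phi p) ->
  pull (orb_iso iV) (trace sig) p = (\sum_(g : Gam) push (conjugate g sig)) p.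
Proof.
move=> Xp; rewrite /pull /trace (perm_big _ (perm_fibre Xp)) big_map linear_sum fam_sum.
by rewrite big_enum.
Qed.

Lemma tw_trace t y sig : (forall g, tw t (deck phi g y) (push sig)) ->
  tw t y (pull (orb_iso iV) (trace sig)).
Proof.
move=> H; have h : tw t y (\sum_(g : Gam) push (conjugate g sig)).
  by apply: tw_sum => g _; exact: tw_conjugate.
by apply: tw_near h; apply: nearW => p; exact: push_trace.
Qed.

End Correspondence.

(** * Traces of sections cut off to one point of a fibre *)

Section Averaging.
Variables (R : realType) (X Y : riemannSurface R) (n : nat) (pt : 'I_n -> X).
Variables (N : 'I_n -> nat) (Gam : finGroupType) (phi : galoisCover Y pt N Gam).
Variables (V : parBundle pt) (VV : orbBundle phi) (iV : corresponds V VV).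
Hypotheses (Y_compact : compact [set: Y]) (pt_inj : injective pt).
Hypothesis N_gt0 : forall i, (0 < N i)%N.
Local Notation C := R[i].
Local Notation Co := (R[i]^o).
Local Notation X' := (punctured pt).
Local Notation SV := (fam (fun y : Y => V (phi y))).
Local Notation tw := (@twisted R X Y n pt N Gam phi VV (@hsec_at R Y VV)).
Local Notation ctw := (@twisted R X Y n pt N Gam phi (fun _ : Y => Co : lmodType C) (@hol_at R
  Y)).
Implicit Types (p q : Y) (sig : SV).

Lemma coord_hol_dom (y q : Y) (w : chart R Y) : coord_at y w -> dom w q -> hol_at q w.
Proof.
move=> [_ _ hw] dq; have [c ac cq] := atlas_cover q; exists c => //.
by have [h _] := hw c ac; exact: h.
Qed.

Section Disc.
Variables (x : X) (U : set X) (D : Y -> set Y) (y : Y) (e : nat).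
Variables (w : chart R Y) (z : chart R X).
Hypotheses (U_punctured : forall x', U x' -> x' <> x -> X' x').
Hypothesis D_fibre : forall y, phi y = x -> open (D y) /\ D y y.
Hypothesis D_disj : forall y y' p, phi y = x -> phi y' = x -> D y p -> D y' p -> y = y'.
Hypothesis D_cover : forall p, U (phi p) -> exists2 y, phi y = x & D y p.
Hypotheses (yx : phi y = x) (wy : coord_at y w) (Dw : D y `<=` dom w).
Hypothesis zw : forall p, dom w p -> z (phi p) = w p ^+ e.
Hypotheses (e_gt0 : (0 < e)%N) (e1 : X' x -> e = 1%N).

(** For m > 0 the centre of the disc gets the default value 0 of division; this is harmless, since
    such m are used only over S. *)
Definition disc_pow (m : nat) (p : Y) : C := if `[< D y p >] then w p ^- m else 0.

Let D_near q : U (phi q) -> (\forall p \near q, D y p) \/ (\forall p \near q, ~ D y p).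
Proof. by apply: disc_near D_disj D_cover yx => y0 /D_fibre[]. Qed.

Let D_over q : D y q -> phi q = x -> q = y.
Proof. by move=> Dq qx; have [_ Dqq] := D_fibre qx; exact: D_disj Dqq Dq. Qed.

(* [w] takes over [phi p] the values [zeta * w p] with [zeta ^ e = 1], so that the sum over
   [m] isolates one point of the fibre. *)
Lemma trace_disc sig p : X' (phi p) -> D y p ->
  \sum_(m < e) (w p ^+ m : C) *: trace (fscale (disc_pow m) sig) (phi p) = e%:R *: sig p.
Proof.
move=> Xp Dp.
have -> : \sum_(m < e) (w p ^+ m : C) *: trace (fscale (disc_pow m) sig) (phi p) =
    \sum_(q <- fibre phi (phi p)) (\sum_(m < e) (w p ^+ m * disc_pow m q)) *: atx sig (phi p) q.
  under eq_bigr do rewrite scaler_sumr.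
  rewrite exchange_big; apply: eq_big_seq => q /mem_fibre qp /=.
  by rewrite scaler_suml; apply: eq_bigr => m _; rewrite atxZ// scalerA.
rewrite (bigD1_seq p) ?fibre_uniq ?(proj2 (mem_fibre _ _ _))//=.
rewrite [X in _ + X]big1_seq ?addr0 => [|q /andP[qp /mem_fibre qf]].
  rewrite atxE; congr (_ *: _); rewrite /disc_pow asboolT//.
  (* If [w p] is 0 then [p] is the centre of the disc and lies over [X'], so e = 1 and only m = 0
     occurs. *)
  have [w0|w0] := eqVneq (w p) 0; last first.
    under eq_bigr do rewrite divff ?expf_neq0//.
    by rewrite sumr_const card_ord.
  have py := coord_eq0 wy (Dw Dp) w0.
  have -> : e = 1%N by apply: e1; rewrite -yx -py.
  by rewrite big_ord1 expr0 invr1 mulr1.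
suff -> : \sum_(m < e) (w p ^+ m * disc_pow m q) = 0 by rewrite scale0r.
rewrite /disc_pow; case: asboolP => Dq; last by rewrite big1// => m _; rewrite mulr0.
have we : w p ^+ e = w q ^+ e by rewrite -!zw ?qf//; exact: Dw.
have wne : w p <> w q by move=> /(chart_inj (Dw Dp) (Dw Dq))/eqP; rewrite eq_sym (negbTE qp).
have wq0 : w q != 0.
  apply/eqP => wq0; apply: wne; rewrite wq0; move/eqP: we.
  by rewrite wq0 expr0n eqn0Ngt e_gt0 expf_eq0 e_gt0 => /eqP.
have -> : \sum_(m < e) w p ^+ m * w q ^- m = \sum_(m < e) (w p / w q) ^+ m.
  by apply: eq_bigr => m _; rewrite expr_div_n.
have := subrX1 (w p / w q) e; rewrite expr_div_n we divff ?expf_neq0// subrr.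
move/esym/eqP; rewrite mulf_eq0 => /orP[|/eqP//].
by rewrite subr_eq0 => /eqP h; case: wne; rewrite -[w p](divfK wq0) h mul1r.
Qed.

(** The pole of order m at the centre is just what the divisor of [t] permits; elsewhere in the disc
    [w] is invertible. Dually, in [ctw_disc] the factor w^m has the zero of order m that the divisor
    demands. *)
Lemma tw_disc sig t m : (forall q, D y q -> hols iV q sig) ->
  (forall q, phi q = x -> orb_div phi t q = m%:Z) ->
  forall q, U (phi q) -> tw t q (push iV (fscale (disc_pow m) sig)).
Proof.
move=> hs tm q Uq; have [Dq|Dq] := D_near Uq; last first.
  apply: tw_near (tw0 VV t q); move: Dq; apply: filterS => p Dp _.
  by rewrite /push fscaleE /disc_pow asboolF// scale0r linear0.
have Dyq := nbhs_singleton Dq; have [tau htau st] := hs q Dyq.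
have [qy|qy] := eqVneq q y.
  exists w; first by rewrite qy; exact: coord_unif.
  exists tau => //; move: Dq st; apply: filterS2 => p Dp st Xp.
  by rewrite /push fscaleE linearZ /= st// tm ?qy// /disc_pow asboolT// exprnN.
have qx : phi q <> x by move=> /(D_over Dyq)/eqP; rewrite (negbTE qy).
have Xq := U_punctured Uq qx.
have wq0 : w q != 0 by apply/eqP => /(coord_eq0 wy (Dw Dyq))/eqP; rewrite (negbTE qy).
have [u hu _] := coord_germ q; exists u => //.
exists (fscale (fun p => (w p ^+ m)^-1 : C) tau).
  apply: hsecM => //; apply: holV; first by rewrite expf_neq0.
  by apply: holX; exact: coord_hol_dom wy (Dw Dyq).
rewrite orb_div_punctured//; move: Dq st; apply: filterS2 => p Dp st Xp.
rewrite oppr0 expr0z scale1r /push !fscaleE linearZ /= st//.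
by rewrite /disc_pow asboolT.
Qed.

Lemma ctw_disc t m (k : C) : (forall q, phi q = x -> orb_div phi t q = - m%:Z) ->
  forall q, U (phi q) -> ctw t q (fun p => if `[< D y p >] then k * w p ^+ m else 0).
Proof.
move=> tm q Uq; have [u hu _] := coord_germ q; have [Dq|Dq] := D_near Uq; last first.
  exists u => //; exists (fun=> 0); first exact: hol_cst.
  move: Dq; apply: filterS => p Dp _.
  by rewrite asboolF// scaler0.
have Dyq := nbhs_singleton Dq.
have [qy|qy] := eqVneq q y.
  exists w; first by rewrite qy; exact: coord_unif.
  exists (fun=> k); first exact: hol_cst.
  move: Dq; apply: filterS => p Dp _.
  by rewrite asboolT// tm ?qy// opprK mulrC.
have qx : phi q <> x by move=> /(D_over Dyq)/eqP; rewrite (negbTE qy).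
have Xq := U_punctured Uq qx.
exists u => //; exists (fun p => k * w p ^+ m : C).
  apply: holM; first exact: hol_cst.
  by apply: holX; exact: coord_hol_dom wy (Dw Dyq).
rewrite orb_div_punctured//; move: Dq; apply: filterS => p Dp _.
by rewrite oppr0 expr0z scale1r asboolT.
Qed.

(** The group sum keeps the bound m on the poles over [x], and the correspondence identifies
    invariant sections with such poles with sections of V_t. *)
Lemma par_trace sig t m : open U -> (forall q, D y q -> hols iV q sig) ->
  (forall q, phi q = x -> orb_div phi t q = m%:Z) ->
  par_sec t U (trace (fscale (disc_pow m) sig)).
Proof.
move=> oU hs tm; apply/(par_sec_tw iV) => // q Uq; apply: tw_trace => // g.
by apply: tw_disc => //; rewrite deck_cov.
Qed.
End Disc.

Lemma par_sec_punctured (W : parBundle pt) (U : set X) (s : fam W) : open U -> U `<=` X' ->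
  par_sec 0 U s <-> hsec U s.
Proof.
move=> oU UX; split=> [h x Ux|h x Ux].
  have [z [tau [zx htau st _]]] := h x Ux.
  apply: hsec_near (htau x _); last by case: zx.
  move: (coord_near zx) (punctured_near (UX _ Ux)); apply: filterS2 => p dp Xp.
  by rewrite st// big1 ?expr0z ?scale1r// => i _; rewrite floor0.
have [u hu /(_ U)[|z [zx zU _]]] := coord_germ x.
  by apply: open_nbhs_nbhs.
exists z, s; split=> //.
- by move=> p /zU; exact: h.
- by move=> p _ _; rewrite big1 ?expr0z ?scale1r// => i _; rewrite floor0.
- by move=> i ix; case: (UX _ Ux i).
Qed.

(** The maps [orb_iso] are only linear on each fibre; that they preserve holomorphy follows from
    [orb_iso_fil] at t = 0 over an open set inside [X']. *)
Lemma hsec_pull y (s : fam V) : X' (phi y) -> hsec_at (phi y) s ->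
  hsec_at y (pull (orb_iso iV) s).
Proof.
move=> Xy /hsec_nbhs[U0 [oU0 U0y] hs]; pose U := U0 `&` X'.
have oU : open U by apply: openI => //; exact: open_punctured.
have : par_sec 0 U s by apply/par_sec_punctured => // [p []//|p [U0p _]]; exact: hs.
move=> /(par_sec_tw iV _ _ oU)/(_ y (conj U0y Xy))/(hols_tw0 iV _ (fun p => s (phi p)))[tau
  htau st].
apply: hsec_near htau; move: st (phi_near (punctured_near Xy)).
by apply: filterS2 => p h Xp; rewrite -h.
Qed.

Lemma push_surj (s : fam VV) : exists sig, forall p, X' (phi p) -> push iV sig p = s p.
Proof.
have ex p : exists v : V (phi p), X' (phi p) -> orb_iso iV p v = s p.
  have [Xp|nXp] := pselect (X' (phi p)); last by exists 0.
  by have [f _ fK] := orb_iso_bij iV Xp; exists (f (s p)).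
by exists (fun p => projT1 (cid (ex p))) => p; rewrite /push; case: cid.
Qed.

Lemma orb_iso_inj y : X' (phi y) -> injective (orb_iso iV y).
Proof. by move=> /(orb_iso_bij iV)/bij_inj. Qed.

Lemma near_away (x : X) : exists2 A : set X, open A /\ A x & forall x', A x' -> x' <> x -> X' x'.
Proof.
have := @near_punctured R X n pt x.
rewrite -[X in X -> _]/(nbhs x (fun x' => x' <> x -> X' x')) nbhsE => -[A [oA Ax] AX].
by exists A.
Qed.

(** The case e = 1, m = 0 of the trace construction: cut [s] off to the disc around [y] and sum over
    the fibres. *)
Lemma hsec_descent y (s : fam VV) : X' (phi y) -> hsec_at y s ->
  exists2 s' : fam V, hsec_at (phi y) s' & \forall p \near y, pull (orb_iso iV) s' p = s p.
Proof.
move=> Xy hs; set x := phi y.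
have [A [oA Ax] AX] := near_away x.
have [w [z [wy zy wz zw]]] := cov_unram Xy.
have [sig sigE] := push_surj s.
have [|U1 [D [[oU1 U1x] HD Ddisj Dcov]]] := @fibre_nbhs _ _ _ _ _ _ _ phi Y_compact x
  (fun y' p => y' = y -> dom w p /\ hsec_at p s).
  move=> y' y'x; have [->|yy] := pselect (y' = y); last exact: nearW.
  by move: (coord_near wy) (hsec_at_open hs); apply: filterS2.
pose U := U1 `&` A `&` X'.
have oU : open U by apply: openI (open_punctured pt); exact: openI.
have Ux : U x by [].
have UX x' : U x' -> x' <> x -> X' x' by case.
have HD' y' : phi y' = x -> open (D y') /\ D y' y' by move=> /HD[].
have Dcov' p : U (phi p) -> exists2 y', phi y' = x & D y' p by case=> -[/Dcov].
have [_ Dyy DO] := HD y erefl.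
have Dw : D y `<=` dom w by move=> p /DO/(_ erefl)[].
have hsig q : D y q -> hols iV q sig.
  move=> /DO/(_ erefl)[_ hq]; exists s => //; apply: nearW => p; exact: sigE.
exists (trace (fscale (disc_pow D y w 0) sig)).
  have : par_sec 0 U (trace (fscale (disc_pow D y w 0) sig)).
    apply: (@par_trace x U D y w UX HD' Ddisj Dcov' erefl wy Dw sig 0 0 oU hsig).
    by move=> q _; rewrite orb_div0.
  by move=> /(par_sec_punctured _ oU) => /(_ (fun _ => @proj2 _ _)); apply.
have nD : \forall p \near y, D y p by apply: open_nbhs_nbhs; split=> //; case: (HD' y erefl).
move: nD (phi_near (punctured_near Xy)); apply: filterS2 => p Dp Xp.
have := @trace_disc x D y 1 w z erefl wy Dw zw (ltn0Sn 0) (fun _ => erefl) sig p Xp Dp.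
rewrite big_ord1 expr0 !scale1r => E.
by rewrite /pull E -sigE.
Qed.
End Averaging.

(** * The direct image of an orbifold bundle is (V (x) E)_0 *)

Section TensorSections.
Variables (R : realType) (X Y : riemannSurface R) (n : nat) (pt : 'I_n -> X).
Variables (N : 'I_n -> nat) (Gam : finGroupType) (phi : galoisCover Y pt N Gam).
Variables (V : parBundle pt) (VV : orbBundle phi) (iV : corresponds V VV).
Hypotheses (Y_compact : compact [set: Y]) (pt_inj : injective pt).
Hypothesis N_gt0 : forall i, (0 < N i)%N.
Local Notation C := R[i].
Local Notation Co := (R[i]^o).
Local Notation X' := (punctured pt).
Local Notation SV := (fam (fun y : Y => V (phi y))).
Implicit Types (p q : Y) (sig : SV).

(** Over x_i take t m = - m / N_i, so that the divisors of [t m] and [- t m] have multiplicities m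
    and - m without rounding. Over [X'] take e = 1 and t = 0. *)
Lemma ramification_data (x : X) : exists (e : nat) (t : nat -> R),
  [/\ (0 < e)%N, X' x -> e = 1%N, forall y, phi y = x -> ramified_at phi y e,
      forall m q, (m < e)%N -> phi q = x -> orb_div phi (t m) q = m%:Z
    & forall m q, (m < e)%N -> phi q = x -> orb_div phi (- t m) q = - m%:Z].
Proof.
have [Xx|] := pselect (X' x).
  exists 1%N, (fun=> 0); split=> // [y yx|m q|m q].
  - by apply: cov_unram; rewrite yx.
  - by rewrite ltnS leqn0 => /eqP -> _; rewrite orb_div0.
  - by rewrite ltnS leqn0 => /eqP -> _; rewrite oppr0 orb_div0 oppr0.
move=> /existsNP[i /contrapT ix].
have N0 : (N i)%:R != 0 :> R by rewrite pnatr_eq0 -lt0n.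
have fl (k : int) : Num.floor (k%:~R : R) = k.
  by apply: floor_def; rewrite lexx ltr_int ltrDl.
exists (N i), (fun m => - (m%:R / (N i)%:R)); split=> // [/(_ i)//|y yx|m q _ qx|m q _ qx].
- by apply: cov_ram; rewrite yx.
- by rewrite (orb_div_over pt_inj _ (etrans ix (esym qx))) opprK divfK// -[m%:R]/(m%:Z%:~R) fl.
- rewrite (orb_div_over pt_inj _ (etrans ix (esym qx))) opprK mulNr divfK//.
  by rewrite -[m%:R]/(m%:Z%:~R) -rmorphN fl.
Qed.

(** With w_y a coordinate at y and 1_y the indicator of its disc, [sig] is 1/e times the sum over
    all y over x and all m < e of (1_y w_y^m) trace(1_y w_y^(-m) sig). The trace lies in V_t and the
    function in E_(-t) for t = - m/e; over [X'] only m = 0 occurs. *)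
Lemma hols_tensE (U : set X) sig : open U ->
  (forall y, U (phi y) -> hols iV y sig) -> @tensE_sec R X Y n pt N Gam phi V 0 U sig.
Proof.
move=> oU hs x Ux; have [e [t [e0 e1 ram tE tNE]]] := ramification_data x.
have [A [oA Ax] AX] := near_away pt x.
have [wz Hwz] : exists wz : Y -> chart R Y * chart R X, forall y, phi y = x ->
    coord_at y (wz y).1 /\ forall p, dom (wz y).1 p -> (wz y).2 (phi p) = (wz y).1 p ^+ e.
  have ex y : exists wz : chart R Y * chart R X, phi y = x ->
      coord_at y wz.1 /\ forall p, dom wz.1 p -> wz.2 (phi p) = wz.1 p ^+ e.
    have [yx|nyx] := pselect (phi y = x).
      by have [w [z [wy _ _ zw]]] := ram y yx; exists (w, z).
    have [d _ [w [z _]]] := ramified phi N_gt0 y.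
    by exists (w, z) => /nyx.
  by have [f Hf] := choice ex; exists f.
have [|U1 [D [[oU1 U1x] HD Ddisj Dcov]]] := @fibre_nbhs _ _ _ _ _ _ _ phi Y_compact x
  (fun y p => dom (wz y).1 p /\ U (phi p)).
  move=> y yx; have [wy _] := Hwz y yx.
  have hU : \forall p \near y, U (phi p) by apply: phi_near; apply: open_nbhs_nbhs; rewrite yx.
  by move: (coord_near wy) hU; apply: filterS2.
pose U' := U1 `&` A; have oU' : open U' by exact: openI.
have Ux' : U' x by [].
have UX x' : U' x' -> x' <> x -> X' x' by case=> _; exact: AX.
have HD' y : phi y = x -> open (D y) /\ D y y by move=> /HD[].
have Dcov' p : U' (phi p) -> exists2 y, phi y = x & D y p by case=> /Dcov.
have Dw y : phi y = x -> D y `<=` dom (wz y).1 by move=> /HD[_ _ h] p /h[].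
have hD y : phi y = x -> forall q, D y q -> hols iV q sig.
  by move=> /HD[_ _ h] q /h[_ Uq]; exact: hs.
pose r := fibre phi x; pose I := ('I_(size r) * 'I_e)%type.
pose yy (i : I) := tnth (in_tuple r) i.1.
have yyx i : phi (yy i) = x by apply/mem_fibre; exact: mem_tnth.
pose s (i : I) := trace (fscale (disc_pow D (yy i) (wz (yy i)).1 i.2) sig).
pose f (i : I) : fam (fun _ : Y => Co : lmodType C) :=
  fun p => if `[< D (yy i) p >] then e%:R^-1 * (wz (yy i)).1 p ^+ i.2 else 0.
pose ev (j : 'I_#|{: I}|) : I := enum_val j.
exists U' => //; exists #|{: I}|, (fun j => t (ev j).2), (fun j => - t (ev j).2),
  (fun j => s (ev j)), (fun j => f (ev j)); split=> [j|p Up Xp].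
  set i := ev j; have [wy zw] := Hwz _ (yyx i); split.
  - by rewrite subrr.
  - exact: (par_trace N_gt0 UX HD' Ddisj Dcov' (yyx i) wy (Dw _ (yyx i)) oU'
      (hD _ (yyx i)) (fun q => tE i.2 q (ltn_ord i.2))).
  - apply/ctwP => //; apply: (ctw_disc UX HD' Ddisj Dcov' (yyx i) wy (Dw _ (yyx i))).
    by move=> q; exact: tNE.
pose H y (m : nat) : V (phi p) :=
  (if `[< D y p >] then e%:R^-1 * (wz y).1 p ^+ m else 0 : C) *:
  trace (fscale (disc_pow D y (wz y).1 m) sig) (phi p).
have -> : \sum_(j < #|{: I}|) (f (ev j) p : C) *: s (ev j) (phi p) =
    \sum_(y <- r) \sum_(m < e) H y m.
  rewrite -(big_enum_val (fun i : I => (f i p : C) *: s i (phi p))) /=.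
  rewrite [RHS]big_tnth pair_bigA /=; apply: eq_bigr => -[i m] _ //.
have [y yx Dyp] := Dcov' p Up.
rewrite (bigD1_seq y) ?fibre_uniq ?(proj2 (mem_fibre _ _ _))//=.
rewrite [X in _ + X]big1_seq ?addr0 => [|q /andP[qy /mem_fibre qx]]; last first.
  rewrite big1// => m _; rewrite /H asboolF ?scale0r// => Dqp.
  by move: qy; rewrite (Ddisj _ _ _ qx yx Dqp Dyp) eqxx.
have [wy zw] := Hwz y yx.
have E := trace_disc yx wy (Dw _ yx) zw e0 e1 sig Xp Dyp.
have -> : \sum_(m < e) H y m = e%:R^-1 *: \sum_(m < e) ((wz y).1 p ^+ m : C) *:
    trace (fscale (disc_pow D y (wz y).1 m) sig) (phi p).
  by rewrite scaler_sumr; apply: eq_bigr => m _; rewrite /H asboolT// scalerA.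
by rewrite E scalerA mulVf ?scale1r// pnatr_eq0 -lt0n.
Qed.
End TensorSections.

(** * Differential operators *)

Section Operators.
Variables (R : realType) (Y : riemannSurface R) (E F : vbundle Y).
Local Notation C := R[i].
Local Notation Co := (R[i]^o).
Local Notation OE := (bundle_omodule E).
Local Notation opT := (fam (fun y : Y => (fam E -> F y) : lmodType C)).
Implicit Types (y q : Y) (s t : fam E) (f : Y -> Co) (D : opT).

Definition opsec D s : fam F := fun y => D y s.

(* [B] may leave out isolated points, such as the ramification points: there the
   vanishing on [m_y^m] is automatic, see [dop_extend]. *)
Definition dop (A B : set Y) (m : nat) D :=
  [/\ forall y (a : C) s t, A y -> hsec_at y s -> hsec_at y t ->
        D y (a *: s + t) = a *: D y s + D y t,
      forall y s, A y -> B y -> mpow OE m y s -> D y s = 0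
    & forall y s, A y -> hsec_at y s -> hsec_at y (opsec D s)].

Lemma dop_sub (A A' B : set Y) m D : A' `<=` A -> dop A B m D -> dop A' B m D.
Proof.
by move=> AA [h1 h2 h3]; split=> [y a s t /AA|y s /AA|y s /AA]; [exact: h1|exact: h2|exact: h3].
Qed.

Definition commutator D f : opT := fun y s => D y (fscale (f : Y -> C) s) - (f y : C) *: D y s.

Lemma mpow_bundle_mul m y f s : hol_at y f -> f y = 0 -> mpow OE m y s ->
  mpow OE m.+1 y (fscale (f : Y -> C) s).
Proof.
move=> hf f0 hs; apply/mpow_bundleS; exists 1%N, (fun=> f), (fun=> s); split=> //.
by apply: nearW => q; rewrite big_ord1.
Qed.

Section DopTheory.
Variables (A B : set Y) (m : nat) (D : opT).
Hypothesis HD : dop A B m D.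

Lemma dop0 y : A y -> D y 0 = 0.
Proof.
case: HD => lin _ _ Ay; have := lin y 1 0 0 Ay (hsec0 E y) (hsec0 E y).
by rewrite !scale1r add0r => h; apply: (addrI (D y 0)); rewrite addr0 -h.
Qed.

Lemma dopZ y (a : C) s : A y -> hsec_at y s -> D y (a *: s) = a *: D y s.
Proof.
case: (HD) => lin _ _ Ay hs; have := lin y a s 0 Ay hs (hsec0 E y).
by rewrite addr0 (dop0 Ay) addr0.
Qed.

Lemma dopD y s t : A y -> hsec_at y s -> hsec_at y t -> D y (s + t) = D y s + D y t.
Proof. by case: HD => lin _ _ Ay hs ht; have := lin y 1 s t Ay hs ht; rewrite !scale1r. Qed.

Lemma dopB y s t : A y -> hsec_at y s -> hsec_at y t -> D y (s - t) = D y s - D y t.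
Proof.
move=> Ay hs ht; have [lin _ _] := HD.
have -> : s - t = (-1) *: t + s by rewrite scaleN1r addrC.
by rewrite lin// scaleN1r addrC.
Qed.

Lemma dop_sum y I (r : seq I) (P : I -> fam E) : A y -> (forall i, hsec_at y (P i)) ->
  D y (\sum_(i <- r) P i) = \sum_(i <- r) D y (P i).
Proof.
move=> Ay hP; elim: r => [|i r IH]; first by rewrite !big_nil dop0.
by rewrite !big_cons dopD ?IH//; exact: hsec_sum.
Qed.

Lemma dop_local y s t : A y -> B y -> hsec_at y t -> (\forall q \near y, s q = t q) ->
  D y s = D y t.
Proof.
move=> Ay By ht st; have hs := hsec_near st ht.
apply/eqP; rewrite -subr_eq0 -dopB//; apply/eqP; case: (HD) => _ kill _; apply: kill => //.
have h : hsec_at y (s - t) by exact: hsecB.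
have h0 : \forall q \near y, (s - t) q = 0.
  by move: st; apply: filterS => q; rewrite famD famN => ->; rewrite subrr.
case: (m) => [|m']; first exact/germ_bundle.
exact: mpow_bundle_near0.
Qed.
End DopTheory.

(** At y the commutator takes [s] to D ((f - f y) s), and f - f y raises the power of the maximal
    ideal by one. *)
Lemma dop_commutator (A B : set Y) m D f : (forall y, A y -> hol_at y f) ->
  dop A B m.+1 D -> dop A B m (commutator D f).
Proof.
move=> hf HD; have [lin kill hol] := HD; split.
- move=> y a s t Ay hs ht; rewrite /commutator.
  have -> : fscale (f : Y -> C) (a *: s + t) = a *: fscale (f : Y -> C) s + fscale (f : Y -> C) t.
    by apply: fam_ext => q; rewrite !(famD, famZ, fscaleE) scalerDr !scalerA mulrC.
  rewrite !lin//; try (by apply: hsecM => //; exact: hf).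
  by rewrite scalerDr scalerBr !scalerA [f y * a]mulrC opprD addrACA.
- move=> y s Ay By hs; have hs' := mpow_bundle_hsec hs; rewrite /commutator.
  rewrite -(dopZ HD)// -(dopB HD)//; last 2 first.
    by apply: hsecM => //; exact: hf.
    exact: hsecZ.
  have -> : fscale (f : Y -> C) s - (f y : C) *: s = fscale (fun q => f q + - f y : C) s.
    by apply: fam_ext => q; rewrite !(famD, famN, famZ, fscaleE) scalerBl.
  apply: kill => //; apply: mpow_bundle_mul => //; last by rewrite subrr.
  by apply: holD; [exact: hf|exact: hol_cst].
- move=> y s Ay hs.
  have -> : opsec (commutator D f) s = opsec D (fscale (f : Y -> C) s) - fscale (f : Y ->
    C) (opsec D s).
    exact: fam_ext.
  apply: hsecB; first by apply: hol => //; apply: hsecM => //; exact: hf.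
  by apply: hsecM; [exact: hf|exact: hol].
Qed.

(* By induction on [m]: [D (f t) = f D t + [D, f] t], where [[D, f]] has smaller order
   off [y]. *)
Lemma dop_extend (A B : set Y) m D y s : (\forall q \near y, A q) ->
  (\forall q \near y, q <> y -> B q) -> dop A B m D -> mpow OE m y s -> D y s = 0.
Proof.
move=> nA nB; elim: m A nA D s => [|m IH] A nA D s HD.
  move=> /germ_bundle hs; have [_ kill hol] := HD; have Ay := nbhs_singleton nA.
  apply: (@hsec_eq0 _ _ _ y (opsec D s)); first exact: hol.
  move: nA nB (hsec_at_open hs); apply: filterS3 => q Aq Bq hq qy.
  by apply: kill; [|exact: Bq|exact/germ_bundle].
move=> /mpow_bundleS[l [f [t [H st]]]].
pose A' : set Y := [set q | A q /\ forall i, hol_at q (f i)].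
have nA' : \forall q \near y, A' q.
  have h : \forall q \near y, forall i, hol_at q (f i).
    by apply: filter_forall => i; apply: hol_at_open; have [] := H i.
  by move: nA h; apply: filterS2.
have HD' : dop A' B m.+1 D by apply: dop_sub HD => q [].
have A'y := nbhs_singleton nA'.
have ht i : hsec_at y (t i) by have [_ _ /mpow_bundle_hsec] := H i.
have hft i : hsec_at y (fscale (f i : Y -> C) (t i)).
  by apply: hsecM => //; have [] := H i.
pose s' : fam E := \sum_(i < l) fscale (f i : Y -> C) (t i).
have hs' : hsec_at y s' by exact: hsec_sum.
have ss' : \forall q \near y, s q = s' q.
  by move: st; apply: filterS => q ->; rewrite /s' fam_sum.
have hs : hsec_at y s by exact: hsec_near ss' hs'.
have [_ _ hol] := HD'.
(* Locality of [D] is available only at points of [B]; at [y] the equality follows by continuity. *)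
have -> : D y s = D y s'.
  apply: (@hsec_eq _ _ _ y (opsec D s) (opsec D s')); [exact: hol|exact: hol|].
  have h : \forall q \near y, A' q /\ hsec_at q s'.
    by move: nA' (hsec_at_open hs'); apply: filterS2.
  move: h nB (nbhs_interior ss'); apply: filterS3 => q [A'q hq] Bq sq qy.
  by rewrite /opsec; apply: (dop_local HD' A'q (Bq qy) hq sq).
rewrite (dop_sum HD')// big1// => i _.
have [hf f0 mt] := H i.
have -> : D y (fscale (f i : Y ->
  C) (t i)) = commutator D (f i) y (t i) + (f i y : C) *: D y (t i).
  by rewrite /commutator subrK.
rewrite f0 scale0r addr0; apply: (IH A' nA') mt.
by apply: dop_commutator HD' => q [_ /(_ i)].
Qed.

(** Mind the shift: order k means that m_y^(k+1) is killed. *)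
Lemma DO_dop (A : set Y) k D : open A -> DO A k E F D -> dop A setT k.+1 D.
Proof.
move=> oA [_ lin kill hol]; split; first exact: lin.
  by move=> y s Ay _ hs; exact: kill Ay (mpow_bundle_hsec hs) hs.
move=> y s Ay /hsec_nbhs[U [oU Uy] hs].
have h : hsec (U `&` A) (opsec D s).
  apply: hol; [exact: openI|by move=> q []|by move=> q [Uq _]; exact: hs].
exact: h.
Qed.
End Operators.

Section OModulePowers.
Variables (R : realType) (X : riemannSurface R).

Lemma mpowSD (F : omodule X) m (x : X) (u s t : fam (@om_fib R X F)) : om_near x u (s + t) ->
  mpow F m.+1 x s -> mpow F m.+1 x t -> mpow F m.+1 x u.
Proof.
move=> un [l1 [f1 [t1 [H1 s1]]]] [l2 [f2 [t2 [H2 s2]]]].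
exists (l1 + l2)%N, (fun i => match fintype.split i with inl j => f1 j | inr j => f2 j end),
  (fun i => match fintype.split i with inl j => t1 j | inr j => t2 j end); split.
  by move=> i; case: (fintype.split i).
move: un s1 s2; apply: filterS3 => x' h h1 h2 p dp px.
rewrite h// famD h1// h2// big_split_ord /=; congr (_ + _); apply: eq_bigr => i _.
  by have := @fintype.unsplitK l1 l2 (inl i); rewrite /fintype.unsplit => ->.
by have := @fintype.unsplitK l1 l2 (inr i); rewrite /fintype.unsplit => ->.
Qed.

Lemma mpow_near (F : omodule X) m (x : X) (u s : fam (@om_fib R X F)) : om_near x u s ->
  mpow F m.+1 x s -> mpow F m.+1 x u.
Proof.
move=> un [l [f [t [H st]]]]; exists l, f, t; split=> //.
by move: un st; apply: filterS2 => x' h1 h2 p dp px; rewrite h1// h2.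
Qed.

Lemma mpowS_sum (F : omodule X) m (x : X) I (r : seq I) (s : I -> fam (@om_fib R X F)) :
  (forall i, mpow F m.+1 x (s i)) -> mpow F m.+1 x (\sum_(i <- r) s i).
Proof.
move=> H; elim: r => [|i r IH].
  by rewrite big_nil; apply: mpow_near0; apply: nearW => x' p.
rewrite big_cons; apply: mpowSD (H i) IH; exact: nearW.
Qed.

End OModulePowers.

(** * Extension of sections across the ramification points *)

Section Extension.
Variables (R : realType) (X Y : riemannSurface R) (n : nat) (pt : 'I_n -> X).
Variables (N : 'I_n -> nat) (Gam : finGroupType) (phi : galoisCover Y pt N Gam).
Variable E : vbundle Y.
Hypothesis N_gt0 : forall i, (0 < N i)%N.
Local Notation C := R[i].
Local Notation X' := (punctured pt).
Implicit Types (y q : Y) (s : fam E).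

Definition extends_at y s tau := hsec_at y tau /\
  \forall p \near y, X' (phi p) -> s p = tau p.

(** Families representing sections of (V (x) E)_0 have arbitrary values over S, whereas operators on
    [VV] act on holomorphic families. By [extends_uniq] the value at y depends on no choice. *)
Definition extension s : fam E := fun y =>
  if pselect (exists tau, extends_at y s tau) is left h then projT1 (cid h) y else 0.

Lemma extends_uniq y s tau tau' : extends_at y s tau -> extends_at y s tau' -> tau y = tau' y.
Proof.
move=> [h st] [h' st']; apply: hsec_eq => //.
move: st st' (near_phi_punctured phi N_gt0 y); apply: filterS3 => p st st' Xp /Xp{}Xp.
by rewrite -st// st'.
Qed.

Lemma extensionE y s tau : extends_at y s tau -> extension s y = tau y.
Proof.
move=> h; rewrite /extension; case: pselect => [e|[]]; last by exists tau.
by case: cid => tau' h' /=; exact: extends_uniq h' h.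
Qed.

Lemma extends_open y s tau : extends_at y s tau -> \forall p \near y, extends_at p s tau.
Proof.
move=> [h st]; move: (hsec_at_open h) (nbhs_interior st); apply: filterS2 => p h1 h2.
by split.
Qed.

Lemma extension_near y s tau : extends_at y s tau -> \forall p \near y, extension s p = tau p.
Proof. by move=> /extends_open; apply: filterS => p; exact: extensionE. Qed.

Lemma hsec_extension y s tau : extends_at y s tau -> hsec_at y (extension s).
Proof. by move=> h; apply: hsec_near (extension_near h) _; case: h. Qed.

Lemma extension_punctured y s tau : extends_at y s tau -> X' (phi y) -> extension s y = s y.
Proof. by move=> h Xy; rewrite (extensionE h); case: h => _ /nbhs_singleton ->. Qed.

Lemma extends_extension y s tau : extends_at y s tau -> extends_at y s (extension s).
Proof.
move=> h; split; first exact: hsec_extension h.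
by move: (extends_open h); apply: filterS => p hp Xp; rewrite (extension_punctured hp).
Qed.

Lemma extends_self y s : hsec_at y s -> extends_at y s s.
Proof. by split=> //; exact: nearW. Qed.

Lemma extendsD y s s' tau tau' : extends_at y s tau -> extends_at y s' tau' ->
  extends_at y (s + s') (tau + tau').
Proof.
move=> [h st] [h' st']; split; first exact: hsecD.
by move: st st'; apply: filterS2 => p st st' Xp; rewrite !famD st// st'.
Qed.

Lemma extendsM y (f : Y -> R[i]^o) s tau : hol_at y f -> extends_at y s tau ->
  extends_at y (fscale (f : Y -> C) s) (fscale (f : Y -> C) tau).
Proof.
move=> hf [h st]; split; first exact: hsecM.
by move: st; apply: filterS => p st Xp; rewrite !fscaleE st.
Qed.

Lemma extends_sum y I (r : seq I) (F G : I -> fam E) : (forall i, extends_at y (F i) (G i)) ->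
  extends_at y (\sum_(i <- r) F i) (\sum_(i <- r) G i).
Proof.
move=> H; elim: r => [|i r IH]; last by rewrite !big_cons; exact: extendsD.
by rewrite !big_nil; apply: extends_self; exact: hsec0.
Qed.

Lemma extends_near y s s' tau : (\forall p \near y, X' (phi p) -> s p = s' p) ->
  extends_at y s' tau -> extends_at y s tau.
Proof.
move=> ss [h st]; split=> //; move: ss st; apply: filterS2 => p ss st Xp.
by rewrite ss// st.
Qed.
End Extension.

(** * Stalks of (V (x) E)_0 *)

Section TensorModule.
Variables (R : realType) (X Y : riemannSurface R) (n : nat) (pt : 'I_n -> X).
Variables (N : 'I_n -> nat) (Gam : finGroupType) (phi : galoisCover Y pt N Gam).
Hypotheses (Y_compact : compact [set: Y]) (pt_inj : injective pt).
Hypothesis N_gt0 : forall i, (0 < N i)%N.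
Variables (V : parBundle pt) (VV : orbBundle phi) (iV : corresponds V VV).
Local Notation C := R[i].
Local Notation X' := (punctured pt).
Local Notation SV := (fam (fun y : Y => V (phi y))).
Local Notation TV := (tensE phi V).
Implicit Types (x : X) (y p q : Y) (sig : SV).

Lemma holsP y sig : hols iV y sig <-> exists tau, extends_at phi y (push iV sig) tau.
Proof. by split=> -[tau]; [exists tau|case=> h st; exists tau]. Qed.

Lemma hols_open y sig : hols iV y sig -> \forall p \near y, hols iV p sig.
Proof.
move=> /holsP[tau /extends_open]; apply: filterS => p h.
by apply/holsP; exists tau.
Qed.

Lemma hols_nbhs x sig : (forall y, phi y = x -> hols iV y sig) ->
  exists2 U : set X, open U /\ U x & forall y, U (phi y) -> hols iV y sig.
Proof.
move=> H; have [|U [D [oU HD _ Dcov]]] := @fibre_nbhs _ _ _ _ _ _ _ phi Y_compact x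
  (fun _ p => hols iV p sig).
  by move=> y /H/hols_open.
by exists U => // p /Dcov[y yx Dp]; have [_ _ h] := HD y yx; exact: h.
Qed.

(** The two inclusions combined. Closedness of [phi], through [hols_nbhs], spreads a condition at
    the points over [x] to a whole neighbourhood of [x]. *)
Lemma germ_tensE x sig : germ TV x sig <-> forall y, phi y = x -> hols iV y sig.
Proof.
split=> [[U [oU Ux] hs] y yx|/hols_nbhs[U oU hs]].
  by apply: (tensE_hols (sig := sig) iV hs); rewrite yx.
by exists U => //; exact: (hols_tensE Y_compact pt_inj N_gt0 oU.1 hs).
Qed.

(** A jet homomorphism is given by representatives modulo m_x. Over [X'] this turns congruences
    between them into equalities of values at points. *)
Lemma mpow1_tensE_eval p sig : mpow TV 1 (phi p) sig -> X' (phi p) -> sig p = 0.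
Proof.
move=> [l [f [t [H st]]]] Xp; have := nbhs_singleton st p Xp erefl.
by move=> ->; apply: big1 => i _; have [_ f0 _] := H i; rewrite /= f0 scale0r.
Qed.

Lemma hols_near y sig sig' : (\forall p \near y, X' (phi p) -> sig p = sig' p) ->
  hols iV y sig' -> hols iV y sig.
Proof.
move=> ss [tau h st]; exists tau => //; move: ss st; apply: filterS2 => p ss st Xp.
by rewrite ss// st.
Qed.

Lemma pushD sig sig' : push iV (sig + sig') = push iV sig + push iV sig'.
Proof. by apply: fam_ext => p; rewrite /push !famD linearD. Qed.

Lemma pushZ (f : Y -> C) sig : push iV (fscale f sig) = fscale f (push iV sig).
Proof. by apply: fam_ext => p; rewrite /push !fscaleE linearZ. Qed.

Lemma push_sum I (r : seq I) (F : I -> SV) :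
  push iV (\sum_(i <- r) F i) = \sum_(i <- r) push iV (F i).
Proof. by apply: fam_ext => p; rewrite /push !fam_sum linear_sum. Qed.

Lemma mpow_tensE_germ m x sig : mpow TV m x sig -> germ TV x sig.
Proof.
elim: m sig => [//|m IH] sig [l [f [t [H st]]]].
apply/germ_tensE => y yx.
have h i : hols iV y (t i) by have [_ _ /IH/germ_tensE] := H i; apply.
have h2 : hols iV y (\sum_(i < l) fscale (f i \o phi : Y -> C) (t i)).
  apply/holsP; rewrite push_sum.
  have [tau Htau] := choice (fun i => (holsP y (t i)).1 (h i)).
  exists (\sum_(i < l) fscale (f i \o phi : Y -> C) (tau i)).
  apply: extends_sum => i; rewrite pushZ; apply: extendsM => //.
  by apply: (cov_hol phi).2; rewrite yx; have [] := H i.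
have st' : \forall x' \near phi y, forall p,
  X' (phi p) -> phi p = x' -> sig p = \sum_(i < l) (f i (phi p) : C) *: t i p.
  by rewrite yx.
apply: hols_near h2; move: (phi_near st'); apply: filterS => p h' Xp.
by rewrite (h' p Xp erefl) fam_sum.
Qed.
End TensorModule.

(** * Operators on [VV] and the filtration by powers of m_x *)

Section Forward.
Variables (R : realType) (X Y : riemannSurface R) (n : nat) (pt : 'I_n -> X).
Variables (N : 'I_n -> nat) (Gam : finGroupType) (phi : galoisCover Y pt N Gam).
Hypotheses (Y_compact : compact [set: Y]) (pt_inj : injective pt).
Hypothesis N_gt0 : forall i, (0 < N i)%N.
Variables (V W : parBundle pt) (VV WW : orbBundle phi).
Variables (iV : corresponds V VV) (iW : corresponds W WW).
Local Notation C := R[i].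
Local Notation X' := (punctured pt).
Local Notation SV := (fam (fun y : Y => V (phi y))).
Local Notation SW := (fam (fun y : Y => W (phi y))).
Local Notation TV := (tensE phi V).
Local Notation TW := (tensE phi W).
Local Notation opY := (fam (fun y : Y => (fam VV -> WW y) : lmodType C)).
Local Notation ext s := (extension phi (push iV s)).
Implicit Types (x : X) (y p q : Y) (D : opY) (sig : SV).

Lemma hols_ext y sig : hols iV y sig -> extends_at phi y (push iV sig) (ext sig).
Proof. by move=> /holsP[tau h]; exact: extends_extension h. Qed.

Lemma push_inj (s s' : SW) p : X' (phi p) -> push iW s p = push iW s' p -> s p = s' p.
Proof. by move=> Xp; apply: (@orb_iso_inj _ _ _ _ _ _ _ _ _ _ iW p Xp). Qed.

Lemma push0 : push iW 0 = 0.
Proof. by apply: fam_ext => p; rewrite /push linear0. Qed.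

Definition lift (s : fam WW) : SW := projT1 (cid (push_surj iW s)).

Lemma liftE (s : fam WW) p : X' (phi p) -> orb_iso iW p (lift s p) = s p.
Proof. by rewrite /lift; case: cid => /= sig h; exact: h. Qed.

Lemma germ_lift x (s : fam WW) : (forall y, phi y = x -> hsec_at y s) -> germ TW x (lift s).
Proof.
move=> hs; apply/(germ_tensE Y_compact pt_inj N_gt0 iW) => y yx.
by exists s; [exact: hs|apply: nearW => p; exact: liftE].
Qed.

(* The same induction as for [dop_extend]. *)
Lemma mpow_dop m (U : set X) x D sig (sig' : SW) : open U -> U x ->
  dop (phi @^-1` U) setT m D -> mpow TV m x sig ->
  (forall p, U (phi p) -> X' (phi p) -> push iW sig' p = D p (ext sig)) -> mpow TW 1 x sig'.
Proof.
elim: m U D sig sig' => [|m IH] U D sig sig' oU Ux HD.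
  (* An operator that kills m_p^0 is zero, so [sig'] vanishes over [X'] near [x]. *)
  move=> [U0 [oU0 U0x] hs] sE; apply: mpow_near0.
  have : \forall x' \near x, U x' /\ U0 x'.
    by apply: filterI; apply: open_nbhs_nbhs.
  apply: filterS => x' [Ux' U0x'] p Xp px; have Up : U (phi p) by rewrite [phi p]px.
  have hp : hols iV p sig by apply: (tensE_hols (sig := sig) iV hs); rewrite [phi p]px.
  apply: (@push_inj sig' 0 p Xp); rewrite sE// push0.
  have [_ kill _] := HD; apply: kill => //; apply/germ_bundle.
  by have [h _] := hols_ext hp.
move=> [l [f [t [H st]]]] sE.
have gt i : germ TV x (t i) by have [_ _ /(mpow_tensE_germ Y_compact pt_inj N_gt0 iV)] := H i.
have [U2 [oU2 U2x] HU2] : exists2 U2 : set X, open U2 /\ U2 x & forall x', U2 x' ->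
    [/\ U x', forall i, hol_at x' (f i), forall i p, phi p = x' -> hols iV p (t i)
      & forall p, X' (phi p) -> phi p = x' -> sig p = \sum_(i < l) (f i (phi p) : C) *: t i p].
  have n1 : \forall x' \near x, U x' by apply: open_nbhs_nbhs.
  have n2 : \forall x' \near x, forall i, hol_at x' (f i).
    by apply: filter_forall => i; apply: hol_at_open; have [] := H i.
  have n3 : \forall x' \near x, forall i p, phi p = x' -> hols iV p (t i).
    apply: filter_forall => i; have [U3 [oU3 U3x] h3] := gt i.
    have : \forall x' \near x, U3 x' by apply: open_nbhs_nbhs.
    by apply: filterS => x' h p px; apply: (tensE_hols (sig := t i) iV h3); rewrite px.
  have : nbhs x (fun x' => [/\ U x', forall i, hol_at x' (f i), forall i p,
    phi p = x' -> hols iV p (t i)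
      & forall p, X' (phi p) -> phi p = x' -> sig p = \sum_(i < l) (f i (phi p) : C) *: t i p]).
    have n12 : \forall x' \near x, U x' /\ forall i, hol_at x' (f i).
      by move: n1 n2; apply: filterS2.
    move: n12 n3 st; apply: filterS3 => x' [h1 h2] h3 h4; split=> //.
  by rewrite nbhsE => -[B [oB Bx] hB]; exists B.
(* The [f i] come from [X], so in D (f t) = [D, f] t + f (D t) the last term lies in m_x (W (x)
   E)_0, with [s2] as the cofactor; the commutator term [s1] does so by induction. *)
pose D' i := commutator D (f i \o phi).
have HD2 : dop (phi @^-1` U2) setT m.+1 D by apply: dop_sub HD => p /HU2[].
have HD' i : dop (phi @^-1` U2) setT m (D' i).
  apply: dop_commutator HD2 => p /HU2[_ h _ _].
  by apply: (cov_hol phi).2; exact: h.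
pose s1 i := lift (fun p => D' i p (ext (t i))).
pose s2 i := lift (fun p => D p (ext (t i))).
have m1 i : mpow TW 1 x (s1 i).
  have [_ _ mt] := H i; apply: (IH U2 (D' i) (t i) (s1 i) oU2 U2x (HD' i) mt).
  by move=> p _ Xp; rewrite /push liftE.
have g2 i : germ TW x (s2 i).
  apply: germ_lift => y yx; have [_ _ hol] := HD2.
  have Uy : (phi @^-1` U2) y by rewrite /preimage /= yx.
  apply: (hol y) => //; have [_ _ h _] := HU2 _ Uy.
  by have [] := hols_ext (h i y erefl).
have m2 i : mpow TW 1 x (fscale (f i \o phi : Y -> C) (s2 i)).
  exists 1%N, (fun=> f i), (fun=> s2 i); split.
    by move=> _; have [hf f0 _] := H i; split=> //; exact: g2.
  by apply: nearW => x' p _ _; rewrite big_ord1.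
pose s3 i : SW := s1 i + fscale (f i \o phi : Y -> C) (s2 i).
have m3 i : mpow TW 1 x (s3 i) by apply: mpowSD (m1 i) (m2 i); exact: nearW.
apply: (@mpow_near _ _ TW 0 x sig' (\sum_(i < l) s3 i)); last exact: (@mpowS_sum _ _ TW 0 x).
have : \forall x' \near x, U2 x' by apply: open_nbhs_nbhs.
apply: filterS => x' Ux' p Xp; rewrite -[om_proj p]/(phi p) => px.
have Up : U2 (phi p) by rewrite px.
have [Uxp hf ht stp] := HU2 _ Up.
apply: (@push_inj sig' (\sum_(i < l) s3 i) p Xp).
rewrite sE//.
pose S : fam VV := \sum_(i < l) fscale (f i \o phi : Y -> C) (ext (t i)).
have hS i : hsec_at p (fscale (f i \o phi : Y -> C) (ext (t i))).
  apply: hsecM; first by apply: (cov_hol phi).2; exact: hf.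
  by have [] := hols_ext (ht i p erefl).
have eS : extends_at phi p (push iV sig) S.
  have e1 : extends_at phi p (push iV (\sum_(i < l) fscale (f i \o phi : Y -> C) (t i))) S.
    rewrite push_sum; apply: extends_sum => i; rewrite pushZ; apply: extendsM.
      by apply: (cov_hol phi).2; exact: hf.
    exact: hols_ext (ht i p erefl).
  apply: extends_near e1.
  have : \forall q \near p, U2 (phi q) by apply: phi_near; apply: open_nbhs_nbhs.
  apply: filterS => q /HU2[_ _ _ h] Xq.
  by rewrite /push (h q Xq erefl) fam_sum.
have -> : D p (ext sig) = D p S.
  apply: (dop_local HD2 Up I); first by case: eS.
  exact: (extension_near N_gt0 eS).
rewrite (dop_sum HD2)// push_sum fam_sum; apply: eq_bigr => i _.
by rewrite /s3 pushD pushZ famD fscaleE /push !liftE// /D' /commutator subrK.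
Qed.
End Forward.

(** * The direct image of an invariant operator *)

Section Pushforward.
Variables (R : realType) (X Y : riemannSurface R) (n : nat) (pt : 'I_n -> X).
Variables (N : 'I_n -> nat) (Gam : finGroupType) (phi : galoisCover Y pt N Gam).
Hypotheses (Y_compact : compact [set: Y]) (pt_inj : injective pt).
Hypothesis N_gt0 : forall i, (0 < N i)%N.
Variables (V W : parBundle pt) (VV WW : orbBundle phi).
Variables (iV : corresponds V VV) (iW : corresponds W WW).
Local Notation C := R[i].
Local Notation X' := (punctured pt).
Local Notation opY := (fam (fun y : Y => (fam VV -> WW y) : lmodType C)).
Local Notation opX := (fam (fun x : X => (fam V -> W x) : lmodType C)).
Local Notation ext s := (extension phi (push iV s)).
Local Notation pullV := (pull (orb_iso iV)).
Implicit Types (x : X) (y p q : Y) (D : opY) (s : fam V).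

(** The value is read off at an arbitrarily chosen point over [x]; for invariant [D] the choice is
    immaterial by [pushforwardE]. The default 0 is the normalization required by [DO]. *)
Definition pushforward D : opX := fun x s =>
  if pselect (X' x /\ hsec_at x s) is left _
  then atx (lift iW (fun q => D q (pullV s))) x (projT1 (cid (cov_surj phi x))) else 0.

Lemma pullD (a : C) s t : pullV (a *: s + t) = a *: pullV s + pullV t.
Proof. by apply: fam_ext => p; rewrite /pull !(famD, famZ) linearP. Qed.

Lemma pull_mpow m y s : X' (phi y) -> mpow (bundle_omodule V) m (phi y) s ->
  mpow (bundle_omodule VV) m y (pullV s).
Proof.
move=> Xy; elim: m s => [|m IH] s.
  by move=> /germ_bundle hs; apply/germ_bundle; exact: hsec_pull.
move=> /mpow_bundleS[l [f [t [H st]]]]; apply/mpow_bundleS.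
exists l, (fun i => f i \o phi), (fun i => pullV (t i)); split.
  move=> i; have [hf f0 ht] := H i; split=> //; last exact: IH.
  exact: (cov_hol phi).2.
move: (phi_near st); apply: filterS => p; rewrite /pull => ->.
by rewrite linear_sum; apply: eq_bigr => i _; rewrite linearZ.
Qed.

Section Invariant.
Variables (k : nat) (D : opY).
Hypothesis HD : DO_inv k VV WW D.

Let Ddop : dop setT setT k.+1 D.
Proof. by apply: DO_dop; [exact: openT|case: HD]. Qed.

(** Invariance of [D] concerns a translate of [pullV s], which is known to agree with [pullV s] only
    over [X']. Near the given point this suffices, as [D] is local. *)
Lemma invariant_pull g y s : X' (phi y) -> hsec_at (phi y) s ->
  D (deck phi g y) (pullV s) = orb_act WW g y (D y (pullV s)).
Proof.
move=> Xy hs; have [t tE] := translate g (pullV s).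
have hp := hsec_pull iV Xy hs; have [_ inv] := HD.
rewrite -(inv g y _ t hp tE); have ht := orb_act_hol hp tE.
apply: (dop_local Ddop) => //.
have : \forall q \near deck phi g y, X' (phi q).
  by apply: phi_near; apply: punctured_near; rewrite deck_cov.
apply: filterS => q Xq; rewrite -(deckVK phi g q) tE (orb_iso_equiv iV)//.
by rewrite -(deck_cov phi g) deckVK.
Qed.

Lemma pushforwardE y s : X' (phi y) -> hsec_at (phi y) s ->
  orb_iso iW y (pushforward D (phi y) s) = D y (pullV s).
Proof.
move=> Xy hs; rewrite /pushforward; case: pselect => [_|[]//].
case: cid => y' /= y'y; have [g yg] := @deck_trans _ _ _ _ _ _ _ phi y y' (esym y'y).
rewrite {}yg {y'y}; set sig := lift _ _.
apply: (@orb_act_inj _ _ _ _ _ _ _ _ _ g); rewrite -invariant_pull//.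
have := push_conjugate iW g sig Xy; rewrite /push => ->.
by rewrite liftE// deck_cov.
Qed.

Lemma pushforward_out x s : ~ (X' x /\ hsec_at x s) -> pushforward D x s = 0.
Proof. by rewrite /pushforward; case: pselect. Qed.

Lemma pushforward_DO : DO X' k V W (pushforward D).
Proof.
split.
- exact: pushforward_out.
- move=> x a s t; have [y <-] := cov_surj phi x => Xy hs ht.
  have hst : hsec_at (phi y) (a *: s + t) by apply: hsecD => //; exact: hsecZ.
  apply: (@orb_iso_inj _ _ _ _ _ _ _ _ _ _ iW y Xy).
  rewrite linearP !pushforwardE// pullD.
  by have [lin _ _] := Ddop; rewrite lin//; exact: hsec_pull.
- move=> x s; have [y <-] := cov_surj phi x => Xy hs ms.
  apply: (@orb_iso_inj _ _ _ _ _ _ _ _ _ _ iW y Xy).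
  rewrite linear0 pushforwardE//; have [_ kill _] := Ddop.
  by apply: kill => //; exact: pull_mpow.
- move=> U s oU UX hs; apply/(par_sec_punctured _ oU UX).
  apply/(par_sec_tw iW _ _ oU) => y Uy.
  have Xy := UX _ Uy; have [_ _ hol] := Ddop.
  apply/(hols_tw0 iW _ (fun p => pushforward D (phi p) s)).
  exists (opsec D (pullV s)); first by apply: hol => //; apply: hsec_pull => //; exact: hs.
  have : \forall p \near y, U (phi p) by apply: phi_near; apply: open_nbhs_nbhs.
  apply: filterS => p Up _.
  by rewrite pushforwardE//; [exact: UX|exact: hs].
Qed.

Lemma pushforward_par : DO_par phi k V W (pushforward D).
Proof.
split; first exact: pushforward_DO.
(* The extension required over [X] is [D] itself, applied to the holomorphic extension of a section;
   nothing in it depends on the point x. *)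
pose L (sig : fam (fun y : Y => V (phi y))) := lift iW (fun q => D q (ext sig)).
have Lhols y sig : hols iV y sig -> hols iW y (L sig).
  move=> /(hols_ext N_gt0) hs; exists (opsec D (ext sig)).
    by have [_ _ hol] := Ddop; apply: hol => //; case: hs.
  by apply: nearW => p; exact: liftE.
exists (fun _ => L); [split|].
- move=> x sig /(germ_tensE Y_compact pt_inj N_gt0 iV) hs.
  by apply/(germ_tensE Y_compact pt_inj N_gt0 iW) => y /hs; exact: Lhols.
- move=> x a s t [U1 [oU1 U1x] hs] [U2 [oU2 U2x] ht]; apply: mpow_near0.
  have : \forall x' \near x, U1 x' /\ U2 x'.
    by apply: filterI; apply: open_nbhs_nbhs.
  apply: filterS => x' [U1x' U2x'] p Xp px.
  have hsp : hols iV p s by apply: (tensE_hols (sig := s) iV hs); rewrite [phi p]px.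
  have htp : hols iV p t by apply: (tensE_hols (sig := t) iV ht); rewrite [phi p]px.
  have es := hols_ext N_gt0 hsp; have et := hols_ext N_gt0 htp.
  have est : extends_at phi p (push iV (a *: s + t)) (a *: ext s + ext t).
    rewrite pushD; apply: extendsD => //.
    by rewrite -[a *: s]/(fscale (fun=> a) s) pushZ; apply: extendsM => //; exact: hol_cst.
  apply: (@push_inj _ _ _ _ _ _ _ _ _ _ iW (L (a *: s + t) - (a *: L s + L t)) 0 p Xp).
  rewrite push0 /push famD famN famD famZ linearB linearP /= !liftE//.
  have [lin _ _] := Ddop.
  have -> : D p (ext (a *: s + t)) = D p (a *: ext s + ext t).
    apply: (dop_local Ddop) => //; last exact: (extension_near N_gt0 est).
    by case: est.
  by rewrite lin ?subrr//; [case: es|case: et].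
- move=> x sig _ ms.
  have D2 : dop (phi @^-1` setT) setT k.+1 D by apply: dop_sub Ddop.
  apply: (@mpow_dop _ _ _ _ _ _ _ phi Y_compact pt_inj N_gt0 V W VV WW iV iW k.+1 setT x D sig
    (L sig) openT I D2 ms) => p _ Xp.
  by rewrite /push liftE.
- move=> U sig oU hs; exists (L sig).
    apply: (hols_tensE Y_compact pt_inj N_gt0 (iV := iW) oU) => y Uy; apply: Lhols.
    exact: (tensE_hols (sig := sig) iV hs).
  by move=> x Ux; apply: mpow_near0; apply: nearW => x' p _ _; rewrite subrr.
- move=> y s u Xy hs [U [oU Uy] fu].
  apply: (@orb_iso_inj _ _ _ _ _ _ _ _ _ _ iW y Xy).
  rewrite liftE// linearZ /= pushforwardE//.
  have uy : \forall p \near y, u p = u y by exact: fu.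
  have e1 : extends_at phi y (push iV (fun p => (u p : C) *: s (phi p))) (fscale (fun=> u y :
    C) (pullV s)).
    split; first by apply: hsecM; [exact: hol_cst|exact: hsec_pull].
    by move: uy; apply: filterS => p up _; rewrite /push /pull fscaleE up linearZ.
  have -> : D y (ext (fun p => (u p : C) *: s (phi p))) = D y ((u y : C) *: pullV s).
    apply: (dop_local Ddop) => //; first by case: e1.
    exact: (extension_near N_gt0 e1).
  by rewrite (dopZ Ddop)//; exact: hsec_pull.
Qed.
End Invariant.

Lemma pushforward_inj k D1 D2 : DO_inv k VV WW D1 -> DO_inv k VV WW D2 ->
  pushforward D1 = pushforward D2 -> D1 = D2.
Proof.
move=> H1 H2 E; apply: fam_ext => y; apply: funext => s.
have [[out1 _ _ _] _] := H1; have [[out2 _ _ _] _] := H2.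
have [hs|nhs] := pselect (hsec_at y s); last first.
  by rewrite out1 ?out2// => -[].
have d1 : dop setT setT k.+1 D1 by apply: DO_dop; [exact: openT|case: H1].
have d2 : dop setT setT k.+1 D2 by apply: DO_dop; [exact: openT|case: H2].
have eqX p : X' (phi p) -> hsec_at p s -> D1 p s = D2 p s.
  move=> Xp hp; have [s' hs' ss] := hsec_descent iV Y_compact N_gt0 Xp hp.
  have hs2 := hsec_pull iV Xp hs'.
  have ss' : \forall q \near p, s q = pullV s' q by move: ss; apply: filterS => q ->.
  rewrite (dop_local d1 (t := pullV s') I I hs2 ss') (dop_local d2 (t := pullV s') I I hs2 ss').
  by rewrite -(pushforwardE H1)// -(pushforwardE H2)// E.
have [_ _ hol1] := d1; have [_ _ hol2] := d2.
apply: (@hsec_eq _ _ _ y (opsec D1 s) (opsec D2 s)); [exact: hol1|exact: hol2|].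
move: (hsec_at_open hs) (near_phi_punctured phi N_gt0 y); apply: filterS2 => p hp Xp py.
exact: eqX (Xp py) hp.
Qed.

Lemma pushforward_linear k (a : C) D1 D2 : DO_inv k VV WW D1 -> DO_inv k VV WW D2 ->
  pushforward (a *: D1 + D2) = a *: pushforward D1 + pushforward D2.
Proof.
move=> H1 H2; apply: fam_ext => x; apply: funext => s.
have [[Xx hs]|nx] := pselect (X' x /\ hsec_at x s); last first.
  change (pushforward (a *: D1 + D2) x s = a *: pushforward D1 x s + pushforward D2 x s).
  by rewrite !pushforward_out// scaler0 addr0.
change (pushforward (a *: D1 + D2) x s = a *: pushforward D1 x s + pushforward D2 x s).
rewrite /pushforward; case: pselect => [_|[]//].
case: cid => y /= yx; move: Xx hs; rewrite -{}yx => Xy hs; rewrite !atxE.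
apply: (@orb_iso_inj _ _ _ _ _ _ _ _ _ _ iW y Xy).
by rewrite linearP /= !liftE.
Qed.
End Pushforward.

(** * Lifting parabolic operators *)

Section Surjectivity.
Variables (R : realType) (X Y : riemannSurface R) (n : nat) (pt : 'I_n -> X).
Variables (N : 'I_n -> nat) (Gam : finGroupType) (phi : galoisCover Y pt N Gam).
Hypotheses (Y_compact : compact [set: Y]) (pt_inj : injective pt).
Hypothesis N_gt0 : forall i, (0 < N i)%N.
Variables (V W : parBundle pt) (VV WW : orbBundle phi).
Variables (iV : corresponds V VV) (iW : corresponds W WW).
Local Notation C := R[i].
Local Notation Co := (R[i]^o).
Local Notation X' := (punctured pt).
Local Notation SV := (fam (fun y : Y => V (phi y))).
Local Notation SW := (fam (fun y : Y => W (phi y))).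
Local Notation TV := (tensE phi V).
Local Notation TW := (tensE phi W).
Local Notation opY := (fam (fun y : Y => (fam VV -> WW y) : lmodType C)).
Local Notation opX := (fam (fun x : X => (fam V -> W x) : lmodType C)).
Local Notation pullV := (pull (orb_iso iV)).
Implicit Types (x : X) (y p q : Y) (s : fam VV) (t : fam V) (sig : SV).

Variables (k : nat) (D' : opX).
Hypothesis HD' : DO_par phi k V W D'.

Let D'dop : dop X' setT k.+1 D'.
Proof. by apply: DO_dop; [exact: open_punctured|case: HD']. Qed.

Definition descends p s t := hsec_at (phi p) t /\ \forall q \near p, pullV t q = s q.

Lemma descends_uniq p s t1 t2 : X' (phi p) -> descends p s t1 -> descends p s t2 ->
  \forall x \near phi p, t1 x = t2 x.
Proof.
move=> Xp [_ st1] [_ st2]; apply: (phi_open_near Xp).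
move: st1 st2 (phi_near (punctured_near Xp)); apply: filterS3 => q h1 h2 Xq.
apply: (@orb_iso_inj _ _ _ _ _ _ _ _ _ _ iV q Xq).
exact: etrans h1 (esym h2).
Qed.

Lemma descends_exists p s : X' (phi p) -> hsec_at p s -> exists t, descends p s t.
Proof. by move=> Xp /(hsec_descent iV Y_compact N_gt0 Xp)[t ht st]; exists t. Qed.

(** Meant over [X'], where every holomorphic section of [VV] descends locally; [pullback_op] extends
    its values over the ramification points. *)
Definition lifted_op : opY := fun p s =>
  if pselect (exists t, descends p s t) is left h
  then orb_iso iW p (D' (phi p) (projT1 (cid h))) else 0.
Local Notation D0 := lifted_op.

Lemma lifted_opE p s t : X' (phi p) -> descends p s t ->
  D0 p s = orb_iso iW p (D' (phi p) t).
Proof.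
move=> Xp h; rewrite /lifted_op; case: pselect => [e|[]]; last by exists t.
case: cid => t' /= h'; congr (orb_iso iW p _).
apply: (dop_local D'dop) => //; first by case: h.
exact: descends_uniq Xp h' h.
Qed.

Lemma lifted_op_linear p (a : C) s s' : X' (phi p) -> hsec_at p s -> hsec_at p s' ->
  D0 p (a *: s + s') = a *: D0 p s + D0 p s'.
Proof.
move=> Xp hs hs'; have [t ht] := descends_exists Xp hs; have [t' ht'] := descends_exists Xp hs'.
have h : descends p (a *: s + s') (a *: t + t').
  case: ht ht' => [h1 h2] [h1' h2']; split; first by apply: hsecD => //; exact: hsecZ.
  by move: h2 h2'; apply: filterS2 => q e e'; rewrite pullD !(famD, famZ) e e'.
rewrite (lifted_opE Xp h) (lifted_opE Xp ht) (lifted_opE Xp ht').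
by have [lin _ _] := D'dop; rewrite lin ?linearP//; [case: ht|case: ht'].
Qed.

(** Over [X'] the maximal ideal at p is generated by pull-backs: if f is g o w near p and z o phi =
    w, then f descends to g o z. *)
Lemma descends_mpow m p s t : X' (phi p) -> descends p s t ->
  mpow (bundle_omodule VV) m p s -> mpow (bundle_omodule V) m (phi p) t.
Proof.
move=> Xp; elim: m s t => [|m IH] s t st; first by move=> _; apply/germ_bundle; case: st.
move=> /mpow_bundleS[l [f [u [H su]]]].
have [w [z [wp zp wz zw]]] := cov_unram Xp.
have fex i : exists f' : X -> Co, [/\ hol_at (phi p) f', f' (phi p) = 0 & \forall q \near p,
  f' (phi q) = f i q].
  have [hf f0 _] := H i; have [g hg fg] := coord_factor wp hf.
  have [_ w0 _] := wp; have [_ z0 _] := zp.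
  have g0 : g 0 = 0 by rewrite -[RHS]f0 (nbhs_singleton fg) w0.
  exists (g \o z); split.
  - have [c [ac cp] [h hh zh]] := coord_hol zp; exists c => //; exists (g \o h).
      by apply: holC_comp hh _; rewrite -(nbhs_singleton zh) z0.
    by move: zh; apply: filterS => q /= ->.
  - by rewrite /= z0.
  - move: fg (coord_near wp); apply: filterS2 => q -> dq.
    by rewrite /= zw// expr1.
have [f' Hf'] := choice fex.
have uex i : exists t', descends p (u i) t'.
  by apply: descends_exists => //; have [_ _ /mpow_bundle_hsec] := H i.
have [u' Hu'] := choice uex.
apply/mpow_bundleS; exists l, f', u'; split.
  by move=> i; have [h1 h2 _] := Hf' i; have [_ _ h3] := H i; split=> //; exact: IH h3.
apply: (phi_open_near Xp).
have nf : \forall q \near p, forall i, f' i (phi q) = f i q.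
  by apply: filter_forall => i; have [] := Hf' i.
have nu : \forall q \near p, forall i, pullV (u' i) q = u i q.
  by apply: filter_forall => i; have [] := Hu' i.
have nt : \forall q \near p, pullV t q = s q /\ X' (phi q).
  by case: st => _ st; move: st (phi_near (punctured_near Xp)); apply: filterS2.
have nsu : \forall q \near p, (forall i,
  f' i (phi q) = f i q) /\ s q = \sum_(i < l) (f i q : C) *: u i q.
  by move: nf su; apply: filterS2.
move: nsu nu nt; apply: filterS3 => q [hf sq] hu [tq Xq].
apply: (@orb_iso_inj _ _ _ _ _ _ _ _ _ _ iV q Xq).
rewrite -[LHS]/(pullV t q) tq sq linear_sum; apply: eq_bigr => i _.
by rewrite linearZ /= hf -(hu i).
Qed.

Section Jets.
Variable L : X -> SV -> SW.
Hypothesis HL : jet_hom k (F := TV) (G := TW) L.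
Hypothesis L_ext : extends_tilde D' L.

(** [L] is prescribed only on products of a flat function with a pull-back. Near x, [sig] is a
    finite sum of such products, one for each point of the fibre, the flat factor being the
    indicator of its disc. At [p] only the disc of [p] contributes, and there the descended section
    is chosen to be [t]. *)
Lemma jet_eval p sig t : X' (phi p) -> germ TV (phi p) sig -> hsec_at (phi p) t ->
  (\forall q \near p, sig q = t (phi q)) -> L (phi p) sig p = D' (phi p) t.
Proof.
move=> Xp gs ht st; set x := phi p.
have [gL linL killL _] := HL.
have gP u := germ_tensE Y_compact pt_inj N_gt0 iV x u.
have evlin (a : C) (u v : SV) : germ TV x u -> germ TV x v ->
    L x (a *: u + v) p = a *: L x u p + L x v p.
  move=> hu hv; have := linL x a u v hu hv.
  move=> /(@mpow1_tensE_eval _ _ _ _ _ _ _ phi W p (L x (a *: u + v) - (a *: L x u + L x v))) -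
    /(_ Xp).
  by rewrite famD famN famD famZ => /eqP; rewrite subr_eq0 => /eqP.
have g0 : germ TV x 0.
  by apply/gP => y _; exists 0; [exact: hsec0|apply: nearW => q _; exact: linear0].
have gD (a : C) (u v : SV) : germ TV x u -> germ TV x v -> germ TV x (a *: u + v).
  move=> /gP hu /gP hv; apply/gP => y yx; apply/holsP.
  have [tu hu'] := (holsP iV y u).1 (hu y yx); have [tv hv'] := (holsP iV y v).1 (hv y yx).
  exists (fscale (fun=> a) tu + tv); rewrite pushD; apply: extendsD => //.
  by rewrite -[a *: u]/(fscale (fun=> a) u) pushZ; apply: extendsM => //; exact: hol_cst.
have ev0 u : germ TV x u -> om_near (F := TV) x u 0 -> L x u p = 0.
  move=> gu u0; apply: (@mpow1_tensE_eval _ _ _ _ _ _ _ phi W p (L x u)) => //.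
  by apply: killL => //; exact: mpow_near0.
have evnear u v : germ TV x u -> germ TV x v -> om_near (F := TV) x u v -> L x u p = L x v p.
  move=> gu gv uv; have gvu : germ TV x ((-1) *: v + u) by exact: gD.
  have : L x ((-1) *: v + u) p = 0.
    apply: ev0 => //; move: uv; apply: filterS => x' h q dq qx.
    by rewrite famD famZ (h q dq qx) scaleN1r addNr.
  by rewrite evlin// scaleN1r addrC => /eqP; rewrite subr_eq0 => /eqP.
have evsum (r : seq Y) (G : Y -> SV) : (forall y, y \in r -> germ TV x (G y)) ->
    germ TV x (\sum_(y <- r) G y) /\ L x (\sum_(y <- r) G y) p = \sum_(y <- r) L x (G y) p.
  elim: r => [_|y r IH Hr].
    by rewrite !big_nil; split=> //; apply: ev0 => //; exact: nearW.
  have [|g e] := IH; first by move=> y' hy'; apply: Hr; rewrite in_cons hy' orbT.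
  have gy := Hr y (mem_head y r).
  have := gD 1 _ _ gy g; have := evlin 1 _ _ gy g; rewrite !scale1r => e1 g1.
  by rewrite !big_cons; split=> //; rewrite e1 e.
have dex y : exists u : fam V, phi y = x -> [/\ hsec_at x u,
    \forall q \near y, sig q = u (phi q) & y = p -> u = t].
  have [yp|yp] := pselect (y = p); first by exists t => _; rewrite yp.
  have [yx|] := pselect (phi y = x); last by exists 0.
  have Xy : X' (phi y) by rewrite yx.
  have [tau htau stau] := (gP sig).1 gs y yx.
  have [u [hu su]] := descends_exists Xy htau.
  exists u => _; split=> //; first by rewrite -yx.
  move: su stau (phi_near (punctured_near Xy)); apply: filterS3 => q su stau Xq.
  apply: (@orb_iso_inj _ _ _ _ _ _ _ _ _ _ iV q Xq).
  by rewrite (stau Xq) -su.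
have [u Hu] := choice dex.
have [|U [D [[oU Ux] HD Ddisj Dcov]]] := @fibre_nbhs _ _ _ _ _ _ _ phi Y_compact x
  (fun y q => sig q = u y (phi q)).
  by move=> y /Hu[].
have oD y : phi y = x -> open (D y) by move=> /HD[].
have Dnear y q := @disc_near _ _ _ _ _ _ _ phi x U D y q oD Ddisj Dcov.
pose c y q : Co := if `[< D y q >] then 1 else 0.
pose G y : SV := fun q => (c y q : C) *: u y (phi q).
have gG y : y \in fibre phi x -> germ TV x (G y).
  move=> /mem_fibre yx; apply/gP => y' y'x.
  have [hu _ _] := Hu y yx.
  case: (Dnear y y' yx) => [|nD|nD]; first by rewrite y'x.
    exists (pullV (u y)); first by apply: hsec_pull; rewrite y'x.
    by move: nD; apply: filterS => q Dq _; rewrite /G /c asboolT// scale1r.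
  exists 0; first exact: hsec0.
  by move: nD; apply: filterS => q Dq _; rewrite /G /c asboolF// scale0r linear0.
have [gsum esum] := evsum (fibre phi x) G gG.
rewrite (evnear sig (\sum_(y <- fibre phi x) G y))//; last first.
  have : \forall x' \near x, U x' by apply: open_nbhs_nbhs.
  apply: filterS => x' Ux' q _ qx.
  have Uq : U (phi q) by rewrite [phi q]qx.
  have [y yx Dq] := Dcov q Uq.
  rewrite fam_sum (bigD1_seq y) ?fibre_uniq ?(proj2 (mem_fibre _ _ _))//=.
  rewrite big1_seq ?addr0 => [|y' /andP[y'y /mem_fibre y'x]].
    by rewrite /G /c asboolT// scale1r; have [_ _ h] := HD y yx; exact: h.
  rewrite /G /c asboolF ?scale0r// => Dq'.
  by move: y'y; rewrite (Ddisj _ _ _ y'x yx Dq' Dq) eqxx.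
rewrite esum.
have eG y : y \in fibre phi x -> L x (G y) p = (c y p : C) *: D' x (u y).
  move=> /mem_fibre yx; have [hu _ _] := Hu y yx.
  apply: L_ext => //; exists U => // q Uq.
  case: (Dnear y q yx Uq) => nD; have Dq := nbhs_singleton nD; move: nD; apply: filterS => q' Dq'.
    by rewrite /c !asboolT.
  by rewrite /c !asboolF.
have px : p \in fibre phi x by apply/mem_fibre.
rewrite (bigD1_seq p) ?fibre_uniq//= big1_seq ?addr0 => [|y /andP[yp yf]].
  rewrite eG//; have [_ Dpp _] := HD p erefl; rewrite /c asboolT// scale1r.
  by have [_ _ ->] := Hu p erefl.
rewrite eG// /c asboolF ?scale0r// => Dyp; have [_ Dpp _] := HD p erefl.
have yx : phi y = x by apply/mem_fibre.
by move: yp; rewrite (Ddisj y p p yx erefl Dyp Dpp) eqxx.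
Qed.

(* [s], cut off to one point [y] of the fibre, is a germ of [(V (x) E)_0], and its image
   under [L] extends [lifted_op s] over [y]. *)
Lemma lifted_op_extends y s : hsec_at y s -> exists tau, extends_at phi y (opsec D0 s) tau.
Proof.
move=> hs; set x := phi y.
have [sig sigE] := push_surj iV s.
have [|U [D [[oU Ux] HD Ddisj Dcov]]] := @fibre_nbhs _ _ _ _ _ _ _ phi Y_compact x
  (fun y' p => y' = y -> hsec_at p s).
  by move=> y' _; have [->|yy] := pselect (y' = y); [move: (hsec_at_open hs);
    apply: filterS|exact: nearW].
have oD y' : phi y' = x -> open (D y') by move=> /HD[].
have [_ Dy DO] := HD y erefl.
pose sig1 : SV := fun p => (if `[< D y p >] then 1 else 0 : C) *: sig p.
have h1 p : U (phi p) -> hols iV p sig1.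
  move=> Up; case: (disc_near oD Ddisj Dcov (erefl : phi y = x) Up) => nD.
    exists s; first by apply: DO => //; exact: nbhs_singleton nD.
    by move: nD; apply: filterS => q Dq Xq; rewrite /sig1 asboolT// scale1r -sigE.
  exists 0; first exact: hsec0.
  by move: nD; apply: filterS => q Dq Xq; rewrite /sig1 asboolF// scale0r linear0.
have hs1 : @om_sec R X TV U sig1 := hols_tensE Y_compact pt_inj N_gt0 oU h1.
have [_ _ _ /(_ U sig1 oU hs1)[t ht Lt]] := HL.
have [tau htau ttau] := tensE_hols (sig := t) iW ht Ux.
exists tau; split=> //.
have nU : \forall p \near y, U (phi p) /\ D y p.
  have nU : \forall p \near y, U (phi p) by apply: phi_near; apply: open_nbhs_nbhs.
  have nD : \forall p \near y, D y p by apply: open_nbhs_nbhs; split=> //; exact: oD.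
  by move: nU nD; apply: filterS2.
move: nU ttau; apply: filterS2 => p [Up Dp] ttau Xp.
have hp : hsec_at p s by exact: DO.
have [s' hs'] := descends_exists Xp hp.
rewrite -(ttau Xp) /opsec (lifted_opE Xp hs'); congr (orb_iso iW p _).
have -> : t p = L (phi p) sig1 p.
  have := @mpow1_tensE_eval _ _ _ _ _ _ _ phi W p (L (phi p) sig1 - t) (Lt (phi p) Up) Xp.
  by rewrite famD famN => /eqP; rewrite subr_eq0 => /eqP ->.
apply/esym/jet_eval => //; first by exists U.
  by case: hs'.
have nD : \forall q \near p, D y q by apply: open_nbhs_nbhs; split=> //; exact: oD.
case: hs' => _ hs'; move: nD hs' (phi_near (punctured_near Xp)); apply: filterS3 => q Dq hq Xq.
rewrite /sig1 asboolT// scale1r; apply: (@orb_iso_inj _ _ _ _ _ _ _ _ _ _ iV q Xq).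
by rewrite -[LHS]/(push iV sig q) sigE// -hq.
Qed.
End Jets.

Definition pullback_op : opY := fun y s =>
  if pselect (hsec_at y s) is left _ then extension phi (opsec D0 s) y else 0.

Let D0_ext y s : hsec_at y s -> extends_at phi y (opsec D0 s) (extension phi (opsec D0 s)).
Proof.
case: HD' => _ [L HL L_ext] hs; have [tau h] := lifted_op_extends HL L_ext hs.
exact: extends_extension h.
Qed.

Lemma pullback_op_extends y s : hsec_at y s ->
  extends_at phi y (opsec D0 s) (opsec pullback_op s).
Proof.
move=> hs; have [h1 h2] := D0_ext hs.
have e : \forall p \near y, opsec pullback_op s p = extension phi (opsec D0 s) p.
  move: (hsec_at_open hs); apply: filterS => p hp.
  by rewrite /opsec /pullback_op; case: pselect.
split; first exact: hsec_near e h1.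
by move: e h2; apply: filterS2 => p -> h Xp; exact: h.
Qed.

Lemma pullback_op_punctured y s : X' (phi y) -> hsec_at y s -> pullback_op y s = D0 y s.
Proof. by move=> Xy /pullback_op_extends[_ /nbhs_singleton h]; exact: esym (h Xy). Qed.

Lemma pullback_op_dop : dop setT [set y | X' (phi y)] k.+1 pullback_op.
Proof.
split=> [y a s s' _ hs hs'|y s _ Xy ms|y s _ hs].
- have [e1 e1'] := pullback_op_extends hs; have [e2 e2'] := pullback_op_extends hs'.
  have hss : hsec_at y (a *: s + s') by apply: hsecD => //; exact: hsecZ.
  have [e3 e3'] := pullback_op_extends hss.
  apply: (@hsec_eq _ _ _ y (opsec pullback_op (a *: s + s'))
    (a *: opsec pullback_op s + opsec pullback_op s')) => //.
    by apply: hsecD => //; exact: hsecZ.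
  have nh : \forall p \near y, hsec_at p s /\ hsec_at p s'.
    by move: (hsec_at_open hs) (hsec_at_open hs'); apply: filterS2.
  move: nh (near_phi_punctured phi N_gt0 y); apply: filterS2 => p [hp hp'] Xp /Xp{}Xp.
  rewrite famD famZ /opsec !pullback_op_punctured//; first exact: lifted_op_linear.
  by apply: hsecD => //; exact: hsecZ.
- have hs := mpow_bundle_hsec ms; have [t ht] := descends_exists Xy hs.
  rewrite pullback_op_punctured// (lifted_opE Xy ht).
  have [_ kill _] := D'dop; rewrite kill ?linear0//.
  exact: descends_mpow ht ms.
- by have [] := pullback_op_extends hs.
Qed.

Lemma pullback_op_inv : DO_inv k VV WW pullback_op.
Proof.
have Pdop := pullback_op_dop; have [lin kill hol] := Pdop; split; [split|].
- by move=> y s ns; rewrite /pullback_op; case: pselect => // hs; case: ns.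
- by move=> y a s t _; exact: lin.
- move=> y s _ _ ms; apply: (dop_extend (B := [set y | X' (phi y)]) filterT _ Pdop ms).
  exact: near_phi_punctured.
- by move=> U s _ _ hs y Uy; apply: (hol y) => //; exact: hs.
move=> g y s t hs tE; have [h1 _] := pullback_op_extends hs.
have [u uE] := translate g (opsec pullback_op s).
have hu := orb_act_hol h1 uE; have ht := orb_act_hol hs tE.
have [h2 _] := pullback_op_extends ht.
(* Both sides are holomorphic sections of [WW], so by continuity it is enough to compare them over
   [X']. *)
rewrite -[RHS](uE y); apply: (@hsec_eq _ _ _ _ (opsec pullback_op t) u) => //.
have nh : \forall q \near deck phi g y, hsec_at (deck phi g^-1%g q) s.
  apply: (@deck_near _ _ _ _ _ _ _ phi g^-1%g _ (fun q => hsec_at q s)).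
  by rewrite deckK; exact: hsec_at_open.
move: nh (near_phi_punctured phi N_gt0 (deck phi g y)) (hsec_at_open ht).
apply: filterS3 => q hq Xq htq /Xq{}Xq.
have qE := deckVK phi g q; move: (deck phi g^-1%g q) qE hq => p qE hp.
rewrite -{q}qE in Xq htq *.
have Xp : X' (phi p) by rewrite -(deck_cov phi g).
have [s' hs'] := descends_exists Xp hp.
rewrite uE /opsec !pullback_op_punctured// (lifted_opE Xp hs').
(* A pull-back is invariant over [X'], so [s] and its translate descend to the same section of V. *)
have hs'g : descends (deck phi g p) t s'.
  case: hs' => h h'; split; first by rewrite deck_cov.
  have nX : \forall q \near deck phi g p, X' (phi q).
    by apply: phi_near; exact: punctured_near.
  have ng : \forall q \near deck phi g p, pullV s' (deck phi g^-1%g q) = s (deck phi g^-1%g q).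
    apply: (@deck_near _ _ _ _ _ _ _ phi g^-1%g _ (fun q => pullV s' q = s q)).
    by rewrite deckK.
  move: nX ng; apply: filterS2 => q; have qE := deckVK phi g q.
  move: (deck phi g^-1%g q) qE => r <- Xr hr.
  by rewrite tE -hr (orb_iso_equiv iV)// -(deck_cov phi g).
rewrite (lifted_opE Xq hs'g).
have := orb_iso_equiv iW g (fun x => D' x s') Xp.
by rewrite /pull => ->.
Qed.

Lemma pushforward_pullback_op : pushforward iV iW pullback_op = D'.
Proof.
apply: fam_ext => x; apply: funext => s.
have [[out _ _ _] _] := HD'.
have [[Xx hs]|nx] := pselect (X' x /\ hsec_at x s); last first.
  by rewrite out// pushforward_out.
have [y yx] := cov_surj phi x; move: Xx hs; rewrite -{}yx => Xy hs.
apply: (@orb_iso_inj _ _ _ _ _ _ _ _ _ _ iW y Xy).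
have hp := hsec_pull iV Xy hs.
rewrite (pushforwardE iV iW pullback_op_inv Xy hs).
rewrite pullback_op_punctured//; apply: lifted_opE => //; split=> //.
exact: nearW.
Qed.
End Surjectivity.

Theorem proposition5p2 (R : realType) (X Y : riemannSurface R)
    (n : nat) (pt : 'I_n -> X) (N : 'I_n -> nat) (Gam : finGroupType)
    (phi : galoisCover Y pt N Gam)
    (V W : parBundle pt) (VV WW : orbBundle phi)
    (iV : corresponds V VV) (iW : corresponds W WW) (k : nat)
    (X_compact : compact [set: X]) (Y_compact : compact [set: Y])
    (n_ge1 : (1 <= n)%N) (pt_inj : injective pt)
    (genus0 : has_genus X 0 -> (3 <= n)%N)
    (N_ge2 : forall i, (2 <= N i)%N)
    (V_weights : weights_in N V) (W_weights : weights_in N W) :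
  exists T : fam (fun y : Y => (fam VV -> WW y) : lmodType R[i]) ->
             fam (fun x : X => (fam V -> W x) : lmodType R[i]),
    [/\ forall D, DO_inv k VV WW D ->
          forall (y : Y) (s : fam V), punctured pt (phi y) -> hsec_at (phi y) s ->
            orb_iso iW y (T D (phi y) s) = D y (pull (orb_iso iV) s),
        forall (a : R[i]) D1 D2, DO_inv k VV WW D1 -> DO_inv k VV WW D2 ->
          T (a *: D1 + D2) = a *: T D1 + T D2
      & set_bij (DO_inv k VV WW) (DO_par phi k V W) T].
Proof.
have N_gt0 i : (0 < N i)%N by exact: ltnW.
exists (pushforward iV iW); split.
- by move=> D HD y s Xy hs; exact: (pushforwardE iV iW HD Xy hs).
- by move=> a D1 D2; exact: pushforward_linear.
split.
- by move=> D HD; exact: pushforward_par.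
- by move=> D1 D2 /set_mem H1 /set_mem H2; exact: pushforward_inj H1 H2.
- move=> D' HD'; exists (pullback_op iV iW D').
    exact: pullback_op_inv.
  exact: pushforward_pullback_op HD'.
Qed.
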